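(* Let $a,u,v\in\mathbb C$ with $0<|a|<1$ and $|u|<\frac12$, put $\varphi(z)=az$, $\psi(z)=\exp(uz^2+vz)$, and suppose that $c=\frac{u}{1-a^2}$ is real with $c\in[0,\frac12)$ and that the weighted composition operator $W_{\psi,\varphi}$ is bounded on $\mathcal F^2$. Then the point spectra satisfy $$\sigma_p(W_{\psi,\varphi})=\{a^n:n\ge0\},\qquad \sigma_p(W_{\psi,\varphi}^* )=\{\overline a^{\,n}:n\ge0\}.$$
   Context: $\mathcal F^2$ is the Fock space of all entire functions $f$ on $\mathbb C$ with $\|f\|^2=\frac1\pi\int_{\mathbb C}|f(z)|^2e^{-|z|^2}\,dA(z)<\infty$ ($dA$ = area measure), with inner product $\langle f,g\rangle=\frac1\pi\int_{\mathbb C}f(z)\overline{g(z)}e^{-|z|^2}\,dA(z)$. For entire $\psi,\varphi$, $W_{\psi,\varphi}f=\psi\cdot(f\circ\varphi)$. $\sigma_p(T)$ is the set of eigenvalues of $T$. *)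

(* Defs.v *)
From HB Require Import structures.
From mathcomp Require Import all_boot all_order all_algebra.
From mathcomp Require Import complex.
From mathcomp Require Import all_classical all_reals all_analysis.

Set Implicit Arguments.
Unset Strict Implicit.
Unset Printing Implicit Defensive.

Import Order.TTheory GRing.Theory Num.Theory.
Import numFieldNormedType.Exports.

Local Open Scope classical_set_scope.
Local Open Scope ring_scope.
Local Open Scope complex_scope.

Section FockSpace.
Context {R : realType}.
Implicit Types (f g psi phi : R[i] -> R[i])
  (T S : (R[i] -> R[i]) -> R[i] -> R[i]).

Definition cexp (z : R[i]) : R[i] :=
  (expR (complex.Re z))%:C * (cos (complex.Im z) +i* sin (complex.Im z)).

(* The topology and norm on the complex numbers are those of [R[i]^o], so
   [derivable _ z 1] is differentiability with respect to a complex increment. *)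
Definition entire f : Prop :=
  forall z : R[i]^o, derivable (f : R[i]^o -> R[i]^o) z 1.

Definition area :
    {measure set (measurableTypeR R * measurableTypeR R) -> \bar R} :=
  (@lebesgue_measure R \x @lebesgue_measure R)%E.

Definition cintegral f : R[i] :=
  Rintegral area setT (fun p => complex.Re (f (p.1 +i* p.2))) +i*
  Rintegral area setT (fun p => complex.Im (f (p.1 +i* p.2))).

Definition fock_sqnorm f : \bar R :=
  ((pi^-1)%:E * \int[area]_p
     (Normc.normc (f (p.1 +i* p.2)) ^+ 2 *
      expR (- Normc.normc (p.1 +i* p.2) ^+ 2))%:E)%E.

Definition fock : set (R[i] -> R[i]) :=
  [set f | entire f /\ (fock_sqnorm f < +oo)%E].

Definition fock_norm f : R := Num.sqrt (fine (fock_sqnorm f)).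

Definition fock_inner f g : R[i] :=
  (pi^-1)%:C *
  cintegral (fun z => f z * conjc (g z) * (expR (- Normc.normc z ^+ 2))%:C).

Definition wcomp psi phi f : R[i] -> R[i] := fun z => psi z * f (phi z).

Definition bounded_on_fock T : Prop :=
  (forall f, fock f -> fock (T f)) /\
  exists M : R, forall f, fock f -> fock_norm (T f) <= M * fock_norm f.

Definition is_adjoint T S : Prop :=
  (forall g, fock g -> fock (S g)) /\
  (forall f g, fock f -> fock g -> fock_inner (T f) g = fock_inner f (S g)).

(* Operators are represented by maps on all functions and only their values on
   [fock] matter; these are determined by [is_adjoint], as [fock_inner] is
   positive definite there.  The identity is used if there is no adjoint,
   which does not occur for a bounded linear [T]. *)
Definition adjoint T : (R[i] -> R[i]) -> R[i] -> R[i] :=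
  xget (fun f => f) [set S | is_adjoint T S].

Definition point_spectrum T : set R[i] :=
  [set l | exists f, [/\ fock f, f <> (fun=> 0) & T f = (fun z => l * f z)]].

End FockSpace.

(* Main.v *)
From HB Require Import structures.
Require Import Defs.
From mathcomp Require Import all_boot all_order all_algebra.
From mathcomp Require Import complex.
From mathcomp Require Import all_classical all_reals all_analysis.
From mathcomp Require Import measurable_realfun gauss_integral.
From mathcomp Require Import ring lra.
Set Implicit Arguments.
Unset Strict Implicit.
Unset Printing Implicit Defensive.
Import Order.TTheory GRing.Theory Num.Theory.
Import numFieldNormedType.Exports.
Local Open Scope classical_set_scope.
Local Open Scope ring_scope.
Local Open Scope complex_scope.

(** Let d = v / (1 - a) and f0(z) = exp(c z^2 + d z).  Since psi(z) f0(a z) = f0(z),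
    the functions z^n f0 are eigenvectors of W for a^n.  If W f = l f, then
    h = f / f0 is entire and h(a z) = l h(z), so l = a^n for every n such that
    the n-th Taylor coefficient of h does not vanish.

    The vectors z^n f0 span a dense subspace, hence an eigenvector g of W^* is
    not orthogonal to all of them and its eigenvalue is the conjugate of some
    a^n.  Conversely, let L_n(f) be the n-th Taylor coefficient of f / f0; this
    is a bounded functional with L_n(W f) = a^n L_n(f), so the vector that
    represents it is an eigenvector of W^* for the conjugate of a^n.

    Taylor coefficients are defined as means over circles; these are computed
    by Goursat's theorem for rectangles in the variable log z, so no power
    series are needed.  Averaging over rotations turns the mean value property
    into the reproducing property f(w) = <f, exp(conj(w) z)>, which yields the
    completeness of the Fock space and thus the existence of the adjoint.  For
    the density, exp(w z) is reached from f0 by finitely many multiplications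
    by exp(-delta z^2), with delta so small that the exponential series can be
    integrated term by term against a vector of the Fock space. *)

(** The bound c < 1/2 puts the vectors z^n f0 into the space, but division by f0 leads out of it:
    the quotient h = f / f0 is only known to be O(exp((1 + c)|z|^2 + B|z|)) for some B, by point
    evaluation. So that the vanishing of all Taylor coefficients of h can still be exploited inside
    the Hilbert space, h is replaced by h(z / 2), whose exponent (1 + c) / 4 is below 1/2. This
    function is orthogonal to all monomials, and the density theorem with c = d = 0 makes it zero.

    The same density theorem thus serves both spectra, once for the monomials and once for the z^n
    f0. Normalising constants are carried along rather than evaluated: circle means keep the factor
    2 pi, inner products lack 1 / pi, and the total Gaussian mass enters the reproducing formula as
    a positive number. *)

Local Notation normc := Normc.normc.

(** * Complex exponential and curves *)

Section ComplexNorm.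
Context {R : realType}.
Local Notation C := R[i].
Implicit Types (z w : C) (x y t : R).

Lemma normE z : `|z| = (normc z)%:C. Proof. by []. Qed.

Lemma normc_ge0 z : 0 <= normc z.
Proof. by case: z => x y; exact: sqrtr_ge0. Qed.

Lemma normcD z w : normc (z + w) <= normc z + normc w.
Proof. exact: le_normcD. Qed.

Lemma normcX z n : normc (z ^+ n) = normc z ^+ n.
Proof.
elim: n => [|n IH]; first by rewrite !expr0 Normc.normc1.
by rewrite !exprS Normc.normcM IH.
Qed.

Lemma normc_opp z : normc (- z) = normc z.
Proof. by case: z => x y /=; rewrite !sqrrN. Qed.

Lemma normcB z w : normc (z - w) <= normc z + normc w.
Proof. by rewrite -(normc_opp w); exact: normcD. Qed.

Lemma normc_sq z : normc z ^+ 2 = complex.Re z ^+ 2 + complex.Im z ^+ 2.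
Proof. by case: z => x y /=; rewrite sqr_sqrtr // addr_ge0 // sqr_ge0. Qed.

Lemma normc_conj z : normc (conjc z) = normc z.
Proof. by case: z => x y /=; rewrite sqrrN. Qed.

Lemma normc_real x : normc x%:C = `|x|.
Proof. by rewrite /= expr0n /= addr0 sqrtr_sqr. Qed.

Lemma Re_le_normc z : complex.Re z <= normc z.
Proof.
rewrite (le_trans (ler_norm _)) // -ler_sqr ?nnegrE ?normc_ge0 //.
by rewrite normc_sq real_normK ?num_real // lerDl sqr_ge0.
Qed.

Lemma normRe_le_normc z : `|complex.Re z| <= normc z.
Proof.
rewrite -ler_sqr ?nnegrE ?normc_ge0 //.
by rewrite normc_sq real_normK ?num_real // lerDl sqr_ge0.
Qed.

Lemma normIm_le_normc z : `|complex.Im z| <= normc z.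
Proof.
rewrite -ler_sqr ?nnegrE ?normc_ge0 //.
by rewrite normc_sq real_normK ?num_real // lerDr sqr_ge0.
Qed.

Lemma normc_le_ReIm z : normc z <= `|complex.Re z| + `|complex.Im z|.
Proof.
case: z => x y; rewrite -ler_sqr ?nnegrE ?normc_ge0 ?addr_ge0 //.
rewrite normc_sq /= -(real_normK (num_real x)) -(real_normK (num_real y)).
by have := normr_ge0 x; have := normr_ge0 y; nra.
Qed.

Lemma normc_eq0 z : (normc z == 0) = (z == 0).
Proof.
apply/eqP/eqP => [|->]; [exact: Normc.eq0_normc|exact: Normc.normc0].
Qed.

Lemma normc_gt0 z : (0 < normc z) = (z != 0).
Proof. by rewrite lt_neqAle normc_ge0 andbT eq_sym normc_eq0. Qed.

Lemma ReD z w : complex.Re (z + w) = complex.Re z + complex.Re w.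
Proof. by case: z w => ? ? [? ?]. Qed.
Lemma ImD z w : complex.Im (z + w) = complex.Im z + complex.Im w.
Proof. by case: z w => ? ? [? ?]. Qed.
Lemma ReN z : complex.Re (- z) = - complex.Re z.
Proof. by case: z. Qed.
Lemma ImN z : complex.Im (- z) = - complex.Im z.
Proof. by case: z. Qed.
Lemma ReM z w : complex.Re (z * w) =
  complex.Re z * complex.Re w - complex.Im z * complex.Im w.
Proof. by case: z w => ? ? [? ?]. Qed.
Lemma ImM z w : complex.Im (z * w) =
  complex.Re z * complex.Im w + complex.Im z * complex.Re w.
Proof. by case: z w => ? ? [? ?]. Qed.
Lemma eqc z w : complex.Re z = complex.Re w -> complex.Im z = complex.Im w ->
  z = w.
Proof. by case: z w => ? ? [? ?] /= -> ->. Qed.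
(** Reduces an estimate of a complex quantity to real estimates, for curves as well as for
    integrals. The extremal multiplier is conj(z) / |z|. *)
Lemma normc_le_dual z r :
  (forall u, normc u <= 1 -> complex.Re (u * z) <= r) -> normc z <= r.
Proof.
move=> H; have [->|z0] := eqVneq z 0.
  by rewrite Normc.normc0 -[0](_ : complex.Re (0 * (0 : C)) = 0) ?mul0r //;
     have := H 0; rewrite Normc.normc0 mul0r /= => /(_ ler01).
have nz : normc z != 0 by rewrite normc_eq0.
have := H ((normc z)^-1%:C * conjc z).
rewrite Normc.normcM normc_real normc_conj ger0_norm ?invr_ge0 ?normc_ge0 //.
rewrite mulVf // lexx => /(_ isT).
suff -> : (normc z)^-1%:C * conjc z * z = (normc z)%:C by [].
apply/(mulfI (x := (normc z)%:C)); first by rewrite eq_complex /= negb_and nz.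
rewrite 2!mulrA -rmorphM divff // mul1r -rmorphM -expr2 normc_sq.
by case: z {H z0 nz} => x y; apply: eqc => /=; ring.
Qed.

Lemma cexp_norm z : normc (cexp z) = expR (complex.Re z).
Proof.
rewrite /cexp Normc.normcM normc_real gtr0_norm ?expR_gt0 //=.
by rewrite cos2Dsin2 sqrtr1 mulr1.
Qed.

Lemma cexpD z w : cexp (z + w) = cexp z * cexp w.
Proof.
case: z w => x y [x' y']; rewrite /cexp /= expRD cosD sinD.
by apply: eqc => /=; ring.
Qed.

Lemma cexp0 : cexp (0 : C) = 1.
Proof. by rewrite /cexp /= expR0 cos0 sin0 mul1r. Qed.

Lemma cexpNK z : cexp (- z) * cexp z = 1.
Proof. by rewrite -cexpD addNr cexp0. Qed.

Lemma cexp_neq0 z : cexp z != 0.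
Proof. by rewrite -normc_eq0 cexp_norm gt_eqF ?expR_gt0. Qed.

Lemma cexp_normle z : normc (cexp z) <= expR (normc z).
Proof. by rewrite cexp_norm ler_expR Re_le_normc. Qed.

Lemma conjc_cexp z : conjc (cexp z) = cexp (conjc z).
Proof. by case: z => x y; rewrite /cexp /= cosN sinN; apply: eqc => /=; ring. Qed.

Lemma cexpMn z n : cexp (n%:R * z) = cexp z ^+ n.
Proof.
elim: n => [|n IH]; first by rewrite mul0r cexp0 expr0.
by rewrite -natr1 mulrDl mul1r cexpD IH exprSr.
Qed.

End ComplexNorm.

Section CurveDerivative.
Context {R : realType}.
Local Notation C := R[i].
Implicit Types (c f g : R -> C) (t : R) (z l m : C).

Definition cderive c t l :=
  is_derive t 1 (fun s => complex.Re (c s)) (complex.Re l) /\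
  is_derive t 1 (fun s => complex.Im (c s)) (complex.Im l).

Lemma is_derive_eqv (f g : R -> R) t (d e : R) :
  is_derive t 1 f d -> f =1 g -> d = e -> is_derive t 1 g e.
Proof. by move=> + /funext <- <-. Qed.

Lemma cderive_eq f g t l m : cderive f t l -> f =1 g -> l = m -> cderive g t m.
Proof. by move=> + /funext <- <-. Qed.

Lemma cderiveD f g t l m : cderive f t l -> cderive g t m ->
  cderive (fun s => f s + g s) t (l + m).
Proof.
move=> [rf imf] [rg img]; split.
- by apply: (is_derive_eqv (is_deriveD rf rg)) => [s|]; rewrite ReD.
- by apply: (is_derive_eqv (is_deriveD imf img)) => [s|]; rewrite ImD.
Qed.

Lemma cderiveZ z f t l : cderive f t l -> cderive (fun s => z * f s) t (z * l).
Proof.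
move=> [rf imf]; split.
- apply: (is_derive_eqv (is_deriveB
    (is_deriveZ (complex.Re z) rf) (is_deriveZ (complex.Im z) imf))) => [s|];
  by rewrite ReM.
- apply: (is_derive_eqv (is_deriveD
    (is_deriveZ (complex.Re z) imf) (is_deriveZ (complex.Im z) rf))) => [s|];
  by rewrite ImM.
Qed.

Lemma cderiveB f g t l m : cderive f t l -> cderive g t m ->
  cderive (fun s => f s - g s) t (l - m).
Proof.
move=> fl gm; apply: (cderive_eq (cderiveD fl (cderiveZ (-1) gm))) => [s|];
by rewrite mulN1r.
Qed.

Lemma cderive_cst z t : cderive (fun=> z) t 0.
Proof. by split; exact: is_derive_cst. Qed.

Lemma cderive_real (f : R -> R) t (l : R) z : is_derive t 1 f l ->
  cderive (fun s => (f s)%:C * z) t (l%:C * z).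
Proof.
move=> fl; rewrite mulrC.
apply: (cderive_eq (f := fun s => z * (f s)%:C)) => [|s|]; last 2 first.
- by rewrite mulrC.
- by [].
by apply: cderiveZ; split => //; exact: is_derive_cst.
Qed.

Lemma cderive_cexp z t : cderive (fun s => cexp (s%:C * z)) t (z * cexp (t%:C * z)).
Proof.
case: z => x y.
have dl (k : R) : is_derive t 1 (fun s : R => s * k) k.
  apply: (is_derive_eqv (is_deriveZ k (is_derive_id t 1))) => [s|].
    by rewrite /= /GRing.scale /= mulrC.
  by rewrite /GRing.scale /= mulr1.
have de := is_derive1_comp (is_derive_expR _) (dl x).
have dc := is_derive1_comp (is_derive_cos _) (dl y).
have ds := is_derive1_comp (is_derive_sin _) (dl y).
split.
- apply: (is_derive_eqv (is_deriveM de dc)) => [s|].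
    by rewrite /cexp /= !mul0r ?subr0 ?addr0.
  by rewrite /cexp /= /GRing.scale /= !mul0r ?subr0 ?addr0; ring.
- apply: (is_derive_eqv (is_deriveM de ds)) => [s|].
    by rewrite /cexp /= !mul0r !subr0 !addr0.
  by rewrite /cexp /= /GRing.scale /= !mul0r ?subr0 ?addr0; ring.
Qed.

(** Mean value inequality. For |u| <= 1 the real function h - Re(u f) has derivative at least h' -
    |f'| >= 0, so it increases from a nonnegative value; [normc_le_dual] recovers |f|. *)
Lemma cderive_mvt f f' (h h' : R -> R) a b : a <= b ->
  (forall t, cderive f t (f' t)) -> (forall t, is_derive t 1 h (h' t)) ->
  (forall t, a < t < b -> normc (f' t) <= h' t) ->
  normc (f a) <= h a -> normc (f b) <= h b.
Proof.
move=> ab df dh le0 f0; apply: normc_le_dual => u u1.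
have nu z : complex.Re (u * z) <= normc z.
  by rewrite (le_trans (Re_le_normc _)) // Normc.normcM ler_piMl ?normc_ge0.
pose k s := h s - complex.Re (u * f s).
have dk (s : R) : is_derive s 1 k (h' s - complex.Re (u * f' s)).
  by apply: is_deriveB; have [] := cderiveZ u (df s).
suff : k a <= k b.
  by rewrite /k => kk; have := nu (f a); lra.
have ck : continuous k.
  by move=> s; apply: differentiable_continuous; apply/derivable1_diffP;
     case: (dk s).
apply: (@ger0_derive1_ndecr _ k a b) => //.
- move=> s; rewrite in_itv /= => sab.
  rewrite derive1E (@derive_val _ _ _ _ _ _ _ (dk s)) subr_ge0.
  by rewrite (le_trans (nu _)) // le0.
- exact: continuous_subspaceT.
Qed.

Definition exp_poly z n t : C := \sum_(k < n) (t ^+ k / k`!%:R)%:C * z ^+ k.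

Lemma is_derive_pow n (t : R) :
  is_derive t 1 (fun s : R => s ^+ n.+1) (n.+1%:R * t ^+ n).
Proof.
apply: (is_derive_eqv (is_deriveX n.+1 (is_derive_id t 1))) => [s|].
  by rewrite exprfctE.
by rewrite /GRing.scale /= mulr1.
Qed.

Lemma cderive_exp_poly z n t : cderive (exp_poly z n.+1) t (z * exp_poly z n t).
Proof.
elim: n => [|n IH].
  apply: (cderive_eq (cderive_cst 1 t)) => [s|]; rewrite /exp_poly.
    by rewrite big_ord1 !expr0 divr1 mulr1.
  by rewrite big_ord0 mulr0.
have dm : is_derive t 1 (fun s : R => s ^+ n.+1 / n.+1`!%:R) (t ^+ n / n`!%:R).
  apply: (is_derive_eqv (is_deriveZ (n.+1`!%:R)^-1 (is_derive_pow n t))) => [s|].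
    by rewrite /= /GRing.scale /= mulrC.
  rewrite /GRing.scale /= factS natrM invfM; field.
  by rewrite pnatr_eq0 -lt0n fact_gt0 /= nat1r pnatr_eq0.
apply: (cderive_eq (cderiveD IH (cderive_real (z ^+ n.+1) dm))) => [s|];
  rewrite /exp_poly.
  by rewrite [in RHS]big_ord_recr.
by rewrite [in RHS]big_ord_recr /= mulrDr exprS; congr (_ + _); rewrite mulrCA.
Qed.

(** Induction on [n]: the derivative in [t] of the remainder of order n + 1 is z times the remainder
    of order n, so the mean value inequality integrates the bound. *)
Lemma cexp_remainder_curve z n t : 0 <= t ->
  normc (cexp (t%:C * z) - exp_poly z n t) <=
    (normc z * t) ^+ n / n`!%:R * expR (normc z * t).
Proof.
elim: n t => [|n IH] t t0.
  rewrite /exp_poly big_ord0 subr0 expr0 divr1 mul1r (le_trans (cexp_normle _)) //.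
  by rewrite ler_expR Normc.normcM normc_real ger0_norm // mulrC.
pose m := normc z.
pose h (s : R) := (m * s) ^+ n.+1 / n.+1`!%:R * expR (m * s).
(* The derivative of the majorant [h]. Its first summand is the induction bound, its second is
   nonnegative slack. *)
pose h' (s : R) := m * ((m * s) ^+ n / n`!%:R * expR (m * s)) + m * h s.
apply: (@cderive_mvt (fun s => cexp (s%:C * z) - exp_poly z n.+1 s)
  (fun s => z * (cexp (s%:C * z) - exp_poly z n s)) h h' 0 t t0).
- move=> s; rewrite mulrBr.
  by apply: cderiveB; [exact: cderive_cexp|exact: cderive_exp_poly].
- move=> s.
  have dl : is_derive s 1 (fun r : R => m * r) m.
    apply: (is_derive_eqv (is_deriveZ m (is_derive_id s 1))) => [r|] //.
    by rewrite /GRing.scale /= mulr1.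
  have d1 := is_derive1_comp (is_derive_pow n (m * s)) dl.
  have d2 := is_derive1_comp (is_derive_expR (m * s)) dl.
  apply: (is_derive_eqv (is_deriveM (is_deriveZ (n.+1`!%:R)^-1 d1) d2)) => [r|].
    by rewrite /h /GRing.mul /= /GRing.scale /= [X in X * _ = _]mulrC.
  rewrite /h' /h /GRing.scale /= /GRing.scale /= factS natrM invfM exprS; field.
  by rewrite pnatr_eq0 -lt0n fact_gt0 /= nat1r pnatr_eq0.
- move=> s /andP[/ltW s0 _]; rewrite Normc.normcM /h' ler_wpDr //; last first.
    by rewrite ler_wpM2l ?normc_ge0 // IH.
  rewrite !mulr_ge0 ?normc_ge0 ?expR_ge0 ?exprn_ge0 ?invr_ge0 ?ler0n //.
  by rewrite mulr_ge0 // normc_ge0.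
- rewrite /h mulr0 expr0n /= mul0r mul0r mul0r cexp0 /exp_poly big_ord_recl big1.
    by rewrite !expr0 divr1 mulr1 addr0 subrr Normc.normc0.
  by move=> i _; rewrite expr0n /= mul0r mul0r.
Qed.

Lemma cexp_remainder z n :
  normc (cexp z - \sum_(k < n) (k`!%:R)^-1 * z ^+ k) <=
    normc z ^+ n / n`!%:R * expR (normc z).
Proof.
have := @cexp_remainder_curve z n 1 ler01; rewrite mulr1 mul1r /exp_poly.
congr (normc (_ - _) <= _); apply: eq_bigr => i _; congr (_ * _).
by rewrite expr1n mul1r fmorphV rmorph_nat.
Qed.

End CurveDerivative.

(** * Entire functions *)

Section Entire.
Context {R : realType}.
Local Notation C := R[i].
Implicit Types (f g : C -> C) (z l h : C).

(** Differentiability with real epsilon and delta and without division by [h]. In the norm topology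
    of [R[i]] the radii are themselves elements of [R[i]], positive in its partial order. *)
Definition has_cderiv f z l := forall e : R, 0 < e -> exists2 d : R, 0 < d &
  forall h, normc h < d -> normc (f (z + h) - f z - l * h) <= e * normc h.

Lemma derivable_has_cderiv f z :
  derivable (f : C^o -> C^o) (z : C^o) 1 <-> exists l, has_cderiv f z l.
Proof.
split=> [|[l fl]].
  move=> /cvg_ex[l /= /cvgrPdist_lt H]; exists l => e e0.
  have e0' : 0 < e%:C by rewrite ltcR.
  have := H _ e0'; rewrite near_withinE => -[d /= d0 Hd].
  have dR : d = (complex.Re d)%:C by case: d d0 {Hd} => x y; rewrite ltcE /= =>
    /andP[/eqP -> _].
  exists (complex.Re d) => [|h hd]; first by rewrite -ltcR -dR.
  have [->|h0] := eqVneq h 0.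
    by rewrite addr0 subrr mulr0 subr0 Normc.normc0 mulr0.
  have := Hd h; rewrite /= sub0r normrN normE dR ltcR => /(_ hd h0).
  rewrite normE ltcR => /ltW; rewrite /GRing.scale /= mulr1 => le.
  have -> : f (z + h) - f z - l * h = - (l - h^-1 * (f (h + z) - f z)) * h.
    by rewrite (addrC h); field.
  by rewrite Normc.normcM normc_opp ler_wpM2r // normc_ge0.
apply/cvg_ex; exists l; apply/cvgrPdist_lt => e.
case: e => e y; rewrite ltcE /= => /andP[/eqP -> e0].
(* Half of [e] turns the weak inequality of [has_cderiv] into a strict one. *)
have [d d0 Hd] := fl (e / 2) (divr_gt0 e0 (ltr0Sn _ 1)).
rewrite near_withinE; exists d%:C; rewrite /= ?ltcR // => h /=.
rewrite sub0r normrN normE ltcR => hd h0.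
rewrite normE -[e +i* 0]/(e%:C) ltcR /GRing.scale /= mulr1.
have -> : l - h^-1 * (f (h + z) - f z) = - h^-1 * (f (z + h) - f z - l * h).
  by rewrite (addrC h); field.
rewrite Normc.normcM normc_opp Normc.normcV.
rewrite -ltr_pdivlMl ?invr_gt0 ?normc_gt0 // invrK (le_lt_trans (Hd _ hd)) //.
by rewrite mulrC ltr_pM2l ?normc_gt0 // ltr_pdivrMr // mulr_natr mulr2n ltrDl.
Qed.

Lemma entireP f : entire f <-> forall z, exists l, has_cderiv f z l.
Proof. by split => H z; apply/derivable_has_cderiv; apply: H. Qed.

Lemma entire_differentiable f : entire f <->
  forall z : C^o, differentiable (f : C^o -> C^o) z.
Proof. by split => H z; apply/derivable1_diffP; apply: H. Qed.

Lemma entire_cst l : entire (fun=> l).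
Proof. by move=> z; exact: derivable_cst. Qed.

Lemma entire_id : entire (fun z : C => z).
Proof. by move=> z; exact: derivable_id. Qed.

Lemma entireD f g : entire f -> entire g -> entire (fun z => f z + g z).
Proof. by move=> Hf Hg z; exact: derivableD (Hf z) (Hg z). Qed.

Lemma entireN f : entire f -> entire (fun z => - f z).
Proof. by move=> Hf z; exact: derivableN (Hf z). Qed.

Lemma entireB f g : entire f -> entire g -> entire (fun z => f z - g z).
Proof. by move=> Hf Hg z; exact: derivableB (Hf z) (Hg z). Qed.

Lemma entireM f g : entire f -> entire g -> entire (fun z => f z * g z).
Proof. by move=> Hf Hg z; exact: derivableM (Hf z) (Hg z). Qed.

Lemma entireX f n : entire f -> entire (fun z => f z ^+ n).
Proof.
move=> Hf; elim: n => [|n IH]; first exact: entire_cst.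
rewrite (_ : (fun z => _) = fun z => f z * f z ^+ n); first exact: entireM.
by apply/funext => z; rewrite exprS.
Qed.

Lemma entire_comp f g : entire f -> entire g -> entire (fun z => f (g z)).
Proof.
move=> /entire_differentiable Hf /entire_differentiable Hg.
apply/entire_differentiable => z.
exact: (@differentiable_comp _ _ _ _ (g : C^o -> C^o) (f : C^o -> C^o)).
Qed.

Lemma cexp_quadratic_remainder z :
  normc (cexp z - 1 - z) <= normc z ^+ 2 * expR (normc z).
Proof.
have := cexp_remainder z 2.
rewrite !big_ord_recl big_ord0 !expr0 /= !fact0 !invr1 !mul1r expr1 addr0.
rewrite opprD addrA => /le_trans; apply.
rewrite ler_wpM2r ?expR_ge0 // ler_pdivrMr ?ltr0n ?fact_gt0 //.
by rewrite ler_peMr ?sqr_ge0 ?ler1n ?fact_gt0.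
Qed.

Lemma entire_cexp : entire (@cexp R).
Proof.
apply/entireP => z; exists (cexp z) => e e0.
(* For |h| <= 1 the quadratic remainder, multiplied by exp(z), is at most K |h|^2. *)
pose K := normc (cexp z) * expR 1.
have K0 : 0 < K by rewrite mulr_gt0 ?expR_gt0 // normc_gt0 cexp_neq0.
exists (Num.min 1 (e / K)); first by rewrite lt_min ltr01 divr_gt0.
move=> h; rewrite lt_min => /andP[h1 hK].
have -> : cexp (z + h) - cexp z - cexp z * h = cexp z * (cexp h - 1 - h).
  by rewrite cexpD; ring.
rewrite Normc.normcM.
rewrite (le_trans (ler_wpM2l (normc_ge0 _) (cexp_quadratic_remainder h))) //.
have le1 : expR (normc h) <= expR 1 by rewrite ler_expR ltW.
rewrite (le_trans (ler_wpM2l (normc_ge0 _) (ler_wpM2l (sqr_ge0 _) le1))) //.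
rewrite mulrCA -/K expr2 mulrAC ler_wpM2r ?normc_ge0 //.
by rewrite -ler_pdivlMr // ltW.
Qed.

Lemma entire_cexp_comp f : entire f -> entire (fun z => cexp (f z)).
Proof. exact: (@entire_comp (@cexp R) f entire_cexp). Qed.

Lemma entire_eps f : entire f -> forall z (e : R), 0 < e ->
  exists2 d : R, 0 < d & forall h, normc h < d -> normc (f (z + h) - f z) < e.
Proof.
move=> /entireP Hf z e e0; have [l /(_ 1 ltr01)[d d0 Hd]] := Hf z.
have L0 : 0 < 1 + normc l by rewrite ltr_wpDr ?normc_ge0.
exists (Num.min d (e / (1 + normc l))); first by rewrite lt_min d0 divr_gt0.
move=> h; rewrite lt_min => /andP[/Hd hd he].
have := normcD (f (z + h) - f z - l * h) (l * h); rewrite subrK.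
move/le_lt_trans; apply; rewrite Normc.normcM.
rewrite (le_lt_trans (lerD hd (lexx _))) // -mulrDl.
by rewrite -ltr_pdivlMl // mulrC.
Qed.

Definition ccontinuous {T : topologicalType} (f : T -> C) :=
  continuous (fun t => complex.Re (f t)) /\ continuous (fun t => complex.Im (f t)).

Lemma entire_ccontinuous {T : topologicalType} f (g : T -> C) :
  entire f -> ccontinuous g -> ccontinuous (fun t => f (g t)).
Proof.
move=> Hf [rg ig].
have H t (e : R) : 0 < e -> \forall s \near t, normc (f (g s) - f (g t)) < e.
  move=> e0; have [d d0 Hd] := entire_eps Hf (g t) e0.
  have d20 : 0 < d / 2 by rewrite divr_gt0.
  have /cvgrPdist_lt/(_ _ d20) rn := rg t.
  have /cvgrPdist_lt/(_ _ d20) in_ := ig t.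
  near=> s.
  have -> : g s = g t + (g s - g t) by rewrite addrC subrK.
  apply: Hd; rewrite (le_lt_trans (normc_le_ReIm _)) //.
  rewrite ReD ImD ReN ImN (splitr d) ltrD // distrC; near: s.
  - exact: rn.
  - exact: in_.
split=> t; apply/cvgrPdist_lt => e /(H t) He; near=> s.
- rewrite distrC (le_lt_trans _ (_ : normc (f (g s) - f (g t)) < e)) //; last first.
    by near: s; exact: He.
  by rewrite -ReN -ReD normRe_le_normc.
- rewrite distrC (le_lt_trans _ (_ : normc (f (g s) - f (g t)) < e)) //; last first.
    by near: s; exact: He.
  by rewrite -ImN -ImD normIm_le_normc.
Unshelve. all: by end_near. Qed.

End Entire.

(** * Primitives and Goursat's theorem *)

Section Primitive.
Context {R : realType}.
Local Notation C := R[i].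
Local Notation mu := (@lebesgue_measure R).
Implicit Types (g : R -> R) (k f : R -> C) (a b t : R).

Definition prim g t : R :=
  if 0 <= t then \int[mu]_(s in `[0, t]) g s else - \int[mu]_(s in `[t, 0]) g s.

Lemma continuous_integrable g a b : continuous g ->
  mu.-integrable `[a, b] (EFin \o g).
Proof.
by move=> cg; apply: continuous_compact_integrable;
  [exact: segment_compact|exact: continuous_subspaceT].
Qed.

Lemma Rintegral_split g a b t : continuous g -> a <= t -> t <= b ->
  \int[mu]_(s in `[a, b]) g s =
  \int[mu]_(s in `[a, t]) g s + \int[mu]_(s in `[t, b]) g s.
Proof.
move=> cg at_ tb; have := @Rintegral_itvB _ g (BLeft a) (BRight b) t
  (@continuous_integrable g a b cg).
rewrite !bnd_simp => /(_ at_ tb).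
rewrite Rintegral_itv_obnd_cbnd; last first.
  apply: integrableS (continuous_integrable t b cg) => //.
  by apply: subset_itvr; rewrite bnd_simp.
by move=> <-; rewrite addrC subrK.
Qed.

(** With a base point [a] to the left of both 0 and [t], the two cases of [prim] become one formula,
    to which the fundamental theorem of calculus applies. *)
Lemma primE g a t : continuous g -> a <= 0 -> a <= t ->
  prim g t = \int[mu]_(s in `[a, t]) g s - \int[mu]_(s in `[a, 0]) g s.
Proof.
move=> cg a0 at_; rewrite /prim; case: ifPn => [t0|]; last rewrite -ltNge => /ltW t0.
  by rewrite (Rintegral_split cg a0 t0) addrC addKr.
by rewrite (Rintegral_split cg at_ t0) opprD addNKr.
Qed.

Lemma is_derive_prim g t : continuous g -> is_derive t 1 (prim g) (g t).
Proof.
move=> cg; pose a := - `|t| - 1.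
have a0 : a <= 0 by rewrite /a; have := normr_ge0 t; lra.
have at_ : a < t by rewrite /a; have := ler_norm (- t); rewrite normrN; lra.
have tt : t < t + 1 by rewrite ltrDl.
pose F x := \int[mu]_(s in `[a, x]) g s.
have [dF F'] := continuous_FTC1_closed tt (continuous_integrable a (t + 1) cg) at_
  (cg t).
have dF' : is_derive t 1 (fun x => F x - F 0) (g t).
  rewrite -[g t]subr0; apply: is_deriveB.
  by apply: (DeriveDef dF); rewrite -derive1E; exact: F'.
apply: near_eq_is_derive dF'; near=> x; rewrite (@primE _ a) //.
by apply: ltW; near: x; exact: lt_nbhsr.
Unshelve. all: by end_near. Qed.

Definition cprim k t : C :=
  prim (fun s => complex.Re (k s)) t +i* prim (fun s => complex.Im (k s)) t.

(** As a difference of primitives the integral is additive by cancellation and needs no order of the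
    end points; its other properties follow from derivatives alone. *)
Definition curve_int k a b : C := cprim k b - cprim k a.

Lemma cderive_cprim k t : ccontinuous k -> cderive (cprim k) t (k t).
Proof. by move=> [ck1 ck2]; split; exact: is_derive_prim. Qed.

Lemma curve_int_bound k a b (K : R) : ccontinuous k -> a <= b ->
  (forall t, a < t < b -> normc (k t) <= K) -> normc (curve_int k a b) <= K * (b - a).
Proof.
move=> ck ab H.
apply: (@cderive_mvt _ (fun t => cprim k t - cprim k a) k (fun t =>
  K * (t - a)) (fun=> K) a b) => //.
- move=> t; rewrite -[k t]subr0; apply: cderiveB (cderive_cst _ _).
  exact: cderive_cprim.
- move=> t.
  apply: (is_derive_eqv (is_deriveZ K (is_deriveB (is_derive_id t 1) (is_derive_cst a
    t 1)))) => [s|] //.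
  by rewrite subr0 /GRing.scale /= mulr1.
- by rewrite !subrr Normc.normc0 mulr0.
Qed.

Lemma cderive0_cst f a b : (forall t, cderive f t 0) -> f a = f b.
Proof.
move=> H.
have le x y : x <= y -> f x = f y.
  move=> xy; apply/esym/eqP; rewrite -subr_eq0 -normc_eq0 eq_le normc_ge0 andbT.
  apply: (@cderive_mvt _ (fun t => f t - f x) (fun=> 0) (fun=> 0) (fun=> 0) x y) => //.
  - by move=> t; rewrite -[0]subr0; apply: cderiveB (cderive_cst _ _).
  - by move=> t _; rewrite Normc.normc0.
  - by rewrite subrr Normc.normc0.
by have [/le|/ltW/le] := leP a b.
Qed.

Lemma curve_intE k f a b : ccontinuous k -> (forall t, cderive f t (k t)) ->
  curve_int k a b = f b - f a.
Proof.
move=> ck H; have : cprim k a - f a = cprim k b - f b.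
  apply: (@cderive0_cst (fun t => cprim k t - f t)) => t; rewrite -(subrr (k t)).
  by apply: cderiveB => //; exact: cderive_cprim.
by rewrite /curve_int => E; rewrite -[cprim k b](subrK (f b)) -E; ring.
Qed.

Lemma curve_intB k1 k2 a b : ccontinuous k1 -> ccontinuous k2 ->
  ccontinuous (fun t => k1 t - k2 t) ->
  curve_int (fun t => k1 t - k2 t) a b = curve_int k1 a b - curve_int k2 a b.
Proof.
move=> c1 c2 c12; rewrite (@curve_intE _ (fun t => cprim k1 t - cprim k2 t)) //.
  by rewrite /curve_int; ring.
by move=> t; apply: cderiveB; exact: cderive_cprim.
Qed.

Lemma curve_intZ (z : C) k a b : ccontinuous k -> ccontinuous (fun t => z * k t) ->
  curve_int (fun t => z * k t) a b = z * curve_int k a b.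
Proof.
move=> c1 c2; rewrite (@curve_intE _ (fun t => z * cprim k t)) //.
  by rewrite /curve_int; ring.
by move=> t; apply: cderiveZ; exact: cderive_cprim.
Qed.

End Primitive.

Section Goursat.
Context {R : realType}.
Local Notation C := R[i].
Implicit Types (H : C -> C) (x y t : R) (z l : C).

(** Each interval contains the next, so every left end is below every right end, and the supremum of
    the left ends lies in all of them. *)
Lemma nested_intervals (xs : nat -> R) (L : R) : 0 <= L ->
  (forall n, xs n <= xs n.+1 <= xs n + L / 2 ^+ n.+1) ->
  exists p, forall n, xs n <= p <= xs n + L / 2 ^+ n.
Proof.
move=> L0 H.
have up n m : (n <= m)%N -> xs n <= xs m.
  elim: m => [|m IH]; first by rewrite leqn0 => /eqP ->.
  rewrite leq_eqVlt => /predU1P[-> //|]; rewrite ltnS => /IH /le_trans; apply.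
  by have /andP[] := H m.
have dn n m : (n <= m)%N -> xs m + L / 2 ^+ m <= xs n + L / 2 ^+ n.
  elim: m => [|m IH]; first by rewrite leqn0 => /eqP ->.
  rewrite leq_eqVlt => /predU1P[-> //|]; rewrite ltnS => /IH; apply: le_trans.
  have /andP[_] := H m; have -> : L / 2 ^+ m = L / 2 ^+ m.+1 + L / 2 ^+ m.+1.
    by rewrite exprS; field; rewrite expf_neq0.
  lra.
have Lge n : 0 <= L / 2 ^+ n by rewrite divr_ge0 // exprn_ge0.
have bd n m : xs n <= xs m + L / 2 ^+ m.
  have [nm|/ltnW mn] := leqP n m.
    by rewrite (le_trans (up _ _ nm)) // lerDl.
  by rewrite (le_trans _ (dn _ _ mn)) // lerDl.
exists (sup [set xs n | n in [set: nat]]) => n; apply/andP; split.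
  apply: ub_le_sup; last by exists n.
  by exists (xs 0 + L / 2 ^+ 0) => _ [m _ <-]; exact: bd.
apply: ge_sup; first by exists (xs 0), 0%N.
by move=> _ [m _ <-]; exact: bd.
Qed.

(* Repeated quartering keeps |E| / area bounded below, which contradicts
   smallness at the point to which the rectangles shrink. *)
Lemma additive_rectangle_eq0 (E : R -> R -> R -> R -> C) :
  (forall x1 x2 x3 y1 y2, E x1 x3 y1 y2 = E x1 x2 y1 y2 + E x2 x3 y1 y2) ->
  (forall x1 x2 y1 y2 y3, E x1 x2 y1 y3 = E x1 x2 y1 y2 + E x1 x2 y2 y3) ->
  (forall p q (e : R), 0 < e -> exists2 d : R, 0 < d & forall x1 x2 y1 y2,
    x1 <= p <= x2 -> y1 <= q <= y2 -> (x2 - x1) + (y2 - y1) < d ->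
    normc (E x1 x2 y1 y2) <= e * ((x2 - x1) + (y2 - y1)) ^+ 2) ->
  forall x1 x2 y1 y2, x1 <= x2 -> y1 <= y2 -> E x1 x2 y1 y2 = 0.
Proof.
move=> addx addy small x1 x2 y1 y2 x12 y12.
pose Lx := x2 - x1; pose Ly := y2 - y1.
have Lx0 : 0 <= Lx by rewrite subr_ge0.
have Ly0 : 0 <= Ly by rewrite subr_ge0.
pose rect n (q : R * R) := E q.1 (q.1 + Lx / 2 ^+ n) q.2 (q.2 + Ly / 2 ^+ n).
pose eta : R := normc (E x1 x2 y1 y2).
apply/eqP; rewrite -normc_eq0 -/eta; apply/negP => /negP eta_neq0.
have eta0 : 0 < eta by rewrite lt_neqAle eq_sym eta_neq0 normc_ge0.
pose big n q := eta / 4 ^+ n <= normc (rect n q).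
have quad u u' u'' v v' v'' : E u u'' v v'' =
    E u u' v v' + E u' u'' v v' + (E u u' v' v'' + E u' u'' v' v'').
  by rewrite (addy u u'' v v' v'') (addx u u' u'' v v') (addx u u' u'' v' v'').
(* The demand on [q'] is conditional on [big n q], so that a total choice function can be
   extracted. *)
have step n q : exists q', big n q -> [/\ big n.+1 q',
    q.1 <= q'.1 <= q.1 + Lx / 2 ^+ n.+1 & q.2 <= q'.2 <= q.2 + Ly / 2 ^+ n.+1].
  have [bq|] := pselect (big n q); last by exists q.
  have Lxn : 0 <= Lx / 2 ^+ n.+1 by rewrite divr_ge0 // exprn_ge0.
  have Lyn : 0 <= Ly / 2 ^+ n.+1 by rewrite divr_ge0 // exprn_ge0.
  have half (L : R) : L / 2 ^+ n = L / 2 ^+ n.+1 + L / 2 ^+ n.+1.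
    by rewrite exprS; field; rewrite expf_neq0.
  have quarter : eta / 4 ^+ n = 4 * (eta / 4 ^+ n.+1).
    by rewrite [in RHS]exprS; field; rewrite expf_neq0.
  pose q00 := q; pose q10 := (q.1 + Lx / 2 ^+ n.+1, q.2).
  pose q01 := (q.1, q.2 + Ly / 2 ^+ n.+1).
  pose q11 := (q.1 + Lx / 2 ^+ n.+1, q.2 + Ly / 2 ^+ n.+1).
  have rE : rect n q = rect n.+1 q00 + rect n.+1 q10 + (rect n.+1 q01 + rect n.+1 q11).
    rewrite /rect /= !half (addrA q.1) (addrA q.2).
    exact: quad.
  have [b|n00] := boolP (eta / 4 ^+ n.+1 <= normc (rect n.+1 q00)).
    by exists q00 => _; split; rewrite //= ?lexx ?lerDl ?Lxn ?Lyn.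
  have [b|n10] := boolP (eta / 4 ^+ n.+1 <= normc (rect n.+1 q10)).
    by exists q10 => _; split; rewrite //= ?lexx ?lerDl ?Lxn ?Lyn.
  have [b|n01] := boolP (eta / 4 ^+ n.+1 <= normc (rect n.+1 q01)).
    by exists q01 => _; split; rewrite //= ?lexx ?lerDl ?Lxn ?Lyn.
  have [b|n11] := boolP (eta / 4 ^+ n.+1 <= normc (rect n.+1 q11)).
    by exists q11 => _; split; rewrite //= ?lexx ?lerDl ?Lxn ?Lyn.
  exfalso; move: bq; rewrite /big quarter rE.
  move: n00 n10 n01 n11; rewrite -!ltNge.
  have := normcD (rect n.+1 q00 + rect n.+1 q10) (rect n.+1 q01 + rect n.+1 q11).
  have := normcD (rect n.+1 q00) (rect n.+1 q10).
  have := normcD (rect n.+1 q01) (rect n.+1 q11).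
  lra.
have /choice[nxt Hnxt] : forall nq : nat * (R * R), exists q', big nq.1 nq.2 ->
    [/\ big nq.1.+1 q', nq.2.1 <= q'.1 <= nq.2.1 + Lx / 2 ^+ nq.1.+1
      & nq.2.2 <= q'.2 <= nq.2.2 + Ly / 2 ^+ nq.1.+1].
  by move=> [n q]; exact: step.
pose qs := fix qs n := if n is m.+1 then nxt (m, qs m) else (x1, y1).
have bigqs n : big n (qs n).
  elim: n => [|n /(Hnxt (n, qs n))[]//].
  by rewrite /big /rect /= !expr0 !divr1 /Lx /Ly !subrKC.
have [p Hp] := @nested_intervals (fun n => (qs n).1) Lx Lx0
  (fun n => let: And3 _ h _ := Hnxt (n, qs n) (bigqs n) in h).
have [q Hq] := @nested_intervals (fun n => (qs n).2) Ly Ly0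
  (fun n => let: And3 _ _ h := Hnxt (n, qs n) (bigqs n) in h).
(* The summand 1 keeps [L] positive even if the rectangle degenerates to a point. *)
pose L := Lx + Ly + 1.
have L0 : 0 < L by apply: ltr_wpDl => //; exact: addr_ge0.
(* With this tolerance the [n]-th integral is at most half of [eta / 4 ^+ n], which [bigqs]
   forbids. *)
have [|d d0 Hd] := small p q (eta / (2 * L ^+ 2)).
  by rewrite divr_gt0 ?mulr_gt0 ?exprn_gt0.
have [n Hn] : exists n, L / 2 ^+ n < d.
  exists (Num.truncn (L / d)).+1; rewrite ltr_pdivrMr ?exprn_gt0 //.
  rewrite mulrC -ltr_pdivrMr //.
  rewrite (lt_le_trans (truncnS_gt (L / d))) // ltW //.
  by rewrite -natrX ltr_nat ltn_expl.
have sE : (qs n).1 + Lx / 2 ^+ n - (qs n).1 + ((qs n).2 + Ly / 2 ^+ n - (qs n).2)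
    = (Lx + Ly) / 2 ^+ n by rewrite [RHS]mulrDl; congr (_ + _);
      rewrite addrAC subrr add0r.
have := Hd _ _ _ _ (Hp n) (Hq n); rewrite sE => /(_ _) H1.
have : normc (rect n (qs n)) <= eta / (2 * L ^+ 2) * ((Lx + Ly) / 2 ^+ n) ^+ 2.
  apply: H1; rewrite (le_lt_trans _ Hn) // ler_pM2r ?invr_gt0 ?exprn_gt0 //.
  by rewrite lerDl.
have := bigqs n; rewrite /big => /le_trans /[apply].
have -> : (4 : R) ^+ n = (2 ^+ n) ^+ 2 by rewrite -exprM mulnC exprM expr2 -natrM.
have -> : eta / (2 * L ^+ 2) * ((Lx + Ly) / 2 ^+ n) ^+ 2 =
  eta / (2 ^+ n) ^+ 2 * (((Lx + Ly) / L) ^+ 2 / 2).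
  by field; rewrite gt_eqF //= expf_neq0.
rewrite ler_pMr; last by rewrite divr_gt0 // !exprn_gt0.
have r1 : (Lx + Ly) / L <= 1 by rewrite ler_pdivrMr // mul1r /L lerDl ler01.
have r0 : 0 <= (Lx + Ly) / L by apply: divr_ge0; [exact: addr_ge0|exact: ltW].
have : ((Lx + Ly) / L) ^+ 2 <= 1 by rewrite expr_le1.
lra.
Qed.

End Goursat.

Section RectangleIdentities.
Variable K : comPzRingType.
Implicit Types a b c d i : K.

Lemma rect_sub a b c d a' b' c' d' i :
  a - a' - (b - b') + i * (c - c' - (d - d')) =
  a - b + i * (c - d) - (a' - b' + i * (c' - d')).
Proof. by ring. Qed.

(** The [a] and [b] stand for values of primitives along two parallel sides, the other letters for
    whole integrals. Once [curve_int] is unfolded, cutting a rectangle in two is this telescoping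
    identity. *)
Lemma rect_split_horiz a1 a2 a3 b1 b2 b3 c d e i :
  a3 - a1 - (b3 - b1) + i * (c - e) =
  a2 - a1 - (b2 - b1) + i * (d - e) + (a3 - a2 - (b3 - b2) + i * (c - d)).
Proof. by ring. Qed.

Lemma rect_split_vert a1 a2 a3 b1 b2 b3 c d e i :
  c - e + i * (a3 - a1 - (b3 - b1)) =
  c - d + i * (a2 - a1 - (b2 - b1)) + (d - e + i * (a3 - a2 - (b3 - b2))).
Proof. by ring. Qed.

End RectangleIdentities.

Section RectangleIntegral.
Context {R : realType}.
Local Notation C := R[i].
Implicit Types (H : C -> C) (x y t : R) (z l : C).

(** The contour integral of H dz, counterclockwise: bottom minus top, then right minus left with dz
    = i dt. *)
Definition rectangle_int H x1 x2 y1 y2 : C :=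
  curve_int (fun t => H (t +i* y1)) x1 x2 - curve_int (fun t => H (t +i* y2)) x1 x2 +
  (0 +i* 1) * (curve_int (fun t => H (x2 +i* t)) y1 y2 -
               curve_int (fun t => H (x1 +i* t)) y1 y2).

Lemma ccontinuous_hline y : ccontinuous (fun t : R => t +i* y).
Proof. by split => t /=; [exact: cvg_id|exact: cvg_cst]. Qed.

Lemma ccontinuous_vline x : ccontinuous (fun t : R => x +i* t).
Proof. by split => t /=; [exact: cvg_cst|exact: cvg_id]. Qed.

Lemma ccontinuous_horiz H y : entire H -> ccontinuous (fun t => H (t +i* y)).
Proof. by move=> Hh; exact: entire_ccontinuous Hh (ccontinuous_hline y). Qed.

Lemma ccontinuous_vert H x : entire H -> ccontinuous (fun t => H (x +i* t)).
Proof. by move=> Hh; exact: entire_ccontinuous Hh (ccontinuous_vline x). Qed.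

Lemma curve_int_affine (b g : C) (k : R -> C) x1 x2 : ccontinuous k ->
  (forall t, k t = b + t%:C * g) ->
  curve_int k x1 x2 = (x2 - x1)%:C * b + ((x2 ^+ 2 - x1 ^+ 2) / 2)%:C * g.
Proof.
move=> ck kE; rewrite (@curve_intE _ _ (fun t => t%:C * b + (t ^+ 2 / 2)%:C * g)) //.
  by rewrite !rmorphB /= !mulrBl rmorphB; ring.
move=> t; rewrite kE.
apply: (cderive_eq (cderiveD (cderive_real b (is_derive_id t 1)) (cderive_real g (f
  := fun s => s ^+ 2 / 2) (l := t) _))).
- apply: (is_derive_eqv (is_deriveZ (2^-1) (is_derive_pow 1 t))) => [s|].
    by rewrite /GRing.scale /= mulrC.
  by rewrite /GRing.scale /= expr1 mulrA mulVf // mul1r.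
- by [].
- by rewrite rmorph1 mul1r.
Qed.

Lemma rectangle_int_affine (b l : C) x1 x2 y1 y2 :
  rectangle_int (fun z => b + l * z) x1 x2 y1 y2 = 0.
Proof.
have Ha : entire (fun z : C => b + l * z).
  by apply: entireD; [exact: entire_cst|apply: entireM;
    [exact: entire_cst|exact: entire_id]].
have hor y : curve_int (fun t => b + l * (t +i* y)) x1 x2 =
  (x2 - x1)%:C * (b + l * (0 +i* y)) + ((x2 ^+ 2 - x1 ^+ 2) / 2)%:C * l.
  apply: curve_int_affine; first exact: ccontinuous_horiz Ha.
  by move=> t; clear -b l; case: b l => ? ? [? ?]; apply: eqc => /=; ring.
have ver x : curve_int (fun t => b + l * (x +i* t)) y1 y2 =
  (y2 - y1)%:C * (b + l * (x +i* 0)) + ((y2 ^+ 2 - y1 ^+ 2) / 2)%:C * (l * (0 +i* 1)).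
  apply: curve_int_affine; first exact: ccontinuous_vert Ha.
  by move=> t; clear -b l; case: b l => ? ? [? ?]; apply: eqc => /=; ring.
rewrite /rectangle_int !hor !ver.
by clear -b l; case: b l => ? ? [? ?]; apply: eqc => /=; ring.
Qed.

Lemma normc_rect (a b c d : C) (A B : R) :
  normc a <= A -> normc b <= A -> normc c <= B -> normc d <= B ->
  normc (a - b + (0 +i* 1) * (c - d)) <= A + A + (B + B).
Proof.
move=> aA bA cB dB; rewrite (le_trans (normcD _ _)) // Normc.normcM.
rewrite [normc (0 +i* 1)](_ : _ = 1) ?mul1r; last first.
  by rewrite /= expr0n expr1n add0r sqrtr1.
by rewrite lerD // (le_trans (normcB _ _)) // lerD.
Qed.

(** Affine functions integrate to zero, so near a point [H] may be replaced by its first-order error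
    [D]. With s the half perimeter, |D| <= (e / 2) s on a boundary of length 2 s, which gives the
    bound e s^2 that [additive_rectangle_eq0] asks for. *)
Lemma goursat H x1 x2 y1 y2 : entire H -> x1 <= x2 -> y1 <= y2 ->
  rectangle_int H x1 x2 y1 y2 = 0.
Proof.
move=> entH; apply: additive_rectangle_eq0 => {x1 x2 y1 y2}.
- by move=> x1 x2 x3 y1 y2; exact: rect_split_horiz.
- by move=> x1 x2 y1 y2 y3; exact: rect_split_vert.
move=> p q e e0.
have /entireP/(_ (p +i* q))[l Hl] := entH.
have [d d0 Hd] := Hl (e / 2) (divr_gt0 e0 (ltr0Sn _ 1)).
exists d => // x1 x2 y1 y2 /andP[x1p px2] /andP[y1q qy2]; set s := (_ + _) => sd.
have x12 := le_trans x1p px2; have y12 := le_trans y1q qy2.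
have s0 : 0 <= s by rewrite addr_ge0 // subr_ge0.
pose P := p +i* q; pose b := H P - l * P.
pose A z := b + l * z; pose D z := H z - A z.
have entA : entire A.
  by apply: entireD; [exact: entire_cst|apply: entireM;
    [exact: entire_cst|exact: entire_id]].
have entD : entire D by exact: entireB.
have -> : rectangle_int H x1 x2 y1 y2 = rectangle_int D x1 x2 y1 y2.
  have := rectangle_int_affine b l x1 x2 y1 y2; rewrite -/A => A0.
  have hB y : curve_int (fun t => D (t +i* y)) x1 x2 =
      curve_int (fun t => H (t +i* y)) x1 x2 - curve_int (fun t => A (t +i* y)) x1 x2.
    apply: curve_intB; [exact: ccontinuous_horiz entH|exact: ccontinuous_horiz entA|].
    exact: ccontinuous_horiz entD.
  have vB x : curve_int (fun t => D (x +i* t)) y1 y2 =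
      curve_int (fun t => H (x +i* t)) y1 y2 - curve_int (fun t => A (x +i* t)) y1 y2.
    apply: curve_intB; [exact: ccontinuous_vert entH|exact: ccontinuous_vert entA|].
    exact: ccontinuous_vert entD.
  transitivity (rectangle_int H x1 x2 y1 y2 - rectangle_int A x1 x2 y1 y2).
    by rewrite A0 subr0.
  by rewrite /rectangle_int (hB y1) (hB y2) (vB x1) (vB x2); exact/esym/rect_sub.
have bnd x y : x1 <= x <= x2 -> y1 <= y <= y2 -> normc (D (x +i* y)) <= e / 2 * s.
  move=> /andP[x1x xx2] /andP[y1y yy2].
  have hs : normc ((x +i* y) - P) <= s.
    rewrite (le_trans (normc_le_ReIm _)) //= lerD // ler_norml; lra.
  have := Hd _ (le_lt_trans hs sd); rewrite -/P subrKC.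
  have -> : H (x +i* y) - H P - l * (x +i* y - P) = D (x +i* y).
    by rewrite /D /A /b; ring.
  by move=> /le_trans; apply; rewrite ler_wpM2l // ltW // divr_gt0.
have cH y : ccontinuous (fun t => D (t +i* y)).
  exact: ccontinuous_horiz entD.
have cV x : ccontinuous (fun t => D (x +i* t)).
  exact: ccontinuous_vert entD.
have h1 : normc (curve_int (fun t => D (t +i* y1)) x1 x2) <= e / 2 * s * (x2 - x1).
  by apply: curve_int_bound => // t /andP[/ltW ? /ltW ?]; apply: bnd; apply/andP.
have h2 : normc (curve_int (fun t => D (t +i* y2)) x1 x2) <= e / 2 * s * (x2 - x1).
  by apply: curve_int_bound => // t /andP[/ltW ? /ltW ?]; apply: bnd; apply/andP.
have v1 : normc (curve_int (fun t => D (x1 +i* t)) y1 y2) <= e / 2 * s * (y2 - y1).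
  by apply: curve_int_bound => // t /andP[/ltW ? /ltW ?]; apply: bnd; apply/andP.
have v2 : normc (curve_int (fun t => D (x2 +i* t)) y1 y2) <= e / 2 * s * (y2 - y1).
  by apply: curve_int_bound => // t /andP[/ltW ? /ltW ?]; apply: bnd; apply/andP.
have -> : e * s ^+ 2 = e / 2 * s * (x2 - x1) + e / 2 * s * (x2 - x1) +
       (e / 2 * s * (y2 - y1) + e / 2 * s * (y2 - y1)) by rewrite /s; field.
exact: normc_rect.
Qed.

End RectangleIntegral.

(** * Vertical means of periodic entire functions, and polar coordinates *)

Section Periodic.
Context {R : realType}.
Local Notation C := R[i].
Implicit Types (H h : C -> C) (s t x y : R) (z : C) (n : nat).

Lemma cderive_shift (f : R -> C) (x t : R) (l : C) : cderive f (x + t) l ->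
  cderive (fun s => f (x + s)) t l.
Proof.
have dl : is_derive t 1 (fun s : R => x + s) 1.
  apply: (is_derive_eqv (is_deriveD (is_derive_cst x t 1) (is_derive_id t 1))) => //.
  by rewrite add0r.
move=> [rf imf]; split.
- by apply: (is_derive_eqv (is_derive1_comp (g := fun s => x + s) rf dl));
    rewrite ?mulr1.
- by apply: (is_derive_eqv (is_derive1_comp (g := fun s => x + s) imf dl));
    rewrite ?mulr1.
Qed.

(** Independence of [s]: in a rectangle of height 2 pi the horizontal sides cancel by periodicity,
    so Goursat equates the vertical ones. Independence of [x]: for a primitive P, the function P(2
    pi + u) - P(u) has derivative zero. *)
Lemma periodic_mean H s x : entire H ->
  (forall z, H (z + (0 +i* (2 * pi))) = H z) ->
  curve_int (fun t => H (s +i* (x + t))) 0 (2 * pi) =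
  curve_int (fun t => H (0 +i* t)) 0 (2 * pi).
Proof.
move=> entH per.
have pi2 : 0 <= 2 * pi :> R by rewrite mulr_ge0 ?pi_ge0.
pose K z := H (z + (0 +i* x)).
have entK : entire K.
  apply: (@entire_comp _ H (fun z => z + (0 +i* x)) entH).
  by apply: entireD; [exact: entire_id|exact: entire_cst].
have KE u t : K (u +i* t) = H (u +i* (x + t)) 
  by rewrite /K; congr (H _); apply: eqc => /=; [exact: addr0|exact: addrC].
have horE : curve_int (fun t => K (t +i* 0)) =  curve_int (fun t => K (t +i* (2 * pi))).
  congr curve_int; apply/funext => t; rewrite !KE addr0 -per; congr (H _).
  by apply: eqc => /=; rewrite ?addr0.
have shift_eq u v : u <= v -> curve_int (fun t => K (v +i* t)) 0 (2 * pi) =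
    curve_int (fun t => K (u +i* t)) 0 (2 * pi).
  move=> uv; have := goursat entK uv pi2; rewrite /rectangle_int horE subrr add0r.
  move/eqP; rewrite mulf_eq0 subr_eq0 => /orP[|/eqP //].
  by rewrite eq_complex /= oner_eq0 andbF.
have -> : curve_int (fun t => H (s +i* (x + t))) 0 (2 * pi) =
          curve_int (fun t => H (0 +i* (x + t))) 0 (2 * pi).
  have KF u : (fun t => H (u +i* (x + t))) = (fun t => K (u +i* t)).
    by apply/funext => t; rewrite KE.
  rewrite !KF; have [/shift_eq //|/ltW/shift_eq //] := leP 0 s.
have cH : ccontinuous (fun t => H (0 +i* t)).
  exact: ccontinuous_vert entH.
pose P := cprim (fun t => H (0 +i* t)).
have dP t : cderive P t (H (0 +i* t)) by exact: cderive_cprim.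
have cHx : ccontinuous (fun t => H (0 +i* (x + t))).
  apply: (entire_ccontinuous entH (g := fun t : R => 0 +i* (x + t))); split => t /=.
    exact: cvg_cst.
  by apply: cvgD; [exact: cvg_cst|exact: cvg_id].
rewrite (@curve_intE _ _ (fun t => P (x + t))) //; last by move=> t;
  exact: cderive_shift.
rewrite /curve_int -/P addr0.
have := @cderive0_cst _ (fun u => P (2 * pi + u) - P u) x 0.
rewrite addr0 (addrC x) => -> // t.
rewrite -(subrr (H (0 +i* t))); apply: cderiveB => //.
apply: cderive_shift; rewrite -(per (0 +i* t)).
by have := dP (2 * pi + t); congr (cderive _ _ (H _)); apply: eqc => /=; ring.
Qed.

Definition cis t : C := cos t +i* sin t.

Lemma cisE t : cis t = cexp (0 +i* t).
Proof. by rewrite /cexp /= expR0 mul1r. Qed.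

Lemma normc_cis t : normc (cis t) = 1.
Proof. by rewrite /= cos2Dsin2 sqrtr1. Qed.

Lemma polar z : exists t, z = (normc z)%:C * cis t.
Proof.
have [->|z0] := eqVneq z 0; first by exists 0; rewrite Normc.normc0 mul0r.
have r0 : 0 < normc z by rewrite normc_gt0.
pose x := complex.Re z / normc z; pose y := complex.Im z / normc z.
have xy : x ^+ 2 + y ^+ 2 = 1.
  by rewrite /x /y !expr_div_n -mulrDl -normc_sq divff // expf_neq0 // gt_eqF.
have x1 : -1 <= x <= 1.
  have x21 : x ^+ 2 <= 1 by rewrite -xy lerDl sqr_ge0.
  by rewrite -ler_norml -(ler_pXn2r (n := 2)) ?nnegrE // expr1n real_normK ?num_real.
have zE : z = (normc z)%:C * (x +i* y).
  by apply: eqc; rewrite ?ReM ?ImM /= mul0r ?subr0 ?addr0 mulrC divfK ?gt_eqF.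
have sE : Num.sqrt (1 - x ^+ 2) = `|y| by rewrite -xy addrC addKr sqrtr_sqr.
have cE : cos (acos x) = x by rewrite acosK // in_itv.
have [y0|/ltW y0] := leP 0 y.
  exists (acos x); rewrite {1}zE; congr (_ * _).
  by rewrite /cis cE sin_acos // sE ger0_norm.
exists (- acos x); rewrite {1}zE; congr (_ * _).
by rewrite /cis cosN sinN cE sin_acos // sE ler0_norm // opprK.
Qed.

Lemma cexp_surj z : z != 0 -> exists w, z = cexp w.
Proof.
move=> z0; have [t ->] := polar z; exists (ln (normc z) +i* t).
by rewrite /cexp /= lnK // posrE normc_gt0.
Qed.

End Periodic.

(** * Circle means *)

Section CircleMean.
Context {R : realType}.
Local Notation C := R[i].
Implicit Types (H h : C -> C) (s t x y : R) (z : C) (n : nat).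

(** For entire [h], the integral [cmean n h z] of this function is 2 pi times the degree-n term of
    the Taylor series of [h] at 0, evaluated at [z]. *)
Definition circ n h z t : C := h (z * cis t) * cis (- (n%:R * t)).
Definition cmean n h z : C := curve_int (circ n h z) 0 (2 * pi).

Lemma circE n h z : circ n h z =
  fun t => (fun w => h (z * cexp w) * cexp (- (n%:R * w))) (0 +i* t).
Proof.
apply/funext => t; rewrite /circ !cisE; congr (h _ * cexp _).
by rewrite -(rmorph_nat (real_complex R)); apply: eqc => /=; ring.
Qed.

Lemma entire_circ n h z : entire h ->
  entire (fun w => h (z * cexp w) * cexp (- (n%:R * w))).
Proof.
move=> Hh; apply: entireM.
  apply: (@entire_comp _ h (fun w => z * cexp w) Hh).
  by apply: entireM; [exact: entire_cst|exact: entire_cexp].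
apply: entire_cexp_comp; apply: entireN.
by apply: entireM; [exact: entire_cst|exact: entire_id].
Qed.

Lemma ccontinuous_circ n h z : entire h -> ccontinuous (circ n h z).
Proof.
move=> Hh; rewrite circE.
exact: (@ccontinuous_vert _ (fun w => h (z * cexp w) * cexp (- (n%:R * w))) 0
  (@entire_circ n h z Hh)).
Qed.

Lemma cexp2pi : cexp (0 +i* (2 * pi)) = 1 :> C.
Proof. by rewrite -cisE /cis mulr_natl cos2pi sin2pi. Qed.

Lemma cexpN2pi : cexp (- (0 +i* (2 * pi))) = 1 :> C.
Proof. by have := cexpNK (0 +i* (2 * pi) : C); rewrite cexp2pi mulr1. Qed.

(** Write z = exp(w). Up to the factor exp(-n w), the integrand is the restriction of a 2 pi
    i-periodic entire function to the vertical line through w, and [periodic_mean] moves that line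
    to the imaginary axis. *)
Lemma cmeanE n h z : entire h -> z != 0 -> cmean n h z = z ^+ n * cmean n h 1.
Proof.
move=> Hh /cexp_surj[w ->].
pose H w := h (1 * cexp w) * cexp (- (n%:R * w)).
have per v : H (v + (0 +i* (2 * pi))) = H v.
  rewrite /H cexpD cexp2pi mulr1; congr (_ * _).
  by rewrite mulrDr opprD cexpD -(mulrN _ (0 +i* _)) cexpMn cexpN2pi expr1n mulr1.
have entH : entire H by exact: entire_circ.
have HE t : H (complex.Re w +i* (complex.Im w + t)) =
    cexp (- (n%:R * w)) * circ n h (cexp w) t.
  have -> : complex.Re w +i* (complex.Im w + t) = w + (0 +i* t).
    by case: w => ? ?; apply: eqc => /=; rewrite ?addr0.
  rewrite circE /H mul1r [RHS]mulrCA cexpD; congr (_ * _).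
  by rewrite mulrDr opprD cexpD.
rewrite {2}/cmean circE -/H -(periodic_mean (complex.Re w) (complex.Im w) entH per).
rewrite (funext HE) curve_intZ; last 2 first.
- exact: ccontinuous_circ.
- rewrite -(funext HE).
  apply: (entire_ccontinuous entH (g := fun t : R =>
    complex.Re w +i* (complex.Im w + t))).
  split => t /=; first exact: cvg_cst.
  by apply: cvgD; [exact: cvg_cst|exact: cvg_id].
by rewrite mulrA -cexpMn -cexpD subrr cexp0 mul1r.
Qed.

(** For n = 0 the homogeneity [cmeanE] says that the radius does not matter; on a small circle [h]
    is close to its value at the centre. *)
Lemma cmean_near0 h : entire h -> cmean 0 h 1 = (2 * pi)%:C * h 0.
Proof.
move=> Hh; apply/eqP; rewrite -subr_eq0 -normc_eq0 eq_le normc_ge0 andbT.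
apply/ler_addgt0Pl => e e0; rewrite addr0.
have pi2 : 0 < 2 * pi :> R by rewrite mulr_gt0 ?pi_gt0.
have [d d0 Hd] := entire_eps Hh 0 (divr_gt0 e0 pi2).
pose z : C := (d / 2)%:C.
have nz : normc z = d / 2 by rewrite normc_real ger0_norm // ltW // divr_gt0.
have z0 : z != 0 by rewrite -normc_gt0 nz divr_gt0.
have := cmeanE 0 Hh z0; rewrite expr0 mul1r => <-.
have cc : ccontinuous (fun _ : R => h 0) by split => t; exact: cvg_cst.
have ck := ccontinuous_circ 0 z Hh.
have cd : ccontinuous (fun t => circ 0 h z t - h 0).
  rewrite circE; apply: (@ccontinuous_vert _ (fun w =>
    h (z * cexp w) * cexp (- (0%:R * w)) - h 0)).
  by apply: entireB; [exact: entire_circ|exact: entire_cst].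
have -> : (2 * pi)%:C * h 0 = curve_int (fun=> h 0) 0 (2 * pi).
  rewrite (@curve_intE _ _ (fun t => t%:C * h 0)) ?mul0r ?subr0 // => t.
  by rewrite -[X in cderive _ _ X]mul1r; apply: cderive_real; exact: is_derive_id.
rewrite -curve_intB //.
have -> : e = e / (2 * pi) * (2 * pi - 0) by rewrite subr0 divfK // gt_eqF.
apply: curve_int_bound => //; first exact: ltW.
move=> t _; rewrite /circ mul0r oppr0 {2}/cis cos0 sin0 mulr1 ltW //.
have := Hd (z * cis t); rewrite add0r; apply.
by rewrite Normc.normcM normc_cis mulr1 nz ltr_pdivrMr // mulr_natr mulr2n ltrDl.
Qed.

Lemma cmean0 h z : entire h -> cmean 0 h z = (2 * pi)%:C * h 0.
Proof.
move=> Hh; have [->|z0] := eqVneq z 0; last first.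
  by rewrite cmeanE // expr0 mul1r cmean_near0.
rewrite /cmean (_ : circ 0 h 0 = fun=> h 0); last first.
  by apply/funext => t; rewrite /circ !mul0r oppr0 /cis cos0 sin0 mulr1.
rewrite (@curve_intE _ _ (fun t => t%:C * h 0)) ?mul0r ?subr0 //.
  by split => t; exact: cvg_cst.
by move=> t; rewrite -[X in cderive _ _ X]mul1r; apply: cderive_real;
  exact: is_derive_id.
Qed.

End CircleMean.

(** * Lebesgue measure on the plane *)

Section PlaneMeasure.
Context {R : realType}.
Local Notation mR := (measurableTypeR R).
Local Notation mu := (@lebesgue_measure R).
Local Notation leb2 := (@lebesgue_measure R \x @lebesgue_measure R)%E.
Local Open Scope ereal_scope.

Lemma measurable_affine (a b : R) :
  measurable_fun setT (fun x : mR => (a * x + b)%R : mR).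
Proof.
apply: continuous_measurable_fun => x.
by apply: cvgD; [apply: cvgM; [exact: cvg_cst|exact: cvg_id]|exact: cvg_cst].
Qed.

Lemma affine_preimage_measure (a b x y : R) : (a != 0)%R ->
  mu `]x, y]%classic =
  `|a|%:E * mu ((fun t => a * t + b)%R @^-1` `]x, y]%classic).
Proof.
move=> a0; have := a0; rewrite neq_lt => /orP[a_lt0|a_gt0].
- have -> : (fun t => a * t + b)%R @^-1` `]x, y]%classic =
      `[((y - b) / a)%R, ((x - b) / a)%R[%classic.
    apply/seteqP; split => t /=; rewrite !in_itv /= => /andP[h1 h2]; apply/andP; split.
    + by rewrite ler_ndivrMr // mulrC lerBrDr.
    + by rewrite ltr_ndivlMr // mulrC ltrBlDr.
    + by rewrite -ltrBlDr mulrC -ltr_ndivlMr.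
    + by rewrite -lerBrDr mulrC -ler_ndivrMr.
  rewrite !lebesgue_measure_itv /= !lte_fin ltr_nM2r ?invr_lt0 // ltrD2r.
  case: ifPn => _; rewrite ?mule0 // -!EFinB -EFinM; congr EFin.
  by rewrite ltr0_norm //; field.
- have -> : (fun t => a * t + b)%R @^-1` `]x, y]%classic =
      `]((x - b) / a)%R, ((y - b) / a)%R]%classic.
    apply/seteqP; split => t /=; rewrite !in_itv /= => /andP[h1 h2]; apply/andP; split.
    + by rewrite ltr_pdivrMr // mulrC ltrBlDr.
    + by rewrite ler_pdivlMr // mulrC lerBrDr.
    + by rewrite -ltrBlDr mulrC -ltr_pdivrMr.
    + by rewrite -lerBrDr mulrC -ler_pdivlMr.
  rewrite !lebesgue_measure_itv /= !lte_fin ltr_pM2r ?invr_gt0 // ltrD2r.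
  case: ifPn => _; rewrite ?mule0 // -!EFinB -EFinM; congr EFin.
  by rewrite gtr0_norm //; field.
Qed.

(** The image of Lebesgue measure under the affine map, scaled by |a|, agrees with Lebesgue measure
    on half-open intervals, hence everywhere. *)
Lemma ge0_integral_affine (a b : R) (F : mR -> \bar R) : (a != 0)%R ->
  measurable_fun setT F -> (forall x, 0 <= F x) ->
  \int[mu]_x F x = `|a|%:E * \int[mu]_x F (a * x + b)%R.
Proof.
move=> a0 mF F0.
pose phi := (fun x => a * x + b)%R : mR -> mR.
have mphi : measurable_fun setT phi := measurable_affine a b.
pose nu := measure_function_pushforward__canonical__measure_function_Measure mu mphi.
have k0 : (0 <= `|a|)%R by [].
pose m := mscale (NngNum k0) nu.
have mE A : measurable A -> mu A = m A.
  apply: (@lebesgue_measure_unique R m) => _ [[x y] _ <-].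
  exact: affine_preimage_measure.
transitivity (\int[m]_x F x); first by apply: eq_measure_integral => A mA _; exact: mE.
rewrite ge0_integral_mscale //; congr (_ * _).
by rewrite [LHS](ge0_integral_pushforward mphi).
Qed.

Lemma measurable_shift2 (a b : R) :
  measurable_fun setT (fun p : mR * mR => (p.1 + a, p.2 + b)%R : mR * mR).
Proof.
have mshift c : measurable_fun setT (fun x : mR => (x + c)%R : mR).
  by rewrite (_ : (fun x => _) = fun x => (1 * x + c)%R) //;
    [exact: measurable_affine|apply/funext => x; rewrite mul1r].
by apply: measurable_fun_pair; apply: measurableT_comp (mshift _) _.
Qed.

Lemma ge0_integral_shift2 (a b : R) (F : mR * mR -> \bar R) :
  measurable_fun setT F -> (forall p, 0 <= F p) ->
  \int[leb2]_p F (p.1 + a, p.2 + b)%R = \int[leb2]_p F p.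
Proof.
move=> mF F0.
have sh c (G : mR -> \bar R) : measurable_fun setT G -> (forall x, 0 <= G x) ->
    \int[mu]_x G (x + c)%R = \int[mu]_x G x.
  move=> mG G0; rewrite [RHS](@ge0_integral_affine 1 c) // normr1 mul1e.
  by apply: eq_integral => x _; rewrite mul1r.
rewrite fubini_tonelli1 //; last exact: measurableT_comp mF (measurable_shift2 a b).
rewrite [RHS]fubini_tonelli1 // /fubini_F /=.
rewrite -[RHS](sh a) //; last 2 first.
- exact: measurable_fun_fubini_tonelli_F.
- by move=> x; exact: integral_ge0.
apply: eq_integral => x _; rewrite (sh b (fun y => F (x + a, y)%R)) //.
exact: measurableT_comp mF (pair1_measurable _).
Qed.

Definition rotate (t : R) (p : mR * mR) : mR * mR :=
  (cos t * p.1 - sin t * p.2, sin t * p.1 + cos t * p.2)%R.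

Lemma measurable_rotate t : measurable_fun setT (rotate t).
Proof.
by apply: measurable_fun_pair; [apply: measurable_funB|apply: measurable_funD];
  apply: measurable_funM => //; exact: measurable_cst.
Qed.

(** Such a rotation splits into two one-dimensional affine substitutions, in x for fixed y and then
    in y for fixed x. Their factors 1 / |cos t| and |cos t| cancel. *)
Lemma ge0_integral_rotate_cos (t : R) (F : mR * mR -> \bar R) : (cos t != 0)%R ->
  measurable_fun setT F -> (forall p, 0 <= F p) ->
  \int[leb2]_p F (rotate t p) = \int[leb2]_p F p.
Proof.
move=> c0 mF F0; set c := cos t in c0 *; set s := sin t.
have cs : (c ^+ 2 + s ^+ 2 = 1)%R by exact: cos2Dsin2.
have mrot := measurable_rotate t.
rewrite fubini_tonelli2 //; last exact: measurableT_comp mF mrot.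
(* [F] in terms of the new x and the old y: if x' = c x - s y, then s x + c y = (s x' + y) / c. *)
pose G (p : mR * mR) := F (p.1, (s * p.1 + p.2) / c)%R.
have mG : measurable_fun setT G.
  apply: measurableT_comp mF _; apply: measurable_fun_pair => //.
  apply: measurable_funM; last exact: measurable_cst.
  by apply: measurable_funD => //; apply: measurable_funM => //; exact: measurable_cst.
have G0 p : 0 <= G p by exact: F0.
have E1 y : fubini_G mu (F \o rotate t) y = `|c|^-1%:E * \int[mu]_x G (x, y).
  have mGy : measurable_fun setT (fun x : mR => G (x, y)).
    exact: measurableT_comp mG (pair2_measurable _).
  rewrite (@ge0_integral_affine c (- (s * y)) (fun x => G (x, y))) //.
  rewrite muleA -EFinM mulVf ?normr_eq0 // mul1e.
  apply: eq_integral => x _; rewrite /= /rotate /G /=; congr (F (_, _)).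
  have -> : (s * (c * x + - (s * y)) + y =
      (s * x + c * y) * c + y * (1 - (c ^+ 2 + s ^+ 2)))%R by ring.
  by rewrite cs subrr mulr0 addr0 mulfK.
transitivity (\int[mu]_y (`|c|^-1%:E * \int[mu]_x G (x, y))).
  by apply: eq_integral => y _; exact: E1.
rewrite ge0_integralZl //; last 2 first.
- exact: (measurable_fun_fubini_tonelli_G G).
- by move=> y _; exact: integral_ge0.
rewrite -(fubini_tonelli G mG) // [RHS]fubini_tonelli1 //.
rewrite -ge0_integralZl //; last 2 first.
- exact: (measurable_fun_fubini_tonelli_F G).
- by move=> y _; exact: integral_ge0.
apply: eq_integral => x _; rewrite /fubini_F.
have mFx : measurable_fun setT (fun y : mR => F (x, y)).
  exact: measurableT_comp mF (pair1_measurable _).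
have ci0 : (c^-1 != 0)%R by rewrite invr_neq0.
rewrite (@ge0_integral_affine c^-1 (s * x / c) (fun y => F (x, y))) //.
rewrite normfV; congr (_ * _); apply: eq_integral => y _; rewrite /G /=.
by congr (F (_, _)); rewrite mulrDl addrC (mulrC _ y).
Qed.

End PlaneMeasure.

(** * Measurability on the plane and averages over rotations *)

Section PlaneMeasurability.
Context {R : realType}.
Local Notation mR := (measurableTypeR R).
Local Notation mu := (@lebesgue_measure R).
Local Notation leb2 := (@lebesgue_measure R \x @lebesgue_measure R)%E.

(** Rounding x down to a multiple of 1 / (n + 1) gives a function that depends only on y in each of
    countably many strips, hence is measurable. By continuity in x these functions converge
    pointwise to [f]. *)
Lemma measurable_separately_continuous (f : R -> R -> R) :
  (forall y, continuous (f ^~ y)) -> (forall x, continuous (f x)) ->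
  measurable_fun setT (fun p : mR * mR => f p.1 p.2 : mR).
Proof.
move=> cx cy.
pose q (n : nat) (x : R) : R := (Num.floor (x * n.+1%:R))%:~R / n.+1%:R.
have q_le n x : `|q n x - x| <= n.+1%:R^-1.
  have n0 : 0 < n.+1%:R :> R by [].
  have /andP[h1 h2] := floor_itv (x * n.+1%:R).
  rewrite distrC ger0_norm; last by rewrite subr_ge0 ler_pdivrMr.
  rewrite lerBlDr -(ler_pM2r n0) mulrDl mulVf ?gt_eqF // divfK ?gt_eqF // ltW //.
  by rewrite (lt_le_trans h2) // rmorphD /= addrC.
apply: (@measurable_fun_cvg _ _ _ _ (fun n (p : mR * mR) => f (q n p.1) p.2)).
- move=> n _ B mB; rewrite setTI.
  rewrite (_ : _ @^-1` B = \bigcup_(k in [set: int])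
      ([set x : mR | Num.floor (x * n.+1%:R) = k] `*`
       (f (k%:~R / n.+1%:R) @^-1` B))); last first.
    apply/seteqP; split => [[x y] /= Bxy|[x y] /= [k _ [/= <-]]] //.
    by exists (Num.floor (x * n.+1%:R)).
  apply: countable_bigcupT_measurable => [|k]; first exact: countableP.
  apply: measurableX.
    rewrite (_ : [set _ | _] = `[(k%:~R / n.+1%:R)%R, ((k + 1)%:~R /
      n.+1%:R)%R[%classic) //.
    apply/seteqP; split => x /=; rewrite in_itv /= ler_pdivrMr // ltr_pdivlMr //.
      by move=> <-; exact: floor_itv.
    exact: floor_def.
  rewrite -[X in measurable X]setTI.
  exact: (@continuous_measurable_fun R (f (k%:~R / n.+1%:R))).
- move=> [x y] _ /=.
  have qx : q n x @[n --> \oo] --> x.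
    apply/cvgrPdist_le => e e0; near=> n.
    rewrite distrC (le_trans (q_le n x)) //.
    near: n; have /cvgrPdist_le/(_ e e0) := @cvg_harmonic R.
    by apply: filterS => n; rewrite sub0r normrN ger0_norm // invr_ge0.
  exact: continuous_cvg (cx y x) qx.
Unshelve. all: by end_near. Qed.

Lemma rotateD (s t : R) (p : mR * mR) : rotate (s + t) p = rotate s (rotate t p).
Proof. by case: p => x y; rewrite /rotate /= cosD sinD; congr (_, _); ring. Qed.

Local Open Scope ereal_scope.

(** If cos(t) = 0, then cos(t / 2) is not zero, and the rotation is performed as two rotations by t
    / 2. *)
Lemma ge0_integral_rotate (t : R) (F : mR * mR -> \bar R) :
  measurable_fun setT F -> (forall p, 0 <= F p) ->
  \int[leb2]_p F (rotate t p) = \int[leb2]_p F p.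
Proof.
move=> mF F0; have [c0|c0] := eqVneq (cos t) 0%R; last exact: ge0_integral_rotate_cos.
have t2 : (t = t / 2 + t / 2)%R by rewrite -splitr.
have c20 : (cos (t / 2) != 0)%R.
  apply/eqP => c20; have := cos2Dsin2 (t / 2).
  have : (cos (t / 2 + t / 2) = 0)%R by rewrite -t2.
  rewrite cosD c20 mul0r sub0r => /eqP; rewrite oppr_eq0 -expr2 => /eqP ->.
  by rewrite expr0n /= addr0 => /eqP; rewrite eq_sym oner_eq0.
transitivity (\int[leb2]_p F (rotate (t / 2) (rotate (t / 2) p))).
  by apply: eq_integral => p _; rewrite -rotateD -t2.
rewrite (@ge0_integral_rotate_cos _ _ (fun p => F (rotate (t / 2) p))) //.
  exact: ge0_integral_rotate_cos.
exact: measurableT_comp mF (measurable_rotate _).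
Qed.

Section Preserving.
Variable phi : mR * mR -> mR * mR.
Hypothesis mphi : measurable_fun setT phi.
Hypothesis phiE : forall F : mR * mR -> \bar R,
  measurable_fun setT F -> (forall p, 0 <= F p) ->
  \int[leb2]_p F (phi p) = \int[leb2]_p F p.

Lemma preserving_integral (F : mR * mR -> \bar R) : measurable_fun setT F ->
  \int[leb2]_p F (phi p) = \int[leb2]_p F p.
Proof.
move=> mF; rewrite integralE [RHS]integralE; congr (_ - _).
- rewrite -[RHS]phiE //; last exact: measurable_funepos.
  by apply: eq_integral => p _; rewrite -[in RHS]/((F^\+ \o phi) p) -funepos_comp.
- rewrite -[RHS]phiE //; last exact: measurable_funeneg.
  by apply: eq_integral => p _; rewrite -[in RHS]/((F^\- \o phi) p) -funeneg_comp.
Qed.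

Lemma preserving_integrable (F : mR * mR -> \bar R) :
  leb2.-integrable setT F -> leb2.-integrable setT (F \o phi).
Proof.
move=> /integrableP[mF iF]; apply/integrableP; split.
  exact: measurableT_comp mF mphi.
by rewrite (preserving_integral (F := fun p => `|F p|)) //; exact: measurableT_comp.
Qed.

End Preserving.

(* The sigma-finite structure that [product_measure1] inherits from the library
   is the one of a product of subprobabilities; it does not apply here. *)
Definition plane : set (mR * mR)%type -> \bar R := leb2.

HB.instance Definition _ := Measure.on plane.

Lemma sigma_finite_plane : sigma_finite setT plane.
Proof.
have /sigma_finiteP[F [TF ndF Foo]] := sigma_finiteT mu.
exists (fun n => F n `*` F n).
  rewrite -setXTT TF predeqE => -[x y]; split.
    move=> [/= [n _ Fnx] [k _ Gky]]; exists (maxn n k) => //; split.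
    - by move: x Fnx; exact/subsetPset/ndF/leq_maxl.
    - by move: y Gky; exact/subsetPset/ndF/leq_maxr.
  by move=> [n _ []/= ? ?]; split; exists n.
move=> k; have [? ?] := Foo k.
split; first exact: measurableX.
by rewrite /plane [X in X < _]product_measure1E // lte_mul_pinfty // ge0_fin_numE.
Qed.

HB.instance Definition _ := Measure_isSigmaFinite.Build _ _ _ plane
  sigma_finite_plane.

(** Fubini for k(rotate t p) on [0, 2 pi] times the plane: integrating over p first gives 2 pi times
    the integral of [k] by rotation invariance, integrating over t first gives 0. *)
Lemma rotation_mean_zero (k : mR * mR -> R) :
  leb2.-integrable setT (EFin \o k) ->
  (forall p, \int[mu]_(t in `[0%R, (2 * pi)%R]) (k (rotate t p))%:E = 0) ->
  \int[leb2]_p (k p)%:E = 0.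
Proof.
move=> ik k0; have pi2 : (0 < 2 * pi :> R)%R by rewrite mulr_gt0 // pi_gt0.
have mk : measurable_fun setT k by move: ik => /integrableP[/measurable_EFinP].
pose I : set mR := `[0%R, (2 * pi)%R]%classic.
have mI : measurable I by exact: measurable_itv.
pose Phi (q : mR * (mR * mR)) := (\1_I q.1 * k (rotate q.1 q.2))%:E.
have mPhi : measurable_fun setT Phi.
  apply/measurable_EFinP; apply: measurable_funM.
    by apply: measurableT_comp => //; exact: measurable_indic.
  apply: measurableT_comp mk _.
  have mc : measurable_fun setT (fun q : mR * (mR * mR) => cos q.1 : mR).
    apply: measurableT_comp (@measurable_fst _ _ _ _).
    by apply: continuous_measurable_fun; exact: continuous_cos.
  have ms : measurable_fun setT (fun q : mR * (mR * mR) => sin q.1 : mR).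
    apply: measurableT_comp (@measurable_fst _ _ _ _).
    by apply: continuous_measurable_fun; exact: continuous_sin.
  have mx : measurable_fun setT (fun q : mR * (mR * mR) => q.2.1 : mR).
    exact: measurableT_comp.
  have my : measurable_fun setT (fun q : mR * (mR * mR) => q.2.2 : mR).
    exact: measurableT_comp.
  apply: measurable_fun_pair.
    by apply: measurable_funB; apply: measurable_funM.
  by apply: measurable_funD; apply: measurable_funM.
have rotE t (F : mR * mR -> \bar R) (mF : measurable_fun setT F) :
  \int[leb2]_p F (rotate t p) = \int[leb2]_p F p.
  exact: (preserving_integral (ge0_integral_rotate t)).
have iE (c : R) : \int[mu]_t ((\1_I t)%:E * c%:E) = (2 * pi * c)%:E.
  rewrite integralZr //; last first.
    exact: integrable_indic_itv.
  have muI : mu I = (2 * pi)%:E.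
    by rewrite /I lebesgue_measure_itv /= lte_fin pi2 -EFinB subr0.
  by rewrite integral_indic // setIT -[LHS]/(mu I * c%:E) muI -EFinM.
have ifin : \int[leb2]_p `|(k p)%:E| < +oo by case/integrableP: ik.
have fin1 : \int[leb2]_p `|(k p)%:E| \is a fin_num.
  by rewrite ge0_fin_numE // integral_ge0.
have fin2 : \int[leb2]_p (k p)%:E \is a fin_num by exact: integrable_fin_num.
have iPhi : (mu \x plane)%E.-integrable setT Phi.
  apply/(integrable12ltyP _ _ mPhi).
  rewrite (_ : \int[mu]_x _ = \int[mu]_t ((\1_I t)%:E * (fine (\int[leb2]_p `|(k
    p)%:E|))%:E)).
    by rewrite iE ltry.
  apply: eq_integral => t _; rewrite fineK //.
  rewrite -(rotE t (fun p => `|(k p)%:E|)); last first.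
    by apply: measurableT_comp => //; exact/measurable_EFinP.
  rewrite -ge0_integralZl //.
  - by apply: eq_integral => p _; rewrite /Phi /= normrM EFinM ger0_norm.
  - apply: measurableT_comp => //; apply/measurable_EFinP.
    exact: measurableT_comp mk (measurable_rotate t).
have H1 := integral12_prod_meas1 iPhi; have H2 := integral21_prod_meas1 iPhi.
rewrite -H2 in H1.
have E1 : \int[mu]_t fubini_F plane Phi t = (2 * pi * fine (\int[leb2]_p (k p)%:E))%:E.
  rewrite -iE; apply: eq_integral => t _; rewrite fineK //.
  rewrite -(rotE t (fun p => (k p)%:E)); last exact/measurable_EFinP.
  rewrite -integralZl //.
  exact: (preserving_integrable (measurable_rotate t) (ge0_integral_rotate t) ik).
have E2 : \int[leb2]_p fubini_G mu Phi p = 0.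
  transitivity (\int[leb2]_p (cst 0 p)); last by rewrite integral0.
  apply: eq_integral => p _.
  rewrite -[RHS](k0 p) [RHS]integral_mkcond /fubini_G; apply: eq_integral => t _.
  rewrite /Phi /= patchE indicE /I; by case: ifPn; rewrite ?mul1r ?mul0r.
move: H1; rewrite E1 E2 => -[/eqP]; rewrite mulf_eq0 gt_eqF //= => /eqP f0.
by rewrite -(fineK fin2) f0.
Qed.

End PlaneMeasurability.

(** * Integration against the Gaussian weight *)

Section PlaneIntegral.
Context {R : realType}.
Local Notation C := R[i].
Local Notation mR := (measurableTypeR R).
Local Notation mu := (@lebesgue_measure R).
Implicit Types (f g h : C -> C) (F G : C -> R) (z w l : C).

(** Measures live on pairs of reals, analysis on [C]. The predicates that follow transport
    measurability and integrability to functions on [C]. *)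
Definition toC (p : mR * mR) : C := p.1 +i* p.2.

Definition rmeas F := measurable_fun setT (fun p : mR * mR => F (toC p) : mR).
Definition cmeas f := rmeas (fun z => complex.Re (f z)) /\
  rmeas (fun z => complex.Im (f z)).
Definition rintegrable F := (@area R).-integrable setT (fun p => (F (toC p))%:E).
Definition rintegral F : R := Rintegral (@area R) setT (fun p => F (toC p)).
Definition cintegrable f := rintegrable (fun z => complex.Re (f z)) /\
  rintegrable (fun z => complex.Im (f z)).

Lemma rintegrable_meas F : rintegrable F -> rmeas F.
Proof. by move=> /integrableP[/measurable_EFinP]. Qed.

Lemma rintegrable_le F G : rmeas F -> rintegrable G -> (forall z, `|F z| <= G z) ->
  rintegrable F.
Proof.
move=> mF iG FG; apply: (le_integrable _ _ _ iG) => //; first exact/measurable_EFinP.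
by move=> p _; rewrite /= lee_fin (le_trans (FG _)) // ler_norm.
Qed.

Lemma rintegrableD F G : rintegrable F -> rintegrable G -> rintegrable (fun z =>
  F z + G z).
Proof.
move=> iF iG; rewrite /rintegrable (_ : (fun p => _) = (fun p =>
  (F (toC p))%:E + (G (toC p))%:E)%E) //.
exact: integrableD.
Qed.

Lemma rintegrableZ k F : rintegrable F -> rintegrable (fun z => k * F z).
Proof.
move=> iF; rewrite /rintegrable (_ : (fun p => _) = (fun p =>
  k%:E * (F (toC p))%:E)%E) //.
exact: integrableZl.
Qed.

Lemma rintegralD F G : rintegrable F -> rintegrable G -> rintegral (fun z =>
  F z + G z) = rintegral F + rintegral G.
Proof. by move=> iF iG; exact: RintegralD. Qed.

Lemma rintegralZ k F : rintegrable F -> rintegral (fun z => k * F z) = k * rintegral F.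
Proof. by move=> iF; exact: RintegralZl. Qed.

Lemma rintegral_le F G : rintegrable F -> rintegrable G -> (forall z, F z <= G z) ->
  rintegral F <= rintegral G.
Proof. by move=> iF iG FG; apply: le_Rintegral. Qed.

Lemma rintegral_ge0 F : (forall z, 0 <= F z) -> 0 <= rintegral F.
Proof. by move=> F0; apply: Rintegral_ge0. Qed.

Lemma EFin_rintegral F : rintegrable F -> ((rintegral F)%:E = \int[@area R]_p (F (toC
  p))%:E)%E.
Proof. by move=> iF; rewrite /rintegral /Rintegral fineK //;
  exact: integrable_fin_num. Qed.

Lemma cintegralE f : cintegral f = rintegral (fun z => complex.Re (f z)) +i*
  rintegral (fun z => complex.Im (f z)).
Proof. by []. Qed.

Lemma cmeas_entire f : entire f -> cmeas f.
Proof.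
move=> Hf; split.
- apply: (measurable_separately_continuous (f := fun x y =>
    complex.Re (f (x +i* y)))) => x.
    by have [] := entire_ccontinuous Hf (g := fun t : R => t +i* x) _;
       first by split => t /=; [exact: cvg_id|exact: cvg_cst].
  by have [] := entire_ccontinuous Hf (g := fun t : R => x +i* t) _;
     first by split => t /=; [exact: cvg_cst|exact: cvg_id].
- apply: (measurable_separately_continuous (f := fun x y =>
    complex.Im (f (x +i* y)))) => x.
    by have [] := entire_ccontinuous Hf (g := fun t : R => t +i* x) _;
       first by split => t /=; [exact: cvg_id|exact: cvg_cst].
  by have [] := entire_ccontinuous Hf (g := fun t : R => x +i* t) _;
     first by split => t /=; [exact: cvg_cst|exact: cvg_id].
Qed.

Lemma rmeas_cst k : rmeas (fun=> k).
Proof. exact: measurable_cst. Qed.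

Lemma rmeasD F G : rmeas F -> rmeas G -> rmeas (fun z => F z + G z).
Proof. exact: measurable_funD. Qed.

Lemma rmeasB F G : rmeas F -> rmeas G -> rmeas (fun z => F z - G z).
Proof. exact: measurable_funB. Qed.

Lemma rmeasM F G : rmeas F -> rmeas G -> rmeas (fun z => F z * G z).
Proof. exact: measurable_funM. Qed.

Lemma rmeas_comp (k : R -> R) F : continuous k -> rmeas F -> rmeas (fun z => k (F z)).
Proof. by move=> ck mF; apply: measurableT_comp mF;
  exact: continuous_measurable_fun. Qed.

Lemma cmeasM f g : cmeas f -> cmeas g -> cmeas (fun z => f z * g z).
Proof.
move=> [rf imf] [rg img]; split.
- rewrite (_ : (fun z => _) = fun z => complex.Re (f z) * complex.Re (g z) -
    complex.Im (f z) * complex.Im (g z)); last by apply/funext => z; rewrite ReM.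
  by apply: rmeasB; exact: rmeasM.
- rewrite (_ : (fun z => _) = fun z => complex.Re (f z) * complex.Im (g z) +
    complex.Im (f z) * complex.Re (g z)); last by apply/funext => z; rewrite ImM.
  by apply: rmeasD; exact: rmeasM.
Qed.

Lemma cmeas_real F : rmeas F -> cmeas (fun z => (F z)%:C).
Proof. by move=> mF; split => //; exact: rmeas_cst. Qed.

Lemma cmeas_conj f : cmeas f -> cmeas (fun z => conjc (f z)).
Proof.
move=> [rf imf]; split.
  by rewrite (_ : (fun z => _) = fun z => complex.Re (f z)) //; apply/funext => z;
    case: (f z).
rewrite (_ : (fun z => _) = fun z => 0 - complex.Im (f z)).
  by apply: rmeasB => //; exact: rmeas_cst.
by apply/funext => z; case: (f z) => ? ?; rewrite /= sub0r.
Qed.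

Lemma rmeas_normc2 f : cmeas f -> rmeas (fun z => normc (f z) ^+ 2).
Proof.
move=> [rf imf]; rewrite (_ : (fun z => _) = fun z =>
  complex.Re (f z) * complex.Re (f z) + complex.Im (f z) * complex.Im (f z)).
  by apply: rmeasD; exact: rmeasM.
by apply/funext => z; rewrite normc_sq !expr2.
Qed.

Lemma rmeas_normc f : cmeas f -> rmeas (fun z => normc (f z)).
Proof.
move=> /rmeas_normc2 /(rmeas_comp (k := Num.sqrt) (@sqrt_continuous R)).
by rewrite (_ : (fun z => _) = (fun z => normc (f z))) //; apply/funext => z;
  rewrite sqrtr_sqr ger0_norm // normc_ge0.
Qed.

Definition gaussw z : R := expR (- normc z ^+ 2).

Lemma gaussw_ge0 z : 0 <= gaussw z. Proof. exact: expR_ge0. Qed.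

Lemma rmeas_id : rmeas (fun z => normc z).
Proof. exact: rmeas_normc (cmeas_entire (@entire_id R)). Qed.

Lemma rmeas_expR F : rmeas F -> rmeas (fun z => expR (F z)).
Proof. by apply: rmeas_comp; exact: continuous_expR. Qed.

Lemma rmeas_gaussw : rmeas gaussw.
Proof.
apply: rmeas_expR; rewrite (_ : (fun z => _) = (fun z => 0 - normc z ^+ 2)).
  apply: rmeasB; first exact: rmeas_cst.
  exact: rmeas_normc2 (cmeas_entire (@entire_id R)).
by apply/funext => z; rewrite sub0r.
Qed.

Lemma integral_gauss_scaled (t : R) : 0 < t ->
  (\int[mu]_x (expR (- (t * x ^+ 2)))%:E < +oo)%E.
Proof.
move=> t0; have s0 : Num.sqrt t != 0 by rewrite gt_eqF // sqrtr_gt0.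
have := @ge0_integral_affine R (Num.sqrt t) 0 (EFin \o gauss_fun) s0.
rewrite integralT_gauss => H.
have -> : (\int[mu]_x (expR (- (t * x ^+ 2)))%:E =
    (`|Num.sqrt t|^-1)%:E * (Num.sqrt pi)%:E)%E.
  rewrite H; last 2 first.
  - by apply/measurable_EFinP; exact: measurable_gauss_fun.
  - by move=> x; rewrite lee_fin gauss_fun_ge0.
  rewrite muleA -EFinM mulVf ?normr_eq0 // mul1e; apply: eq_integral => x _.
  by rewrite /= /gauss_fun addr0 exprMn sqr_sqrtr // ltW.
by rewrite -EFinM ltry.
Qed.

Lemma rintegrable_gauss (t : R) : 0 < t -> rintegrable (fun z =>
  expR (- (t * normc z ^+ 2))).
Proof.
move=> t0.
have m : rmeas (fun z => expR (- (t * normc z ^+ 2))).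
  apply: rmeas_expR; rewrite (_ : (fun z => _) = (fun z => (- t) * normc z ^+ 2)).
    apply: rmeasM; first exact: rmeas_cst.
    exact: rmeas_normc2 (cmeas_entire (@entire_id R)).
  by apply/funext => z; rewrite mulNr.
apply/(integrable12ltyP mu mu); first exact/measurable_EFinP.
pose A := (\int[mu]_x (expR (- (t * x ^+ 2)))%:E)%E.
have Aoo : (A < +oo)%E := integral_gauss_scaled t0.
have A0 : (0 <= A)%E by apply: integral_ge0 => x _; rewrite lee_fin expR_ge0.
have mg : measurable_fun setT (fun x : mR => (expR (- (t * x ^+ 2)))%:E).
  apply/measurable_EFinP; apply: measurableT_comp => //.
  by apply: measurableT_comp; [exact: oppr_measurable|apply: measurable_funM;
    [exact: measurable_cst|exact: measurable_funX]].
have slice (x : R) : (\int[mu]_y `|(expR (- (t * normc (toC (x, y)) ^+ 2)))%:E| =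
    (expR (- (t * x ^+ 2)))%:E * A)%E.
  rewrite -ge0_integralZl //; apply: eq_integral => y _.
  by rewrite gee0_abs ?lee_fin ?expR_ge0 // -EFinM -expRD normc_sq mulrDr opprD.
under eq_integral do rewrite slice.
have finA : A \is a fin_num by rewrite ge0_fin_numE.
rewrite ge0_integralZr // -/A -(fineK finA) -EFinM ltry //.
Qed.

Lemma rintegrable_expgrowth (A B : R) : A < 1 ->
  rintegrable (fun z => expR (A * normc z ^+ 2 + B * normc z) * gaussw z).
Proof.
(* Half of the available decay absorbs the linear term: the exponent is -2 t r^2 + B r, and
   completing the square bounds it by B^2 / (4 t) - t r^2. *)
move=> A1; pose t := (1 - A) / 2.
have t0 : 0 < t by rewrite divr_gt0 // subr_gt0.
apply: (@rintegrable_le _ (fun z => expR (B ^+ 2 / (4 * t)) * expR (- (t * normc z ^+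
  2)))).
- apply: rmeasM rmeas_gaussw; apply: rmeas_expR; apply: rmeasD; apply: rmeasM.
  + exact: rmeas_cst.
  + exact: rmeas_normc2 (cmeas_entire (@entire_id R)).
  + exact: rmeas_cst.
  + exact: rmeas_id.
- exact/rintegrableZ/rintegrable_gauss.
- move=> z; rewrite ger0_norm ?mulr_ge0 ?expR_ge0 // /gaussw -!expRD ler_expR.
  set r := normc z; rewrite -subr_ge0.
  have -> : B ^+ 2 / (4 * t) + - (t * r ^+ 2) - (A * r ^+ 2 + B * r + - r ^+ 2) =
      (B - 2 * t * r) ^+ 2 / (4 * t).
    have tA : A = 1 - 2 * t by rewrite /t; field.
    by rewrite tA; field; rewrite gt_eqF.
  by rewrite divr_ge0 ?sqr_ge0 // mulr_ge0 // ltW.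
Qed.

End PlaneIntegral.

Section ComplexIntegral.
Context {R : realType}.
Local Notation C := R[i].
Implicit Types (f g h : C -> C) (F G : C -> R) (z w l : C).

Lemma cintegrable_le f G : cmeas f -> rintegrable G -> (forall z,
  normc (f z) <= G z) -> cintegrable f.
Proof.
move=> [rf imf] iG fG; split.
- by apply: (rintegrable_le rf iG) => z; rewrite (le_trans (normRe_le_normc _)).
- by apply: (rintegrable_le imf iG) => z; rewrite (le_trans (normIm_le_normc _)).
Qed.

Lemma rintegrable_eq F G : rintegrable F -> F =1 G -> rintegrable G.
Proof. by move=> + /funext <-. Qed.

Lemma rintegral_eq F G : F =1 G -> rintegral F = rintegral G.
Proof. by move=> /funext ->. Qed.

Lemma cintegral_eq f g : f =1 g -> cintegral f = cintegral g.
Proof. by move=> /funext ->. Qed.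

Lemma cintegrable_eq f g : cintegrable f -> f =1 g -> cintegrable g.
Proof. by move=> + /funext <-. Qed.

Lemma cintegrableD f g : cintegrable f -> cintegrable g -> cintegrable (fun z =>
  f z + g z).
Proof.
move=> [rf imf] [rg img]; split.
- by apply: (rintegrable_eq (rintegrableD rf rg)) => z; rewrite ReD.
- by apply: (rintegrable_eq (rintegrableD imf img)) => z; rewrite ImD.
Qed.

Lemma cintegralD f g : cintegrable f -> cintegrable g ->
  cintegral (fun z => f z + g z) = cintegral f + cintegral g.
Proof.
move=> [rf imf] [rg img]; rewrite !cintegralE; apply: eqc; rewrite /= -rintegralD //.
- by apply: rintegral_eq => z; rewrite ReD.
- by apply: rintegral_eq => z; rewrite ImD.
Qed.

Lemma cintegrableZ l f : cintegrable f -> cintegrable (fun z => l * f z).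
Proof.
move=> [rf imf]; split.
- apply: (rintegrable_eq (rintegrableD (rintegrableZ (complex.Re l) rf) (rintegrableZ
    (- complex.Im l) imf))).
  by move=> z; rewrite ReM mulNr.
- apply: (rintegrable_eq (rintegrableD (rintegrableZ (complex.Re l) imf)
    (rintegrableZ (complex.Im l) rf))).
  by move=> z; rewrite ImM.
Qed.

Lemma cintegralZ l f : cintegrable f -> cintegral (fun z => l * f z) = l * cintegral f.
Proof.
move=> [rf imf]; rewrite !cintegralE; apply: eqc; rewrite ?ReM ?ImM /=.
- rewrite -mulNr -!rintegralZ // -rintegralD; last 2 first.
  + exact: rintegrableZ.
  + exact: rintegrableZ.
  by apply: rintegral_eq => z; rewrite ReM mulNr.
- rewrite -!rintegralZ // -rintegralD; last 2 first.
  + exact: rintegrableZ.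
  + exact: rintegrableZ.
  by apply: rintegral_eq => z; rewrite ImM.
Qed.

Lemma cintegrableB f g : cintegrable f -> cintegrable g -> cintegrable (fun z =>
  f z - g z).
Proof.
move=> pf pg; apply: (cintegrable_eq (cintegrableD pf (cintegrableZ (-1) pg))) => z.
by rewrite mulN1r.
Qed.

Lemma cintegralB f g : cintegrable f -> cintegrable g ->
  cintegral (fun z => f z - g z) = cintegral f - cintegral g.
Proof.
move=> pf pg; rewrite -mulN1r -cintegralZ // -cintegralD //; last exact: cintegrableZ.
by apply: cintegral_eq => z; rewrite mulN1r.
Qed.

Lemma cintegral_conj f : cintegrable f ->
  cintegral (fun z => conjc (f z)) = conjc (cintegral f).
Proof.
move=> [rf imf]; rewrite !cintegralE; apply: eqc => /=.
- by apply: rintegral_eq => z; case: (f z).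
- by rewrite -mulN1r -rintegralZ //; apply: rintegral_eq => z; case: (f z) => ? ?;
    rewrite /= mulN1r.
Qed.

Lemma normc_cintegral f G : cintegrable f -> rintegrable G -> (forall z,
  normc (f z) <= G z) ->
  normc (cintegral f) <= rintegral G.
Proof.
move=> pf iG fG; apply: normc_le_dual => u u1.
rewrite -cintegralZ // cintegralE /=; apply: rintegral_le => //.
  by case: (cintegrableZ u pf).
move=> z; rewrite (le_trans (Re_le_normc _)) // Normc.normcM.
by rewrite (le_trans _ (fG z)) // ler_piMl ?normc_ge0.
Qed.

Lemma cintegral_real F : cintegral (fun z => (F z)%:C) = (rintegral F)%:C.
Proof.
rewrite cintegralE; apply: eqc => //=.
by rewrite /rintegral /Rintegral integral0.
Qed.

End ComplexIntegral.

(** * The Hilbert space of the Gaussian weight *)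

Section L2.
Context {R : realType}.
Local Notation C := R[i].
Local Notation mu := (@lebesgue_measure R).
Implicit Types (f g h : C -> C) (F G : C -> R) (z w l : C).

(* [sqnorm] and [inner] lack the factor 1 / pi of the Fock space norm. *)
Definition L2 f := cmeas f /\ rintegrable (fun z => normc (f z) ^+ 2 * gaussw z).
Definition sqnorm f : R := rintegral (fun z => normc (f z) ^+ 2 * gaussw z).
Definition inner f g : C := cintegral (fun z => f z * conjc (g z) * (gaussw z)%:C).

Lemma L2_eq f g : L2 f -> f =1 g -> L2 g.
Proof. by move=> + /funext <-. Qed.

Lemma sqnorm_ge0 f : 0 <= sqnorm f.
Proof. by apply: rintegral_ge0 => z; rewrite mulr_ge0 ?sqr_ge0 ?gaussw_ge0. Qed.

Lemma L2_prod f g : L2 f -> L2 g -> rintegrable (fun z =>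
  normc (f z) * normc (g z) * gaussw z).
Proof.
move=> [mf if_] [mg ig]; apply: (@rintegrable_le _ _ _ _ (rintegrableD if_ ig)).
  by apply: rmeasM (@rmeas_gaussw R); apply: rmeasM; exact: rmeas_normc.
move=> z; rewrite ger0_norm ?mulr_ge0 ?normc_ge0 ?gaussw_ge0 // -mulrDl.
rewrite ler_wpM2r ?gaussw_ge0 //.
by have := sqr_ge0 (normc (f z) - normc (g z)); have :=
  sqr_ge0 (normc (f z) + normc (g z)); nra.
Qed.

Lemma cintegrable_prod f g : L2 f -> L2 g -> cintegrable (fun z =>
  f z * conjc (g z) * (gaussw z)%:C).
Proof.
move=> Hf Hg; apply: (cintegrable_le _ (L2_prod Hf Hg)).
  apply: cmeasM (cmeas_real (@rmeas_gaussw R)); case: Hf => mf _; case: Hg => mg _.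
  by apply: cmeasM mf (cmeas_conj mg).
by move=> z; rewrite !Normc.normcM normc_conj normc_real ger0_norm // gaussw_ge0.
Qed.

Lemma L2Z l f : L2 f -> L2 (fun z => l * f z).
Proof.
move=> [mf if_]; split.
  by apply: cmeasM mf; split; exact: rmeas_cst.
apply: (rintegrable_eq (rintegrableZ (normc l ^+ 2) if_)) => z.
by rewrite Normc.normcM exprMn mulrA.
Qed.

Lemma sqnormZ l f : L2 f -> sqnorm (fun z => l * f z) = normc l ^+ 2 * sqnorm f.
Proof.
move=> [mf if_]; rewrite /sqnorm -rintegralZ //; apply: rintegral_eq => z.
by rewrite Normc.normcM exprMn -mulrA.
Qed.

Lemma cmeasD f g : cmeas f -> cmeas g -> cmeas (fun z => f z + g z).
Proof.
move=> [rf imf] [rg img]; split.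
- by rewrite (_ : (fun z => _) = fun z => complex.Re (f z) + complex.Re (g z));
    [exact: rmeasD|apply/funext => z; rewrite ReD].
- by rewrite (_ : (fun z => _) = fun z => complex.Im (f z) + complex.Im (g z));
    [exact: rmeasD|apply/funext => z; rewrite ImD].
Qed.

Lemma weighted_sum (s t x y e : R) :
  s * (x * e) + t * (y * e) = (s * x + t * y) * e.
Proof. by ring. Qed.

Lemma normcD_sq z w : normc (z + w) ^+ 2 <= 2 * normc z ^+ 2 + 2 * normc w ^+ 2.
Proof.
have := normcD z w; have := normc_ge0 (z + w); have := normc_ge0 z.
have := normc_ge0 w; have := sqr_ge0 (normc z - normc w); nra.
Qed.

Lemma L2D f g : L2 f -> L2 g -> L2 (fun z => f z + g z).
Proof.
move=> [mf if_] [mg ig]; have mfg := cmeasD mf mg; split => //.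
apply: (@rintegrable_le _ _ _ _ (rintegrableD (rintegrableZ 2 if_) (rintegrableZ 2
  ig))).
  by apply: rmeasM (@rmeas_gaussw R); exact: rmeas_normc2.
move=> z; rewrite ger0_norm ?mulr_ge0 ?normc_ge0 ?sqr_ge0 ?gaussw_ge0 //.
rewrite weighted_sum ler_wpM2r ?gaussw_ge0 //; exact: normcD_sq.
Qed.

Lemma L2B f g : L2 f -> L2 g -> L2 (fun z => f z - g z).
Proof.
move=> Hf Hg; apply: (L2_eq (L2D Hf (L2Z (-1) Hg))) => z.
by rewrite mulN1r.
Qed.

Lemma innerDl f g h : L2 f -> L2 g -> L2 h ->
  inner (fun z => f z + g z) h = inner f h + inner g h.
Proof.
move=> Hf Hg Hh; rewrite /inner -cintegralD; [|exact: cintegrable_prod|exact: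
  cintegrable_prod].
by apply: cintegral_eq => z; rewrite !mulrDl.
Qed.

Lemma innerZl l f h : L2 f -> L2 h -> inner (fun z => l * f z) h = l * inner f h.
Proof.
move=> Hf Hh; rewrite /inner -cintegralZ; last exact: cintegrable_prod.
by apply: cintegral_eq => z; rewrite !mulrA.
Qed.

Lemma innerC f g : L2 f -> L2 g -> inner g f = conjc (inner f g).
Proof.
move=> Hf Hg; rewrite /inner -cintegral_conj; last exact: cintegrable_prod.
by apply: cintegral_eq => z; rewrite !rmorphM /= conjcK oppr0 (mulrC (g z)).
Qed.

Lemma innerBl f g h : L2 f -> L2 g -> L2 h ->
  inner (fun z => f z - g z) h = inner f h - inner g h.
Proof.
move=> Hf Hg Hh; have E : (fun z => f z - g z) = (fun z => f z + -1 * g z).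
  by apply/funext => z; rewrite mulN1r.
by rewrite E innerDl // ?innerZl // ?mulN1r //; exact: L2Z.
Qed.

Lemma innerDr f g h : L2 f -> L2 g -> L2 h ->
  inner h (fun z => f z + g z) = inner h f + inner h g.
Proof.
move=> Hf Hg Hh; have Hfg := L2D Hf Hg.
by rewrite (innerC Hfg Hh) innerDl // (innerC Hf Hh) (innerC Hg Hh); exact: rmorphD.
Qed.

Lemma innerZr l f h : L2 f -> L2 h -> inner h (fun z => l * f z) = conjc l * inner h f.
Proof.
move=> Hf Hh; have Hlf := L2Z l Hf.
by rewrite (innerC Hlf Hh) innerZl // (innerC Hf Hh); exact: rmorphM.
Qed.

Lemma innerBr f g h : L2 f -> L2 g -> L2 h ->
  inner h (fun z => f z - g z) = inner h f - inner h g.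
Proof.
move=> Hf Hg Hh; have Hfg := L2B Hf Hg.
by rewrite (innerC Hfg Hh) innerBl // (innerC Hf Hh) (innerC Hg Hh); exact: rmorphB.
Qed.

Lemma inner_self f : inner f f = (sqnorm f)%:C.
Proof.
rewrite /sqnorm -cintegral_real; apply: cintegral_eq => z.
rewrite rmorphM /=; congr (_ * _).
by rewrite normc_sq; case: (f z) => x y; apply: eqc => /=; ring.
Qed.

(** Passes from the weighted inequality of arithmetic and geometric means, which can be integrated
    pointwise, to the product form of Cauchy-Schwarz. *)
Lemma le_sqr_of_weighted (X A B : R) : 0 <= X -> 0 <= A -> 0 <= B ->
  (forall t, 0 < t -> 2 * X <= t * A + B / t) -> X ^+ 2 <= A * B.
Proof.
rewrite le_eqVlt => /predU1P[<- A0 B0 _|X0].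
  by rewrite expr0n mulr_ge0.
rewrite le_eqVlt => /predU1P[<- B0 H|A0 B0 H].
  have B1 : 0 < B + 1 by rewrite ltr_wpDl.
  (* For A = 0 the hypothesis reads 2 X <= B / t, and this t makes the right side at most X, which
     contradicts X > 0. *)
  have t0 : 0 < (B + 1) / X by rewrite divr_gt0.
  have := H _ t0; rewrite mulr0 add0r.
  have -> : B / ((B + 1) / X) = X * (B / (B + 1)).
    by field; rewrite (gt_eqF B1) (gt_eqF X0).
  have : B / (B + 1) <= 1 by rewrite ler_pdivrMr // mul1r lerDl.
  nra.
(* This t turns the hypothesis into 2 X <= X + A B / X. *)
have t0 : 0 < X / A by rewrite divr_gt0.
have := H _ t0; rewrite divfK ?gt_eqF // => H1.
have : X <= A * B / X.
  have -> : A * B / X = B / (X / A) by field; rewrite (gt_eqF X0) (gt_eqF A0).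
  lra.
by rewrite ler_pdivlMr // expr2.
Qed.

(** Integrate 2 |f| |g| <= t |f|^2 + |g|^2 / t and let t vary. *)
Lemma cauchy_schwarz f g : L2 f -> L2 g -> normc (inner f g) ^+ 2 <= sqnorm f *
  sqnorm g.
Proof.
move=> Hf Hg; apply: le_sqr_of_weighted; rewrite ?normc_ge0 ?sqnorm_ge0 // => t t0.
have ifg := L2_prod Hf Hg.
have : normc (inner f g) <= rintegral (fun z => normc (f z) * normc (g z) * gaussw z).
  apply: normc_cintegral => //; first exact: cintegrable_prod.
  by move=> z; rewrite !Normc.normcM normc_conj normc_real ger0_norm // gaussw_ge0.
move=> /(ler_wpM2l (ler0n _ 2)) /le_trans; apply.
case: Hf => mf if_; case: Hg => mg ig.
rewrite (mulrC (sqnorm g)) /sqnorm -!rintegralZ // -rintegralD; last 2 first.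
- exact: rintegrableZ.
- exact: rintegrableZ.
apply: rintegral_le; [exact: rintegrableZ|by apply: rintegrableD; exact: rintegrableZ|].
move=> z; rewrite weighted_sum (mulrA 2) ler_wpM2r ?gaussw_ge0 // -subr_ge0.
have -> : t * normc (f z) ^+ 2 + t^-1 * normc (g z) ^+ 2 - 2 * (normc (f z) * normc
  (g z))
   = (t * normc (f z) - normc (g z)) ^+ 2 / t by field; rewrite gt_eqF.
by rewrite divr_ge0 ?sqr_ge0 // ltW.
Qed.

(** The working test for membership. Squaring doubles the exponent, so the threshold 1 of
    [rintegrable_expgrowth] becomes 1/2. *)
Lemma L2_growth f (K A B : R) : cmeas f -> A < 1 / 2 ->
  (forall z, normc (f z) <= K * expR (A * normc z ^+ 2 + B * normc z)) -> L2 f.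
Proof.
move=> mf A12 fK; split => //.
have A1 : 2 * A < 1 by lra.
apply: (@rintegrable_le _ _ _ _ (rintegrableZ (K ^+ 2) (rintegrable_expgrowth (2 * B)
  A1))).
  by apply: rmeasM (@rmeas_gaussw R); exact: rmeas_normc2.
move=> z; rewrite ger0_norm ?mulr_ge0 ?normc_ge0 ?sqr_ge0 ?gaussw_ge0 // mulrA.
rewrite ler_wpM2r ?gaussw_ge0 //.
have -> : 2 * A * normc z ^+ 2 + 2 * B * normc z =
  (A * normc z ^+ 2 + B * normc z) + (A * normc z ^+ 2 + B * normc z) by ring.
rewrite expRD -expr2 -exprMn ler_sqr ?nnegrE ?normc_ge0 //.
exact: le_trans (normc_ge0 _) (fK z).
Qed.

Lemma rintegrable_gaussw : rintegrable (@gaussw R).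
Proof.
apply: (rintegrable_eq (@rintegrable_expgrowth R 0 0 ltr01)) => z.
by rewrite !mul0r addr0 expR0 mul1r.
Qed.

(** By Tonelli the integral is the square of the one-dimensional Gauss integral, that is pi. Its
    sign is what the later arguments use. *)
Lemma rintegral_gaussw_gt0 : 0 < rintegral (@gaussw R).
Proof.
have m := rintegrable_meas rintegrable_gaussw.
have sp : (0 < \int[mu]_x (gauss_fun x)%:E :> \bar R)%E.
  by rewrite integralT_gauss lte_fin sqrtr_gt0 pi_gt0.
rewrite -lte_fin EFin_rintegral; last exact: rintegrable_gaussw.
rewrite [X in (_ < X)%E](fubini_tonelli1 (m1 := mu) (m2 := mu)); last 2 first.
- exact/measurable_EFinP.
- by move=> p; rewrite lee_fin gaussw_ge0.
rewrite (_ : (\int[mu]_x _ = \int[mu]_x ((gauss_fun x)%:E * (Num.sqrt pi)%:E))%E).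
  rewrite ge0_integralZr //; last 2 first.
  - by apply/measurable_EFinP; exact: measurable_gauss_fun.
  - by move=> x _; rewrite lee_fin gauss_fun_ge0.
  by rewrite mule_gt0 // lte_fin sqrtr_gt0 pi_gt0.
apply: eq_integral => x _; rewrite /fubini_F -integralT_gauss -ge0_integralZl //.
- apply: eq_integral => y _; rewrite -EFinM /gaussw normc_sq /= /gauss_fun.
  by rewrite opprD expRD.
- by apply/measurable_EFinP; exact: measurable_gauss_fun.
- by move=> y _; rewrite lee_fin gauss_fun_ge0.
- by rewrite lee_fin gauss_fun_ge0.
Qed.

Lemma fock_L2 f : fock f <-> entire f /\ L2 f.
Proof.
have pi0 : 0 < pi^-1 :> R by rewrite invr_gt0 pi_gt0.
split=> [[ef nf]|[ef [mf if_]]].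
  split => //; have mf := cmeas_entire ef; split => //.
  have m : rmeas (fun z => normc (f z) ^+ 2 * gaussw z).
    by apply: rmeasM (@rmeas_gaussw R); exact: rmeas_normc2.
  apply/integrableP; split; first exact/measurable_EFinP.
  rewrite [X in (X < _)%E](_ : _ = \int[@area R]_p (normc (f (toC p)) ^+ 2 * gaussw
    (toC p))%:E)%E.
    rewrite ltey; apply/negP => /eqP Ioo; move: nf; rewrite /fock_sqnorm.
    by rewrite [X in (_ * X)%E](_ : _ = +oo%E) // gt0_muley ?lte_fin.
  apply: eq_integral => p _; rewrite gee0_abs // lee_fin.
  by rewrite mulr_ge0 ?sqr_ge0 ?gaussw_ge0.
split => //; rewrite /fock_sqnorm.
rewrite (_ : (\int[area]_p _ = (sqnorm f)%:E)%E); last by rewrite EFin_rintegral.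
by rewrite -EFinM ltry.
Qed.

Lemma fock_normE f : fock f -> fock_norm f = Num.sqrt (pi^-1 * sqnorm f).
Proof.
move=> /fock_L2[ef [mf if_]]; rewrite /fock_norm /fock_sqnorm.
by rewrite (_ : (\int[area]_p _ = (sqnorm f)%:E)%E); last by rewrite EFin_rintegral.
Qed.

Lemma fock_innerE f g : fock_inner f g = (pi^-1)%:C * inner f g.
Proof. by []. Qed.

End L2.

(** * The reproducing property *)

Section Reproducing.
Context {R : realType}.
Local Notation C := R[i].
Local Notation mR := (measurableTypeR R).
Local Notation mu := (@lebesgue_measure R).
Implicit Types (f g h : C -> C) (F G : C -> R) (z w l : C).

Lemma integral_circle (k : R -> C) : ccontinuous k ->
  (\int[mu]_(t in `[0%R, (2 * pi)%R]) (complex.Re (k t))%:E =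
   (complex.Re (curve_int k 0 (2 * pi)))%:E)%E.
Proof.
move=> [ck _]; have pi2 : 0 <= 2 * pi :> R by rewrite mulr_ge0 ?pi_ge0.
rewrite /curve_int ReD ReN /= /prim lexx pi2 set_itv1 Rintegral_set1 subr0.
by rewrite /Rintegral fineK //; apply: integrable_fin_num => //;
  exact: continuous_integrable.
Qed.

Lemma toC_rotate t (p : mR * mR) : toC (rotate t p) = toC p * cis t.
Proof. by apply: eqc; rewrite /=; ring. Qed.

Lemma conjc_cis (t : R) : conjc (cis t) = cis (- t).
Proof. by rewrite /cis cosN sinN. Qed.

Lemma cisX (t : R) n : cis t ^+ n = cis (n%:R * t).
Proof.
rewrite !cisE -cexpMn; congr cexp.
by rewrite -(rmorph_nat (real_complex R)); apply: eqc => /=; ring.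
Qed.

Lemma gaussw_cis z t : gaussw (z * cis t) = gaussw z.
Proof. by rewrite /gaussw Normc.normcM normc_cis mulr1. Qed.

Lemma ccontinuousZ l (k : R -> C) : ccontinuous k -> ccontinuous (fun t => l * k t).
Proof.
move=> [rk ik]; split => t.
- rewrite (_ : (fun s => _) = fun s => complex.Re l * complex.Re (k s) -
    complex.Im l * complex.Im (k s)); last by apply/funext => s; rewrite ReM.
  by apply: cvgB; apply: cvgM; [exact: cvg_cst|exact: rk|exact: cvg_cst|exact: ik].
- rewrite (_ : (fun s => _) = fun s => complex.Re l * complex.Im (k s) +
    complex.Im l * complex.Re (k s)); last by apply/funext => s; rewrite ImM.
  by apply: cvgD; apply: cvgM; [exact: cvg_cst|exact: ik|exact: cvg_cst|exact: rk].
Qed.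

(** Along the circle through z the integrand is a constant multiple of [circ n h z], so its rotation
    mean is a multiple of [cmean n h z]. Working with the real part of an arbitrary multiple [l]
    covers both components, by l = 1 and l = -i. *)
Lemma plane_mean_zero h n : entire h ->
  cintegrable (fun z => h z * conjc z ^+ n * (gaussw z)%:C) ->
  (forall z, cmean n h z = 0) ->
  cintegral (fun z => h z * conjc z ^+ n * (gaussw z)%:C) = 0.
Proof.
move=> eh ph h0.
have H l : rintegral (fun z => complex.Re (l * (h z * conjc z ^+ n * (gaussw z)%:C)))
  = 0.
  have [rp _] := cintegrableZ l ph.
  rewrite /rintegral /Rintegral.
  rewrite [X in fine X](_ : _ = 0%E) //.
  apply: (rotation_mean_zero rp) => p; set z := toC p.
  have E t : l * (h (toC (rotate t p)) * conjc (toC (rotate t p)) ^+ n *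
      (gaussw (toC (rotate t p)))%:C) =
      l * conjc z ^+ n * (gaussw z)%:C * circ n h z t.
    have cE : conjc (z * cis t) = conjc z * cis (- t).
      by rewrite -conjc_cis; exact: rmorphM.
    rewrite toC_rotate -/z gaussw_cis cE exprMn /circ cisX mulrN.
    have gen (a b c d : C) : l * (a * (b * d) * c) = l * b * c * (a * d) by ring.
    exact: gen.
  under eq_integral do rewrite E.
  rewrite integral_circle; last by apply: ccontinuousZ; exact: ccontinuous_circ.
  rewrite curve_intZ; [|exact: ccontinuous_circ|by apply: ccontinuousZ;
    exact: ccontinuous_circ].
  by rewrite -/(cmean n h z) h0 mulr0.
rewrite cintegralE; apply: eqc => /=.
- by rewrite -[RHS](H 1); apply: rintegral_eq => z; rewrite mul1r.
- rewrite -[RHS](H (0 +i* -1)); apply: rintegral_eq => z.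
  by rewrite [in RHS]ReM /= mul0r sub0r mulN1r opprK.
Qed.

Lemma cintegrable_shift f w : cintegrable f -> cintegrable (fun z => f (z + w)).
Proof.
have P F : rintegrable F -> rintegrable (fun z => F (z + w)).
  move=> iF; have := preserving_integrable (measurable_shift2 (complex.Re w)
    (complex.Im w)) (ge0_integral_shift2 (complex.Re w) (complex.Im w)) iF.
  by congr (_.-integrable _ _); apply/funext => p; rewrite /= /toC; congr (F _)%:E;
    case: w.
by move=> [rf imf]; split; [exact: (P (fun z => complex.Re (f z)))|
  exact: (P (fun z => complex.Im (f z)))].
Qed.

Lemma cintegral_shift f w : cintegrable f -> cintegral (fun z =>
  f (z + w)) = cintegral f.
Proof.
have P F : rintegrable F -> rintegral (fun z => F (z + w)) = rintegral F.
  move=> iF; rewrite /rintegral /Rintegral; congr fine.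
  rewrite -[RHS](preserving_integral (ge0_integral_shift2 (complex.Re w) (complex.Im
    w))).
    by apply: eq_integral => p _; rewrite /toC; congr (F _)%:E; case: w.
  by case/integrableP: iF.
move=> [rf imf]; rewrite !cintegralE; congr Complex.
- exact: (P (fun z => complex.Re (f z))).
- exact: (P (fun z => complex.Im (f z))).
Qed.

Lemma normc_linear_le w z : normc (w * z) <= 0 * normc z ^+ 2 + normc w * normc z.
Proof. by rewrite mul0r add0r Normc.normcM. Qed.

Lemma entire_linear w : entire (fun z => w * z).
Proof. by apply: entireM; [exact: entire_cst|exact: entire_id]. Qed.

Lemma L2_cexp w : L2 (fun z => cexp (w * z)).
Proof.
apply: (@L2_growth _ _ 1 0 (normc w)).
- by apply: cmeas_entire; apply: entire_cexp_comp; exact: entire_linear.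
- lra.
- move=> z; rewrite mul1r (le_trans (cexp_normle _)) // ler_expR.
  exact: normc_linear_le.
Qed.

Lemma conjc_kernel w z : cexp (w * conjc z) = conjc (cexp (conjc w * z)).
Proof.
rewrite conjc_cexp; congr cexp.
by case: w z => a b [x y]; apply: eqc => /=; ring.
Qed.

Lemma kernel_inner f w : cintegral (fun z => f z * cexp (w * conjc z) * (gaussw z)%:C) =
  inner f (fun z => cexp (conjc w * z)).
Proof. by apply: cintegral_eq => z; rewrite conjc_kernel. Qed.

(** The exponent on the left is w conj(z + w) - |z + w|^2 = -z conj(z + w) = -|z|^2 - conj(w) z. *)
Lemma gaussw_shift w z : cexp (w * conjc (z + w)) * (gaussw (z + w))%:C =
  cexp (- (conjc w * z)) * (gaussw z)%:C.
Proof.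
have gE v : (gaussw v)%:C = cexp (- (v * conjc v)) :> C.
  rewrite /gaussw normc_sq /cexp; case: v => x y.
  have -> : - ((x +i* y) * conjc (x +i* y)) = (- (x ^+ 2 + y ^+ 2)) +i* 0.
    by apply: eqc => /=; ring.
  by rewrite /= cos0 sin0 mulr1.
rewrite !gE -!cexpD; congr cexp.
by case: w z => a b [x y]; apply: eqc => /=; ring.
Qed.

(** Translation by [w] moves the claim to the origin: the integrand becomes an entire [h] with h(0)
    = f(w) times the weight, and h - h(0) has vanishing circle means. *)
Lemma reproducing f w : fock f ->
  inner f (fun z => cexp (conjc w * z)) = (rintegral (@gaussw R))%:C * f w.
Proof.
move=> /fock_L2[ef lf]; rewrite -kernel_inner.
(* [h] times the Gaussian weight is the integrand on the left, shifted by [w]. *)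
pose h z := f (z + w) * cexp (- (conjc w * z)).
have eh : entire h.
  apply: entireM.
    apply: (@entire_comp _ f (fun z => z + w) ef).
    by apply: entireD; [exact: entire_id|exact: entire_cst].
  by apply: entire_cexp_comp; apply: entireN; exact: entire_linear.
have pf : cintegrable (fun z => f z * cexp (w * conjc z) * (gaussw z)%:C).
  by apply: (cintegrable_eq (cintegrable_prod lf (L2_cexp (conjc w)))) => z;
    rewrite conjc_kernel.
have hE z : f (z + w) * cexp (w * conjc (z + w)) * (gaussw (z + w))%:C = h z *
  (gaussw z)%:C.
  by rewrite -mulrA gaussw_shift mulrA.
have ph : cintegrable (fun z => h z * (gaussw z)%:C).
  by apply: (cintegrable_eq (cintegrable_shift w pf)).
rewrite -(cintegral_shift w pf) (cintegral_eq hE).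
have p0 : cintegrable (fun z => h 0 * (gaussw z)%:C).
  apply: cintegrableZ; split; first exact: rintegrable_gaussw.
  by apply: (rintegrable_eq (rintegrableZ 0 (@rintegrable_gaussw R))) => z;
    rewrite mul0r.
pose h0 z := h z - h 0.
have eh0 : entire h0 := entireB eh (@entire_cst R (h 0)).
have := @plane_mean_zero h0 0 eh0.
have E z : h0 z * conjc z ^+ 0 * (gaussw z)%:C = h z * (gaussw z)%:C - h 0 * (gaussw
  z)%:C.
  by rewrite expr0 mulr1 mulrBl.
rewrite (cintegral_eq E) cintegralB // cintegralZ; last first.
  split; first exact: rintegrable_gaussw.
  by apply: (rintegrable_eq (rintegrableZ 0 (@rintegrable_gaussw R))) => z;
    rewrite mul0r.
rewrite cintegral_real.
have -> : h 0 = f w by rewrite /h add0r mulr0 oppr0 cexp0 mulr1.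
move=> H; rewrite mulrC; apply/eqP; rewrite -subr_eq0; apply/eqP; apply: H.
- by apply: (cintegrable_eq (cintegrableB ph p0)) => z; rewrite E.
- by move=> z; rewrite cmean0 // /h0 subrr mulr0.
Qed.

Lemma fock_eq0 f : fock f -> (forall w, inner f (fun z => cexp (w * z)) = 0) ->
  f = fun=> 0.
Proof.
move=> Ff H; apply/funext => w; have := reproducing w Ff; rewrite H => /esym/eqP.
rewrite mulf_eq0 => /orP[|/eqP //].
by rewrite eq_complex /= gt_eqF // rintegral_gaussw_gt0.
Qed.

Lemma fock_posdef f : fock f -> sqnorm f = 0 -> f = fun=> 0.
Proof.
move=> Ff N0; apply: fock_eq0 => // w.
have [_ lf] := (fock_L2 f).1 Ff.
have := cauchy_schwarz lf (L2_cexp w); rewrite N0 mul0r => H.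
apply/eqP; rewrite -normc_eq0 -sqrf_eq0 eq_le H sqr_ge0 //.
Qed.

(** From 2 |w| |z| <= 2 |w|^2 + |z|^2 / 2, which leaves half of the Gaussian decay. The sharp
    exponent is |w|^2; the dilation in [wcomp_eigenvalue] makes up for the loss. *)
Lemma sqnorm_kernel_le w : sqnorm (fun z => cexp (w * z)) <=
  expR (2 * normc w ^+ 2) * rintegral (fun z =>
    expR (1 / 2 * normc z ^+ 2 + 0 * normc z) * gaussw z).
Proof.
have h1 : 1 / 2 < 1 :> R by lra.
rewrite -rintegralZ; last exact: rintegrable_expgrowth.
apply: rintegral_le.
- by case: (L2_cexp w).
- by apply: rintegrableZ; exact: rintegrable_expgrowth.
- move=> z; rewrite mulrA ler_wpM2r ?gaussw_ge0 // cexp_norm expr2 -!expRD ler_expR.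
  have := Re_le_normc (w * z); rewrite Normc.normcM => H.
  have := sqr_ge0 (2 * normc w - normc z); nra.
Qed.

Lemma point_evaluation : exists2 K : R, 0 < K & forall f w, fock f ->
  normc (f w) ^+ 2 <= K * expR (2 * normc w ^+ 2) * sqnorm f.
Proof.
have k0 := @rintegral_gaussw_gt0 R; set k := rintegral gaussw in k0.
pose J := rintegral (fun z : C => expR (1 / 2 * normc z ^+ 2 + 0 * normc z) * gaussw z).
have J0 : 0 <= J by apply: rintegral_ge0 => z; rewrite mulr_ge0 ?expR_ge0 ?gaussw_ge0.
exists ((J + 1) / k ^+ 2); first by rewrite divr_gt0 ?exprn_gt0 // ltr_wpDl.
move=> f w Ff; have [_ lf] := (fock_L2 f).1 Ff.
have := cauchy_schwarz lf (L2_cexp (conjc w)); rewrite reproducing // -/k.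
rewrite Normc.normcM normc_real (ger0_norm (ltW k0)) exprMn => H.
have := sqnorm_kernel_le (conjc w); rewrite normc_conj -/J => HJ.
set E := expR _ in HJ *.
have -> : (J + 1) / k ^+ 2 * E * sqnorm f = (J + 1) * E * sqnorm f / k ^+ 2.
  by field; rewrite gt_eqF.
rewrite ler_pdivlMr ?exprn_gt0 // mulrC (le_trans H) // mulrC.
rewrite ler_wpM2r ?sqnorm_ge0 // (le_trans HJ) // mulrC.
by rewrite ler_wpM2r ?expR_ge0 // lerDl.
Qed.

End Reproducing.

(** * Completeness of the Fock space *)

Section Completeness.
Context {R : realType}.
Local Notation C := R[i].
Implicit Types (f g h : C -> C) (F G : C -> R) (z w l : C).

Lemma pow_fact_le_expR (x : R) n : 0 <= x -> x ^+ n / n`!%:R <= expR x.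
Proof.
move=> x0; case: n => [|n]; first by rewrite expr0 fact0 divr1 -expR0 ler_expR.
by rewrite (le_trans _ (expR_ge1Dxn n x0)) // lerDr.
Qed.

Lemma L2_expR_normc (k B : R) : L2 (fun z => (k * expR (B * normc z))%:C).
Proof.
apply: (@L2_growth _ _ `|k| 0 B).
- apply: cmeas_real; apply: rmeasM; first exact: rmeas_cst.
  apply: rmeas_expR; apply: rmeasM; first exact: rmeas_cst.
  exact: rmeas_id.
- lra.
- by move=> z; rewrite normc_real normrM (ger0_norm (expR_ge0 _)) mul0r add0r.
Qed.

(** Differentiation under the integral sign, with an error of order |k|^2 for the increment [k].
    Only [L2 g] is assumed because the lemma is applied to a limit function whose analyticity is the
    point at issue. *)
Lemma kernel_entire g : L2 g ->
  entire (fun w => cintegral (fun z => g z * cexp (w * conjc z) * (gaussw z)%:C)).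
Proof.
move=> lg; apply/entireP => w.
have mconj : cmeas (fun z : C => conjc z) by exact: cmeas_conj (cmeas_entire
  (@entire_id R)).
have pk v : cintegrable (fun z => g z * cexp (v * conjc z) * (gaussw z)%:C).
  by apply: (cintegrable_eq (cintegrable_prod lg (L2_cexp (conjc v)))) => z;
    rewrite conjc_kernel.
have lD : L2 (fun z => z * cexp (conjc w * z)).
  apply: (@L2_growth _ _ 1 0 (normc w + 1)).
  - apply: cmeas_entire; apply: entireM (@entire_id R) _.
    by apply: entire_cexp_comp; exact: entire_linear.
  - lra.
  - move=> z; rewrite mul1r mul0r add0r Normc.normcM mulrDl mul1r expRD mulrC.
    apply: ler_pM; rewrite ?normc_ge0 //.
      by rewrite (le_trans (cexp_normle _)) // ler_expR Normc.normcM normc_conj.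
    by have := pow_fact_le_expR 1 (normc_ge0 z); rewrite expr1 divr1.
have pD : cintegrable (fun z => g z * (conjc z * cexp (w * conjc z)) * (gaussw z)%:C).
  apply: (cintegrable_eq (cintegrable_prod lg lD)) => z; rewrite conjc_kernel.
  by congr (_ * _ * _); exact: rmorphM.
exists (cintegral (fun z => g z * (conjc z * cexp (w * conjc z)) * (gaussw z)%:C)).
(* Majorant of the second-order error for |k| <= 1: with r = |z| the error is at most |k|^2 r^2
   exp(r) exp(|w| r), and r^2 <= 2 exp(r). *)
pose b z : C := (2 * expR ((normc w + 2) * normc z))%:C.
have lb : L2 b := L2_expR_normc _ _.
pose K := rintegral (fun z => normc (g z) * normc (b z) * gaussw z).
have K0 : 0 <= K.
  by apply: rintegral_ge0 => z; rewrite !mulr_ge0 ?normc_ge0 ?gaussw_ge0.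
have K1 : 0 < K + 1 by rewrite ltr_wpDl.
move=> e e0; exists (Num.min 1 (e / (K + 1))); first by rewrite lt_min ltr01 divr_gt0.
move=> k; rewrite lt_min => /andP[k1 ke].
rewrite (mulrC (cintegral _) k) -cintegralB // -cintegralZ // -cintegralB //;
  last 2 first.
- exact: cintegrableB.
- exact: cintegrableZ.
have bound z : normc (g z * cexp ((w + k) * conjc z) * (gaussw z)%:C -
    g z * cexp (w * conjc z) * (gaussw z)%:C -
    k * (g z * (conjc z * cexp (w * conjc z)) * (gaussw z)%:C)) <=
    normc k ^+ 2 * (normc (g z) * normc (b z) * gaussw z).
  have E a c v x : a * (c * x) * v - a * c * v - k * (a * (conjc z * c) * v) =
      a * c * (x - 1 - k * conjc z) * v by ring.
  have gE : normc (gaussw z)%:C = gaussw z by rewrite normc_real ger0_norm ?gaussw_ge0.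
  have N4 (a c x v : C) : normc (a * c * x * v) = normc a * normc c * normc x * normc v.
    by rewrite !Normc.normcM.
  rewrite mulrDl cexpD E N4 gE.
  have -> : normc k ^+ 2 * (normc (g z) * normc (b z) * gaussw z) =
    normc (g z) * (normc k ^+ 2 * normc (b z)) * gaussw z by ring.
  rewrite ler_wpM2r ?gaussw_ge0 // -mulrA ler_wpM2l ?normc_ge0 //.
  set r := normc z.
  have rem : normc (cexp (k * conjc z) - 1 - k * conjc z) <= normc k ^+ 2 * r ^+ 2 *
    expR r.
    rewrite (le_trans (cexp_quadratic_remainder _)) // Normc.normcM normc_conj exprMn.
    apply: ler_wpM2l; first by apply: mulr_ge0; apply: exprn_ge0; exact: normc_ge0.
    by rewrite ler_expR ler_piMl ?normc_ge0 // ltW.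
  have ker : normc (cexp (w * conjc z)) <= expR (normc w * r).
    by rewrite (le_trans (cexp_normle _)) // ler_expR Normc.normcM normc_conj.
  rewrite (le_trans (ler_pM (normc_ge0 _) (normc_ge0 _) ker rem)) //.
  have -> : normc (b z) = 2 * (expR (normc w * r) * (expR r * expR r)).
    rewrite normc_real ger0_norm ?mulr_ge0 ?expR_ge0 // -!expRD -/r.
    by congr (_ * expR _); ring.
  have r2 : r ^+ 2 <= 2 * expR r.
    have := pow_fact_le_expR 2 (normc_ge0 z).
    by rewrite ler_pdivrMr // mulrC.
  have -> : expR (normc w * r) * (normc k ^+ 2 * r ^+ 2 * expR r) =
    r ^+ 2 * (normc k ^+ 2 * expR (normc w * r) * expR r) by ring.
  have -> : normc k ^+ 2 * (2 * (expR (normc w * r) * (expR r * expR r))) =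
    2 * expR r * (normc k ^+ 2 * expR (normc w * r) * expR r) by ring.
  apply: ler_wpM2r r2; apply: mulr_ge0; last exact: expR_ge0.
  by apply: mulr_ge0; [apply: exprn_ge0; exact: normc_ge0|exact: expR_ge0].
have iK := L2_prod lg lb.
rewrite (le_trans (normc_cintegral _ (rintegrableZ (normc k ^+ 2) iK) bound)) //.
  by apply: cintegrableB; [exact: cintegrableB|exact: cintegrableZ].
rewrite rintegralZ // -/K expr2 mulrAC ler_wpM2r ?normc_ge0 //.
have := ltW ke; rewrite ler_pdivlMr // => /(le_trans _); apply.
by rewrite ler_wpM2l ?normc_ge0 // lerDl.
Qed.

Lemma fatou_le (f_ : nat -> C -> R) F (e : R) (N : nat) :
  (forall n, rmeas (f_ n)) -> (forall n z, 0 <= f_ n z) ->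
  (forall z, f_ ^~ z @ \oo --> F z) ->
  (forall n, (N <= n)%N -> (\int[@area R]_p (f_ n (toC p))%:E <= e%:E)%E) ->
  (\int[@area R]_p (F (toC p))%:E <= e%:E)%E.
Proof.
move=> mf f0 fF le.
have := @fatou _ _ R (@area R) setT measurableT (fun n p => (f_ n (toC p))%:E).
move=> H; have {H} := H (fun n => (measurable_EFinP _ _).2 (mf n)) (fun n p _ =>
  f0 n (toC p)).
rewrite (_ : (\int[area]_x _ = \int[@area R]_p (F (toC p))%:E)%E); last first.
  apply: eq_integral => p _.
  have cv : (fun n => (f_ n (toC p))%:E) @ \oo --> (F (toC p))%:E.
    by apply/fine_cvgP; split; [exact: nearW|exact: fF].
  by rewrite is_cvg_limn_einfE; [exact/cvg_lim|apply/cvg_ex; eexists; exact: cv].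
move/le_trans; apply; rewrite limn_einf_lim; apply: lime_le; first exact: is_cvg_einfs.
exists N => // n /= Nn; apply: le_trans (le n Nn).
by apply: ereal_inf_lbound; exists n => /=.
Qed.

Lemma complex_cauchy (s : nat -> C) :
  (forall e : R, 0 < e -> exists N, forall n, (N <= n)%N -> normc (s n - s N) < e) ->
  exists l, (fun n => complex.Re (s n)) @ \oo --> complex.Re l /\
            (fun n => complex.Im (s n)) @ \oo --> complex.Im l.
Proof.
move=> H.
have P (proj : C -> R) : (forall z w, proj z - proj w = proj (z - w)) ->
    (forall z, `|proj z| <= normc z) -> cvg ((fun n => proj (s n)) @ \oo).
  move=> pB pn; apply: cauchy_cvg; apply: cauchy_exP => e /= e0.
  have [N HN] := H e e0; exists (proj (s N)).
  exists N => // n /= /HN; rewrite /ball /= distrC pB; exact: le_lt_trans.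
have rB (z w : C) : complex.Re z - complex.Re w = complex.Re (z - w) by rewrite ReD ReN.
have iB (z w : C) : complex.Im z - complex.Im w = complex.Im (z - w) by rewrite ImD ImN.
have /cvg_ex[x xP] := P _ rB (@normRe_le_normc R).
have /cvg_ex[y yP] := P _ iB (@normIm_le_normc R).
by exists (x +i* y).
Qed.

Lemma fockB f g : fock f -> fock g -> fock (fun z => f z - g z).
Proof.
move=> /fock_L2[ef lf] /fock_L2[eg lg]; apply/fock_L2; split; first exact: entireB.
exact: L2B.
Qed.

Lemma fockD f g : fock f -> fock g -> fock (fun z => f z + g z).
Proof.
move=> /fock_L2[ef lf] /fock_L2[eg lg]; apply/fock_L2; split; first exact: entireD.
exact: L2D.
Qed.

Lemma fockZ l f : fock f -> fock (fun z => l * f z).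
Proof.
move=> /fock_L2[ef lf]; apply/fock_L2; split; last exact: L2Z.
exact: entireM (@entire_cst R l) ef.
Qed.

(** Bounded point evaluations give a pointwise limit, Fatou makes it the limit in norm, and it is
    entire because the reproducing formula passes to the limit. *)
Lemma fock_complete (f_ : nat -> C -> C) : (forall n, fock (f_ n)) ->
  (forall e : R, 0 < e -> exists N, forall m n, (N <= m)%N -> (N <= n)%N ->
     sqnorm (fun z => f_ m z - f_ n z) <= e) ->
  exists2 f, fock f & forall e : R, 0 < e -> exists N, forall n, (N <= n)%N ->
     sqnorm (fun z => f_ n z - f z) <= e.
Proof.
move=> Ff cau.
have [K K0 HK] := @point_evaluation R.
have ptw z : exists l, (fun n => complex.Re (f_ n z)) @ \oo --> complex.Re l /\
    (fun n => complex.Im (f_ n z)) @ \oo --> complex.Im l.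
  apply: complex_cauchy => e e0; pose k := K * expR (2 * normc z ^+ 2).
  have k0 : 0 < k by rewrite mulr_gt0 ?expR_gt0.
  have [|N HN] := cau (e ^+ 2 / (2 * k)).
    by rewrite divr_gt0 ?exprn_gt0 // mulr_gt0.
  exists N => n Nn; have := HK _ z (fockB (Ff n) (Ff N)); rewrite -/k => H1.
  have := ler_wpM2l (ltW k0) (HN n N Nn (leqnn N)) => H2.
  have H3 : normc (f_ n z - f_ N z) ^+ 2 < e ^+ 2.
    rewrite (le_lt_trans H1) // (le_lt_trans H2) //.
    have -> : k * (e ^+ 2 / (2 * k)) = e ^+ 2 / 2 by field; rewrite gt_eqF.
    by rewrite ltr_pdivrMr // mulr_natr mulr2n ltrDl exprn_gt0.
  by move: H3; rewrite ltr_sqr ?nnegrE ?normc_ge0 // ltW.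
have /choice[f Hf] := ptw.
have mf : cmeas f.
  split.
  - apply: (@measurable_fun_cvg _ _ _ _ (fun n p => complex.Re (f_ n (toC p)))).
      by move=> n; have /fock_L2[_ [[]]] := Ff n.
    by move=> p _; case: (Hf (toC p)).
  - apply: (@measurable_fun_cvg _ _ _ _ (fun n p => complex.Im (f_ n (toC p)))).
      by move=> n; have /fock_L2[_ [[]]] := Ff n.
    by move=> p _; case: (Hf (toC p)).
have lfn n : L2 (f_ n) by have /fock_L2[] := Ff n.
(* Fatou in the second index of the Cauchy estimate, with [n] fixed. *)
have close (e : R) : 0 < e -> exists N, forall n, (N <= n)%N ->
    L2 (fun z => f_ n z - f z) /\ sqnorm (fun z => f_ n z - f z) <= e.
  move=> e0; have [N HN] := cau e e0; exists N => n Nn.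
  have mnf : cmeas (fun z => f_ n z - f z).
    have := cmeasD (lfn n).1 (cmeasM (f := fun=> -1) _ mf).
    rewrite (_ : (fun z => f_ n z + -1 * f z) = (fun z => f_ n z - f z)); last first.
      by apply/funext => z; rewrite mulN1r.
    by apply; split; exact: rmeas_cst.
  have m2 : rmeas (fun z => normc (f_ n z - f z) ^+ 2 * gaussw z).
    by apply: rmeasM (@rmeas_gaussw R); exact: rmeas_normc2.
  have le : (\int[@area R]_p (normc (f_ n (toC p) - f (toC p)) ^+ 2 * gaussw (toC
    p))%:E <= e%:E)%E.
    apply: (@fatou_le (fun m z => normc (f_ n z - f_ m z) ^+ 2 * gaussw z)
      (fun z => normc (f_ n z - f z) ^+ 2 * gaussw z) e N).
    - move=> m; apply: rmeasM (@rmeas_gaussw R); apply: rmeas_normc2.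
      by have [] := L2B (lfn n) (lfn m).
    - by move=> m z; rewrite mulr_ge0 ?gaussw_ge0 // exprn_ge0 ?normc_ge0.
    - move=> z; have [cr ci] := Hf z; apply: cvgM; last exact: cvg_cst.
      under eq_fun do rewrite normc_sq !ReD !ImD !ReN !ImN.
      rewrite normc_sq !ReD !ImD !ReN !ImN.
      by apply: cvgD; apply: cvgM; apply: cvgB => //; exact: cvg_cst.
    - move=> m Nm; have := HN n m Nn Nm; rewrite -lee_fin /sqnorm EFin_rintegral //.
      by case: (L2B (lfn n) (lfn m)).
  have l2 : L2 (fun z => f_ n z - f z).
    split => //; apply/integrableP; split; first exact/measurable_EFinP.
    rewrite (le_lt_trans _ (ltry e)) // (le_trans _ le) //.
    rewrite le_eqVlt; apply/orP; left; apply/eqP; apply: eq_integral => p _.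
    by rewrite gee0_abs // lee_fin mulr_ge0 ?gaussw_ge0 // exprn_ge0 ?normc_ge0.
  by split => //; rewrite -lee_fin /sqnorm EFin_rintegral //; case: l2.
have lf : L2 f.
  have [N HN] := close 1 ltr01; have [l2 _] := HN N (leqnn N).
  apply: (L2_eq (L2B (lfn N) l2)) => z.
  by rewrite opprB addrC subrK.
exists f; last first.
  by move=> e /close[N HN]; exists N => n /HN[].
apply/fock_L2; split => //.
pose k := rintegral (@gaussw R); have k0 : 0 < k := @rintegral_gaussw_gt0 R.
(* [reproducing] holds for each [f_ n]. Its left side converges by Cauchy-Schwarz and its right side
   pointwise, each to within e / 2. *)
have fE w : f w = (k^-1)%:C * cintegral (fun z =>
  f z * cexp (w * conjc z) * (gaussw z)%:C).
  have kc : (k^-1)%:C * k%:C = 1 :> C by rewrite -rmorphM mulVf ?gt_eqF.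
  suff : k%:C * f w = inner f (fun z => cexp (conjc w * z)).
    by move=> E; rewrite kernel_inner -E mulrA kc mul1r.
  apply/eqP; rewrite -subr_eq0 -normc_eq0 eq_le normc_ge0 andbT.
  apply/ler_addgt0Pl => e e0; rewrite addr0.
  pose M := sqnorm (fun z => cexp (conjc w * z)).
  have M0 : 0 <= M := sqnorm_ge0 _.
  pose e1 := (e / 2) ^+ 2 / (M + 1).
  have e10 : 0 < e1 by rewrite divr_gt0 ?exprn_gt0 ?divr_gt0 // ltr_wpDl.
  have [N HN] := close _ e10.
  have [cr ci] := Hf w.
  have d0 : 0 < e / (4 * k) by rewrite divr_gt0 // mulr_gt0.
  have /cvgrPdist_lt/(_ _ d0)[N1 _ HN1] := cr.
  have /cvgrPdist_lt/(_ _ d0)[N3 _ HN3] := ci.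
  pose n := maxn N (maxn N1 N3).
  have [l2 n2] := HN n (leq_maxl _ _).
  have nN1 : (N1 <= n)%N by rewrite /n (leq_trans (leq_maxl N1 N3)) // leq_maxr.
  have nN3 : (N3 <= n)%N by rewrite /n (leq_trans (leq_maxr N1 N3)) // leq_maxr.
  have near_w : normc (k%:C * (f w - f_ n w)) <= e / 2.
    rewrite Normc.normcM normc_real (ger0_norm (ltW k0)).
    have := normc_le_ReIm (f w - f_ n w); rewrite !ReD !ImD !ReN !ImN => le.
    have h1 := ltW (HN1 n nN1); have h3 := ltW (HN3 n nN3).
    rewrite -ler_pdivlMl // (le_trans le) // (le_trans (lerD h1 h3)) //.
    by rewrite le_eqVlt; apply/orP; left; apply/eqP; field; rewrite gt_eqF.
  have near_ip : normc (inner (fun z => f_ n z - f z) (fun z =>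
    cexp (conjc w * z))) <= e / 2.
    rewrite -ler_sqr ?nnegrE ?normc_ge0 //; last by rewrite ltW // divr_gt0.
    rewrite (le_trans (cauchy_schwarz l2 (L2_cexp _))) // -/M.
    rewrite (le_trans (ler_wpM2r M0 n2)) // /e1 mulrAC ler_pdivrMr ?ltr_wpDl //.
    by rewrite ler_wpM2l ?sqr_ge0 // lerDl.
  have rep := reproducing w (Ff n); rewrite -/k in rep.
  have -> : k%:C * f w - inner f (fun z => cexp (conjc w * z)) =
     k%:C * (f w - f_ n w) + inner (fun z => f_ n z - f z) (fun z =>
       cexp (conjc w * z)).
    rewrite innerBl //; last exact: L2_cexp.
    by rewrite rep mulrBr addrA subrK.
  by rewrite (le_trans (normcD _ _)) // [leRHS]splitr lerD.
rewrite (funext fE); apply: entireM; first exact: entire_cst.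
exact: kernel_entire.
Qed.

End Completeness.

(** * Riesz representation and adjoints *)

Section Riesz.
Context {R : realType}.
Local Notation C := R[i].
Implicit Types (f g h k : C -> C) (z w l : C).

Lemma Re_innerC f g : L2 f -> L2 g -> complex.Re (inner g f) = complex.Re (inner f g).
Proof. by move=> lf lg; rewrite (innerC lf lg); case: (inner f g). Qed.

Lemma sqnorm_inner f : sqnorm f = complex.Re (inner f f).
Proof. by rewrite inner_self. Qed.

Lemma sqnormD f g : L2 f -> L2 g ->
  sqnorm (fun z => f z + g z) = sqnorm f + sqnorm g + 2 * complex.Re (inner f g).
Proof.
move=> lf lg; have lfg := L2D lf lg.
rewrite !sqnorm_inner innerDl // !innerDr // !ReD (Re_innerC lf lg); ring.
Qed.

Lemma sqnormB f g : L2 f -> L2 g ->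
  sqnorm (fun z => f z - g z) = sqnorm f + sqnorm g - 2 * complex.Re (inner f g).
Proof.
move=> lf lg; have lfg := L2B lf lg.
rewrite !sqnorm_inner innerBl // !innerBr // !(ReD, ReN) (Re_innerC lf lg); ring.
Qed.

Lemma fock_L2_of f : fock f -> L2 f. Proof. by case/fock_L2. Qed.

Lemma fock0 : fock (fun=> 0 : C).
Proof.
apply/fock_L2; split; first exact: entire_cst.
split; first by split; exact: rmeas_cst.
apply: (rintegrable_eq (rintegrableZ 0 (@rintegrable_gaussw R))) => z.
by rewrite Normc.normc0 expr0n.
Qed.

Section Functional.
Variables (L : (C -> C) -> C) (M : R).
Hypothesis LD : forall f g, fock f -> fock g -> L (fun z => f z + g z) = L f + L g.
Hypothesis LZ : forall l f, fock f -> L (fun z => l * f z) = l * L f.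
Hypothesis LM : forall f, fock f -> normc (L f) ^+ 2 <= M * sqnorm f.

(** If [h] represents [L], then J f = |f - h|^2 - |h|^2, so the representing vector is sought as the
    minimiser of [J]. *)
Let J f : R := sqnorm f - 2 * complex.Re (L f).
Let values : set R := [set J f | f in fock].

Let J_lower f : fock f -> - `|M| <= J f.
Proof.
move=> Ff; have := LM Ff; have := sqnorm_ge0 f; have := Re_le_normc (L f).
have := ler_norm M; have := normr_ge0 M; have := normc_ge0 (L f); rewrite /J.
set x := normc _; set y := complex.Re _; set n := sqnorm f; set m := `|M|.
move=> x0 m0 Mm yx n0 xx.
have : x ^+ 2 <= m * n by rewrite (le_trans xx) // ler_wpM2r.
move=> {}xx; have : 2 * x <= m + n.
  rewrite -ler_sqr ?nnegrE ?mulr_ge0 ?addr_ge0 //.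
  by have := sqr_ge0 (m - n); nra.
by lra.
Qed.

Let has_inf_values : has_inf values.
Proof.
split; first by exists (J (fun=> 0)), (fun=> 0) => //; exact: fock0.
by exists (- `|M|) => _ [f Ff <-]; exact: J_lower.
Qed.

Let m := inf values.

Let m_le f : fock f -> m <= J f.
Proof. by move=> Ff; apply: ge_inf; [case: has_inf_values|exists f]. Qed.

(** The parallelogram identity with J >= m at the midpoint of [f] and [g]; it makes every minimising
    sequence a Cauchy sequence. *)
Let parallelogram f g : fock f -> fock g ->
  sqnorm (fun z => f z - g z) <= 2 * (J f - m) + 2 * (J g - m).
Proof.
move=> Ff Fg; have lf := fock_L2_of Ff; have lg := fock_L2_of Fg.
have Fs := fockD Ff Fg; have Fh := fockZ (2^-1)%:C Fs.
have := m_le Fh; rewrite /J sqnormZ; last exact: fock_L2_of.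
rewrite LZ // LD // normc_real ger0_norm ?invr_ge0 // sqnormD // sqnormB //.
have -> : complex.Re ((2^-1)%:C * (L f + L g)) =
    2^-1 * (complex.Re (L f) + complex.Re (L g)).
  by rewrite ReM ReD /= mul0r subr0.
set a := sqnorm f; set b := sqnorm g; set c := complex.Re _; set d := complex.Re (L f).
set e := complex.Re (L g) => H.
have : (2^-1 : R) ^+ 2 = 1 / 4 by field.
move: H => /[swap] ->; lra.
Qed.

Lemma riesz : exists2 h, fock h & forall f, fock f -> L f = inner f h.
Proof.
have /choice[s Hs] : forall n : nat, exists f, fock f /\ J f < m + n.+1%:R^-1.
  move=> n; have n0 : 0 < n.+1%:R^-1 :> R by rewrite invr_gt0.
  by have [_ [f Ff <-] Hf] := inf_adherent n0 has_inf_values; exists f.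
have small (e : R) : 0 < e -> exists N, forall n, (N <= n)%N -> n.+1%:R^-1 < e.
  move=> e0; have /cvgrPdist_lt/(_ e e0)[N _ HN] := @cvg_harmonic R.
  by exists N => n /HN /=; rewrite sub0r normrN ger0_norm // invr_ge0.
have [|h Fh Hh] := @fock_complete R s (fun n => (Hs n).1).
  move=> e e0; have [|N HN] := small (e / 4); first by rewrite divr_gt0.
  exists N => i j Ni Nj.
  rewrite (le_trans (parallelogram (Hs i).1 (Hs j).1)) //.
  have := (Hs i).2; have := (Hs j).2; have := HN i Ni; have := HN j Nj.
  move: (J (s i)) (J (s j)) i.+1%:R^-1 j.+1%:R^-1 m => x y p q r; lra.
exists h => //.
have Re_eq k : fock k -> complex.Re (L k) = complex.Re (inner k h).
  move=> Fk; have lk := fock_L2_of Fk; have lh := fock_L2_of Fh.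
  pose D := complex.Re (inner k h) - complex.Re (L k).
  (* With n = |k|^2, the choice t = -D / (n + 1) gives -D^2 (n + 2) / (n + 1)^2, which is
     nonnegative only if D = 0. *)
  suff quad t : 0 <= 2 * t * D + t ^+ 2 * sqnorm k.
    have := sqnorm_ge0 k; have := quad (- D / (sqnorm k + 1)); set n := sqnorm k =>
      H n0.
    have n1 : 0 < n + 1 by rewrite ltr_wpDl.
    have : 2 * (- D / (n + 1)) * D + (- D / (n + 1)) ^+ 2 * n =
        - (D ^+ 2 * (n + 2) / (n + 1) ^+ 2) by field; rewrite gt_eqF.
    move=> E; move: H; rewrite E oppr_ge0 => H.
    have D0 : D ^+ 2 = 0.
      apply/eqP; rewrite eq_le sqr_ge0 andbT.
      by move: H; rewrite pmulr_lle0 ?invr_gt0 ?exprn_gt0 // pmulr_lle0 // ltr_wpDl.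
    by move/eqP: D0; rewrite sqrf_eq0 subr_eq0 => /eqP ->.
  (* [J] is compared with [m] at [s n] plus t times [k], not at [h]. One half of [e] pays for J(s n)
     - m, the other for replacing [s n] by [h] in the inner product with [k]. *)
  apply/ler_addgt0Pl => e e0; rewrite addrC.
  pose c := 2 * `|t|.
  have c0 : 0 <= c by rewrite mulr_ge0.
  pose d := e / (2 * (c + 1)).
  have d0 : 0 < d by rewrite divr_gt0 // mulr_gt0 // ltr_wpDl.
  have k1 : 0 < sqnorm k + 1 by rewrite ltr_wpDl ?sqnorm_ge0.
  have [|N1 HN1] := Hh (d ^+ 2 / (sqnorm k + 1)); first by rewrite divr_gt0 ?exprn_gt0.
  have [|N3 HN3] := small (e / 2); first by rewrite divr_gt0.
  pose n := maxn N1 N3; have [Fs Js] := Hs n; have ls := fock_L2_of Fs.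
  have h1 := HN1 n (leq_maxl _ _); have h2 := HN3 n (leq_maxr _ _).
  have near_h : `|complex.Re (inner k (s n)) - complex.Re (inner k h)| <= d.
    rewrite -ReN -ReD -innerBr // (le_trans (normRe_le_normc _)) //.
    rewrite -ler_sqr ?nnegrE ?normc_ge0 //; last exact: ltW.
    have lsh := L2B ls lh.
    rewrite (le_trans (cauchy_schwarz lk lsh)) //.
    rewrite (le_trans (ler_wpM2l (sqnorm_ge0 k) h1)) // mulrCA ger_pMr ?exprn_gt0 //.
    by rewrite ler_pdivrMr // mul1r lerDl.
  have Ftk := fockZ t%:C Fk.
  have := m_le (fockD Fs Ftk); rewrite /J sqnormD //; last exact: L2Z.
  rewrite sqnormZ // LD // LZ // normc_real.
  have -> : inner (s n) (fun z => t%:C * k z) = t%:C * inner (s n) k.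
    by rewrite innerZr //= oppr0.
  have ReZ z : complex.Re (t%:C * z) = t * complex.Re z by rewrite ReM /= mul0r subr0.
  rewrite ReD !ReZ (Re_innerC lk ls) real_normK ?num_real //.
  move: Js; rewrite /J => Js H.
  have tD : 2 * t * (complex.Re (inner k (s n)) - complex.Re (inner k h)) <= e / 2.
    rewrite (le_trans (ler_norm _)) // normrM (le_trans (ler_wpM2l (normr_ge0 _)
      near_h)) //.
    rewrite normrM ger0_norm // -/c /d mulrA ler_pdivrMr ?mulr_gt0 ?ltr_wpDl //.
    have -> : e / 2 * (2 * (c + 1)) = (c + 1) * e by field.
    by rewrite ler_wpM2r // ?lerDl // ltW.
  move: H Js h2 tD; rewrite /D.
  move: (sqnorm (s n)) (sqnorm k) (complex.Re (L (s n))) (complex.Re (L k)) => x y p q.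
  move: (complex.Re (inner k (s n))) (complex.Re (inner k h)) n.+1%:R^-1 m => v w r m'.
  lra.
move=> f Ff; apply: eqc; first exact: Re_eq.
(* The imaginary part of a number is the real part of -i times it. *)
have := Re_eq _ (fockZ (0 +i* -1) Ff).
rewrite LZ // innerZl //; [|exact: fock_L2_of|exact: fock_L2_of].
by rewrite !ReM /= !mul0r !sub0r !mulN1r !opprK.
Qed.

End Functional.

Lemma bounded_sqnorm (T : (C -> C) -> C -> C) : bounded_on_fock T ->
  exists M : R, forall f, fock f -> sqnorm (T f) <= M * sqnorm f.
Proof.
move=> [FT [M HM]]; exists (M ^+ 2) => f Ff.
have := HM f Ff; rewrite !fock_normE //; last exact: FT.
have pi0 : 0 < pi^-1 :> R by rewrite invr_gt0 pi_gt0.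
have n1 : 0 <= pi^-1 * sqnorm (T f) by rewrite mulr_ge0 ?sqnorm_ge0 // ltW.
have n2 : 0 <= pi^-1 * sqnorm f by rewrite mulr_ge0 ?sqnorm_ge0 // ltW.
set x := Num.sqrt _; set y := Num.sqrt _ => xy.
have x0 : 0 <= x by exact: sqrtr_ge0.
have : x ^+ 2 <= (M * y) ^+ 2.
  by rewrite ler_sqr // nnegrE // (le_trans x0).
rewrite exprMn /x /y !sqr_sqrtr // mulrCA ler_pM2l //.
Qed.

(** Riesz representation of f -> <T f, g> for each [g] produces an adjoint, so the choice made by
    [xget] is a true adjoint and not its default. *)
Lemma adjointP (T : (C -> C) -> C -> C) : bounded_on_fock T ->
  (forall f g, T (fun z => f z + g z) = (fun z => T f z + T g z)) ->
  (forall l f, T (fun z => l * f z) = (fun z => l * T f z)) ->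
  (forall g, fock g -> fock (adjoint T g)) /\
  (forall f g, fock f -> fock g -> inner (T f) g = inner f (adjoint T g)).
Proof.
move=> bT TD TZ; have [M HM] := bounded_sqnorm bT; have [FT _] := bT.
have pi0 : (pi^-1)%:C != 0 :> C.
  by rewrite eq_complex /= negb_and invr_eq0 gt_eqF ?pi_gt0.
have /choice[S HS] : forall g, exists h, fock g ->
    fock h /\ forall f, fock f -> inner (T f) g = inner f h.
  move=> g; have [Fg|nFg] := pselect (fock g); last by exists g.
  have lg := fock_L2_of Fg.
  have [|||h Fh Hh] := @riesz (fun f => inner (T f) g) (M * sqnorm g).
  - move=> f f' Ff Ff'; rewrite TD innerDl //; apply: fock_L2_of; exact: FT.
  - by move=> l f Ff; rewrite TZ innerZl //; apply: fock_L2_of; exact: FT.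
  - move=> f Ff; have lT := fock_L2_of (FT f Ff).
    rewrite (le_trans (cauchy_schwarz lT lg)) //.
    by rewrite mulrAC ler_wpM2r ?sqnorm_ge0 // HM.
  by exists h => _; split.
have [FA HA] : is_adjoint T (adjoint T).
  apply: (@xgetPex _ (fun f => f) [set S | is_adjoint T S]); exists S.
  split; first by move=> g /HS[].
  by move=> f g Ff Fg; rewrite !fock_innerE; have [_ ->] := HS g Fg.
split => // f g Ff Fg.
by have := HA f g Ff Fg; rewrite !fock_innerE => /(mulfI pi0).
Qed.

End Riesz.

(** * Completeness of the eigenvectors *)

Section Density.
Context {R : realType}.
Local Notation C := R[i].
Implicit Types (f g h F : C -> C) (z w l : C).

Lemma normc_pow_le z n : normc (z ^+ n) <= n`!%:R * expR (normc z).
Proof.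
rewrite normcX mulrC -ler_pdivrMr ?ltr0n ?fact_gt0 //.
exact: pow_fact_le_expR (normc_ge0 z).
Qed.

Lemma eq0_geometric (x K : R) : 0 <= x -> (forall n, x <= (2^-1) ^+ n * K) -> x = 0.
Proof.
move=> x0 H; apply/eqP; rewrite eq_le x0 andbT.
have cv : (fun n => (2^-1) ^+ n * K) @ \oo --> (0 * K : R).
  apply: cvgM; last exact: cvg_cst.
  by apply: cvg_expr; rewrite ger0_norm ?invr_ge0 // invf_lt1 // ltr1n.
rewrite -(mul0r K) -(cvg_lim _ cv) //; apply: limr_ge.
  by apply/cvg_ex; eexists; exact: cv.
exact: nearW.
Qed.

Section ExponentialSeries.
Variables (g F : C -> C) (K A B : R) (p q : C).
Hypothesis lg : L2 g.
Hypothesis mF : entire F.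
Hypothesis growthF : forall z,
  normc (F z) <= K * expR (A * normc z ^+ 2 + B * normc z).
Hypothesis small : A + 3 * normc p < 1 / 2.
Hypothesis orth : forall n, inner (fun z => z ^+ n * F z) g = 0.

Let P z : C := p * z ^+ 2 + q * z.

Let entireP_ : entire P.
Proof.
apply: entireD; last exact: entire_linear.
exact: entireM (@entire_cst R p) (@entireX R _ 2 (@entire_id R)).
Qed.

Let r z : R := normc p * normc z ^+ 2 + normc q * normc z.

Let normP z : normc (P z) <= r z.
Proof. by rewrite (le_trans (normcD _ _)) // !Normc.normcM -expr2. Qed.

Let p0 : 0 <= normc p := normc_ge0 p.

Let monomial_growth m k z : normc (z ^+ m * P z ^+ k * F z) <=
  m`!%:R * k`!%:R * K *
    expR ((A + normc p) * normc z ^+ 2 + (B + 1 + normc q) * normc z).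
Proof.
rewrite (Normc.normcM (z ^+ m * P z ^+ k)) (Normc.normcM (z ^+ m)).
have H1 := ler_pM (normc_ge0 _) (normc_ge0 _) (normc_pow_le z m) (normc_pow_le (P z) k).
have H2 := ler_pM (mulr_ge0 (normc_ge0 _) (normc_ge0 _)) (normc_ge0 _) H1 (growthF z).
rewrite (le_trans H2) //.
have K0 : 0 <= K.
  have := le_trans (normc_ge0 _) (growthF z).
  by rewrite pmulr_lge0 // expR_gt0.
have -> : m`!%:R * expR (normc z) * (k`!%:R * expR (normc (P z))) *
   (K * expR (A * normc z ^+ 2 + B * normc z)) = m`!%:R * k`!%:R * K *
   (expR (normc z) * expR (normc (P z)) * expR (A * normc z ^+ 2 + B * normc z)).
  by ring.
apply: ler_wpM2l; first by rewrite !mulr_ge0 ?ler0n.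
rewrite -!expRD ler_expR; have := normP z; rewrite /r; lra.
Qed.

Let entire_monomial m k : entire (fun z => z ^+ m * P z ^+ k * F z).
Proof.
have h1 : entire (fun z : C => z ^+ m) := @entireX R _ m (@entire_id R).
have h2 : entire (fun z => P z ^+ k) := @entireX R _ k entireP_.
exact: (entireM (entireM h1 h2) mF).
Qed.

Let L2_monomial m k : L2 (fun z => z ^+ m * P z ^+ k * F z).
Proof.
have sm : A + normc p < 1 / 2 by have := small; have := p0; lra.
have cm := cmeas_entire (@entire_monomial m k).
exact: (L2_growth cm sm (monomial_growth m k)).
Qed.

(** One factor p z^2 + q z is traded for powers of z, so the induction on [k] needs all [m] at
    once. *)
Let orth_monomial k m : inner (fun z => z ^+ m * P z ^+ k * F z) g = 0.
Proof.
elim: k m => [|k IH] m.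
  have -> : (fun z => z ^+ m * P z ^+ 0 * F z) = (fun z => z ^+ m * F z).
    by apply/funext => z; rewrite expr0 mulr1.
  exact: orth.
have E : (fun z => z ^+ m * P z ^+ k.+1 * F z) =
    (fun z => p * (z ^+ m.+2 * P z ^+ k * F z) + q * (z ^+ m.+1 * P z ^+ k * F z)).
  apply/funext => z; rewrite (exprS (P z)) !(exprS z) /P.
  by move: (F z) (z ^+ m) (_ ^+ k) => x y t; ring.
rewrite E innerDl //; [|exact/L2Z/L2_monomial|exact/L2Z/L2_monomial].
rewrite !innerZl ?IH ?mulr0 ?addr0 //; exact: L2_monomial.
Qed.

Let partial m n z : C := \sum_(k < n) (k`!%:R)^-1 * (z ^+ m * P z ^+ k * F z).

Let orth_partial m n : L2 (partial m n) /\ inner (partial m n) g = 0.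
Proof.
elim: n => [|n [IHl IHip]].
  have E : partial m 0 = fun z => 0 * (z ^+ m * P z ^+ 0 * F z).
    by apply/funext => z; rewrite /partial big_ord0 mul0r.
  rewrite E; split; first exact/L2Z/L2_monomial.
  by rewrite innerZl ?mul0r //; exact: L2_monomial.
have E : partial m n.+1 =
    fun z => partial m n z + (n`!%:R)^-1 * (z ^+ m * P z ^+ n * F z).
  by apply/funext => z; rewrite /partial big_ord_recr.
have lm := L2Z (n`!%:R)^-1 (L2_monomial m n).
rewrite E; split; first exact: L2D.
by rewrite innerDl // IHip innerZl ?orth_monomial ?mulr0 ?addr0 //; exact: L2_monomial.
Qed.

(** Since (2 |P|)^n / n! <= exp(2 |P|), the remainder decays geometrically and uniformly in z at the
    price of exp(3 |P|). This is the origin of the 3 in [small]. *)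
Let remainder_bound n z :
  normc (cexp (P z) - \sum_(k < n) (k`!%:R)^-1 * P z ^+ k) <=
  (2^-1) ^+ n * expR (3 * r z).
Proof.
rewrite (le_trans (cexp_remainder _ _)) //.
set x := normc (P z); have x0 : 0 <= x := normc_ge0 _.
have H : 2 ^+ n * (x ^+ n / n`!%:R) <= expR (2 * x).
  by rewrite mulrA -exprMn pow_fact_le_expR // mulr_ge0.
have -> : x ^+ n / n`!%:R = (2^-1) ^+ n * (2 ^+ n * (x ^+ n / n`!%:R)).
  have e2 : (2^-1) ^+ n * 2 ^+ n = 1 :> R by rewrite -exprMn mulVf // expr1n.
  by rewrite (mulrA (2^-1 ^+ n)) e2 mul1r.
rewrite -mulrA ler_wpM2l ?exprn_ge0 ?invr_ge0 //.
rewrite (le_trans (ler_wpM2r (expR_ge0 _) H)) // -expRD ler_expR.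
by have := normP z; rewrite -/x; lra.
Qed.

Lemma orth_exp m : inner (fun z => z ^+ m * (F z * cexp (P z))) g = 0.
Proof.
(* Square-integrable majorant of the remainders, free of the factor 2^-n; [small] is the condition
   for it to lie in [L2]. *)
pose b z : C := (m`!%:R * K *
  expR ((A + 3 * normc p) * normc z ^+ 2 + (B + 1 + 3 * normc q) * normc z))%:C.
have K0 : 0 <= K.
  have := le_trans (normc_ge0 _) (growthF 0).
  by rewrite pmulr_lge0 // expR_gt0.
have bE z : normc (b z) = m`!%:R * K *
  expR ((A + 3 * normc p) * normc z ^+ 2 + (B + 1 + 3 * normc q) * normc z).
  by rewrite normc_real ger0_norm // !mulr_ge0 ?expR_ge0 ?ler0n.
have rn2 : rmeas (fun z : C => normc z ^+ 2) :=
  rmeas_normc2 (cmeas_entire (@entire_id R)).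
have lb : L2 b.
  apply: (@L2_growth _ _ (m`!%:R * K) (A + 3 * normc p) (B + 1 + 3 * normc q)) => //.
    apply: cmeas_real; apply: rmeasM; first exact: rmeas_cst.
    apply: rmeas_expR; apply: rmeasD; apply: rmeasM => //; try exact: rmeas_cst.
    exact: rmeas_id.
  by move=> z; rewrite bE.
have remE n z : z ^+ m * (F z * cexp (P z)) - partial m n z =
    z ^+ m * F z * (cexp (P z) - \sum_(k < n) (k`!%:R)^-1 * P z ^+ k).
  rewrite mulrBr mulrA; congr (_ - _); rewrite /partial mulr_sumr.
  apply: eq_bigr => k _.
  by move: (k`!%:R^-1) (z ^+ m) (P z ^+ k) (F z) => x y t s; ring.
have bound n z : normc (z ^+ m * (F z * cexp (P z)) - partial m n z) <=
    (2^-1) ^+ n * normc (b z).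
  rewrite remE Normc.normcM (Normc.normcM (z ^+ m)) bE.
  have H1 := ler_pM (normc_ge0 _) (normc_ge0 _) (normc_pow_le z m) (growthF z).
  have H2 := ler_pM (mulr_ge0 (normc_ge0 _) (normc_ge0 _)) (normc_ge0 _) H1
    (remainder_bound n z).
  rewrite (le_trans H2) //.
  have -> : m`!%:R * expR (normc z) * (K * expR (A * normc z ^+ 2 + B * normc z)) *
      (2^-1 ^+ n * expR (3 * r z)) = 2^-1 ^+ n * (m`!%:R * K *
      (expR (normc z) * expR (A * normc z ^+ 2 + B * normc z) * expR (3 * r z))).
    by ring.
  apply: ler_wpM2l; first by rewrite exprn_ge0 // invr_ge0.
  apply: ler_wpM2l; first by rewrite mulr_ge0 ?ler0n.
  by rewrite -!expRD ler_expR /r; lra.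
have lE : L2 (fun z => z ^+ m * (F z * cexp (P z))).
  have l1 := (orth_partial m 0).1.
  split.
    apply: cmeas_entire; apply: entireM (@entireX R _ m (@entire_id R)) _.
    exact: entireM mF (entire_cexp_comp entireP_).
  case: lb => mb ib; apply: (@rintegrable_le _ _ _ _ ib).
    apply: rmeasM (@rmeas_gaussw R); apply: rmeas_normc2; apply: cmeas_entire.
    apply: entireM (@entireX R _ m (@entire_id R)) _.
    exact: entireM mF (entire_cexp_comp entireP_).
  move=> z; rewrite ger0_norm; last first.
    by apply: mulr_ge0 (gaussw_ge0 _); apply: exprn_ge0; exact: normc_ge0.
  apply: ler_wpM2r; first exact: gaussw_ge0.
  rewrite ler_sqr ?nnegrE ?normc_ge0 //.
  (* The remainder of order 0 is the function itself. *)
  by have := bound 0%N z; rewrite /partial big_ord0 subr0 expr0 mul1r.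
have ib := L2_prod lb lg.
apply/eqP; rewrite -normc_eq0; apply/eqP.
apply: (eq0_geometric (normc_ge0 _) (K := rintegral (fun z =>
  normc (b z) * normc (g z) * gaussw z))) => n.
have [lp ipp] := orth_partial m n.
rewrite -[inner _ g]subr0 -{1}ipp -innerBl // -rintegralZ //.
apply: normc_cintegral.
- by apply: cintegrable_prod => //; exact: L2B.
- exact: rintegrableZ.
- move=> z.
  have gen (x y : C) (t : R) : 0 <= t -> normc (x * conjc y * t%:C) = normc x * normc
    y * t.
    by move=> t0; rewrite !Normc.normcM normc_conj normc_real ger0_norm.
  rewrite gen ?gaussw_ge0 //.
  have -> : 2^-1 ^+ n * (normc (b z) * normc (g z) * gaussw z) =
    2^-1 ^+ n * normc (b z) * normc (g z) * gaussw z by ring.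
  by rewrite ler_wpM2r ?gaussw_ge0 // ler_wpM2r ?normc_ge0.
Qed.

End ExponentialSeries.

Definition gauss_exp (c : R) (d : C) z : C := cexp (c%:C * z ^+ 2 + d * z).

Lemma entire_gauss_exp c d : entire (gauss_exp c d).
Proof.
apply: entire_cexp_comp; apply: entireD; last exact: entire_linear.
exact: entireM (@entire_cst R c%:C) (@entireX R _ 2 (@entire_id R)).
Qed.

Lemma gauss_exp_growth c d (c' : R) z : `|c| <= c' ->
  normc (gauss_exp c d z) <= 1 * expR (c' * normc z ^+ 2 + normc d * normc z).
Proof.
move=> cc'; rewrite mul1r (le_trans (cexp_normle _)) // ler_expR.
rewrite (le_trans (normcD _ _)) // lerD ?Normc.normcM //.
by rewrite normc_real -expr2 ler_wpM2r // exprn_ge0 // normc_ge0.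
Qed.

(** All intermediate quadratic coefficients lie between 0 and [c], so one growth bound and one step
    size c / N serve every step. When the coefficient has become 0, only a linear exponent is left
    to adjust, and [small] does not restrict it. *)
Lemma orth_gauss_exp g c d : 0 <= c -> c < 1 / 2 -> fock g ->
  (forall n, inner (fun z => z ^+ n * gauss_exp c d z) g = 0) -> g = fun=> 0.
Proof.
move=> c0 c12 Fg orth; have lg := fock_L2_of Fg.
(* Least convenient number of steps with c + 3 (c / N) < 1/2. *)
pose N := (Num.truncn (3 * c / (1 / 2 - c))).+1.
have N0 : 0 < N%:R :> R by rewrite ltr0n.
have h0 : 0 < 1 / 2 - c by lra.
have Nc : c + 3 * (c / N%:R) < 1 / 2.
  have := truncnS_gt (3 * c / (1 / 2 - c)); rewrite -/N ltr_pdivrMr // => H.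
  have : 3 * (c / N%:R) < 1 / 2 - c by rewrite mulrA ltr_pdivrMr // [X in _ < X]mulrC.
  by lra.
have cN0 : 0 <= c / N%:R by rewrite divr_ge0 // ltW.
have steps j : (j <= N)%N -> forall n,
    inner (fun z => z ^+ n * gauss_exp (c - j%:R * (c / N%:R)) d z) g = 0.
  elim: j => [_|j IH jN] n; first by rewrite mul0r subr0.
  have IHj := IH (ltnW jN).
  have cj : `|c - j%:R * (c / N%:R)| <= c.
    rewrite ger0_norm; last first.
      rewrite subr_ge0 mulrA ler_pdivrMr // mulrC ler_wpM2l // ler_nat.
      exact: ltnW.
    by rewrite gerBl mulr_ge0.
  have sm : c + 3 * normc (- (c / N%:R)%:C) < 1 / 2.
    by rewrite normc_opp normc_real ger0_norm.
  have E : (fun z => z ^+ n * gauss_exp (c - j.+1%:R * (c / N%:R)) d z) =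
      (fun z => z ^+ n * (gauss_exp (c - j%:R * (c / N%:R)) d z *
        cexp (- (c / N%:R)%:C * z ^+ 2 + 0 * z))).
    apply/funext => z; congr (_ * _); rewrite /gauss_exp -cexpD; congr cexp.
    rewrite -natr1 mulrDl mul1r opprD addrA [(_ - c / N%:R)%:C]rmorphB /=.
    by move: (c - _)%:C (c / _)%:C (z ^+ 2) (d * z) => x y t s; ring.
  rewrite E; apply: (orth_exp 0 lg (@entire_gauss_exp _ d) _ sm IHj n) => z.
  exact: gauss_exp_growth cj.
apply: (fock_eq0 Fg) => w.
have orthd n : inner (fun z => z ^+ n * gauss_exp 0 d z) g = 0.
  by have := steps N (leqnn N) n; rewrite mulrCA divff ?gt_eqF // mulr1 subrr.
have sm : 0 + 3 * normc (0 : C) < 1 / 2 by rewrite Normc.normc0; lra.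
have n0 : `|0 : R| <= 0 by rewrite normr0.
have := orth_exp (w - d) lg (@entire_gauss_exp 0 d) (fun z =>
  gauss_exp_growth d z n0) sm orthd 0.
have -> : (fun z => z ^+ 0 * (gauss_exp 0 d z * cexp (0 * z ^+ 2 + (w - d) * z))) =
    (fun z => cexp (w * z)).
  apply/funext => z; rewrite expr0 mul1r /gauss_exp -cexpD; congr cexp.
  by rewrite !mul0r !add0r mulrBl addrC subrK.
by move=> E; rewrite (innerC (L2_cexp w) lg) E conjc0.
Qed.

End Density.

(** * Point spectra *)

Section Eigenvectors.
Context {R : realType}.
Local Notation C := R[i].
Implicit Types (f g h : C -> C) (z w l : C).

Lemma two_pi_neq0 : (2 * pi)%:C != 0 :> C.
Proof. by rewrite eq_complex /= negb_and gt_eqF // mulr_gt0 ?pi_gt0. Qed.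

(** Homogeneity covers z different from 0; at the centre the integrand itself vanishes, since the
    mean with n = 0 gives h(0) = 0. *)
Lemma cmean_eq0 h z : entire h -> (forall n, cmean n h 1 = 0) ->
  forall n, cmean n h z = 0.
Proof.
move=> eh H n; have [->|z0] := eqVneq z 0; last by rewrite cmeanE // H mulr0.
have h0 : h 0 = 0.
  have := cmean0 1 eh; rewrite H => /esym/eqP; rewrite mulf_eq0 => /orP[|/eqP //].
  by rewrite (negbTE two_pi_neq0).
rewrite /cmean (_ : circ n h 0 = fun=> 0); last first.
  by apply/funext => t; rewrite /circ mul0r h0 mul0r.
rewrite (@curve_intE _ _ (fun=> 0)); first by rewrite subrr.
  by split=> t; exact: cvg_cst.
by move=> t; exact: cderive_cst.
Qed.

Lemma cmean_dilation n h l z : cmean n (fun w => h (l * w)) z = cmean n h (l * z).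
Proof.
have E : circ n (fun w => h (l * w)) z = circ n h (l * z).
  by apply/funext => t; rewrite /circ mulrA.
by rewrite /cmean E.
Qed.

Lemma cmean_scale n h l : entire h -> l != 0 ->
  cmean n (fun z => h (l * z)) 1 = l ^+ n * cmean n h 1.
Proof.
by move=> eh l0; rewrite cmean_dilation mulr1 cmeanE.
Qed.

Lemma cmeanZ n h l z : entire h -> cmean n (fun z => l * h z) z = l * cmean n h z.
Proof.
move=> eh; have cc := ccontinuous_circ n z eh.
have E : circ n (fun z => l * h z) z = fun t => l * circ n h z t.
  by apply/funext => t; rewrite /circ mulrA.
by rewrite /cmean E curve_intZ //; exact: ccontinuousZ.
Qed.

Lemma ccontinuousD (k1 k2 : R -> C) : ccontinuous k1 -> ccontinuous k2 ->
  ccontinuous (fun t => k1 t + k2 t).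
Proof.
move=> [r1 i1] [r2 i2]; split => t.
- rewrite (_ : (fun s => _) = fun s => complex.Re (k1 s) + complex.Re (k2 s)).
    by apply: cvgD; [exact: r1|exact: r2].
  by apply/funext => s; rewrite ReD.
- rewrite (_ : (fun s => _) = fun s => complex.Im (k1 s) + complex.Im (k2 s)).
    by apply: cvgD; [exact: i1|exact: i2].
  by apply/funext => s; rewrite ImD.
Qed.

Lemma cmeanD n h1 h2 z : entire h1 -> entire h2 ->
  cmean n (fun z => h1 z + h2 z) z = cmean n h1 z + cmean n h2 z.
Proof.
move=> e1 e2; have c1 := ccontinuous_circ n z e1; have c2 := ccontinuous_circ n z e2.
have -> : cmean n (fun z => h1 z + h2 z) z =
    curve_int (fun t => circ n h1 z t + circ n h2 z t) 0 (2 * pi).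
  have E : circ n (fun z => h1 z + h2 z) z = fun t => circ n h1 z t + circ n h2 z t.
    by apply/funext => t; rewrite /circ mulrDl.
  by rewrite /cmean E.
rewrite (@curve_intE _ _ (fun t => cprim (circ n h1 z) t + cprim (circ n h2 z) t)).
- rewrite /cmean /curve_int; move: (cprim _ _) (cprim _ _) (cprim _ _) (cprim _ _).
  by move=> x y x' y'; ring.
- exact: ccontinuousD.
- by move=> t; apply: cderiveD; exact: cderive_cprim.
Qed.

Lemma cmean_monomial n : cmean n (fun z : C => z ^+ n) 1 = (2 * pi)%:C.
Proof.
rewrite /cmean (_ : circ n _ 1 = fun=> 1); last first.
  apply/funext => t; rewrite /circ mul1r cisX !cisE -cexpD -cexp0; congr cexp.
  by apply: eqc => /=; rewrite ?addr0 ?subrr.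
rewrite (@curve_intE _ _ (fun t => t%:C * 1)) ?mul0r ?subr0 ?mulr1 //.
  by split => t; exact: cvg_cst.
by move=> t; rewrite -[X in cderive _ _ X](mul1r 1); apply: cderive_real;
  exact: is_derive_id.
Qed.

Section WeightedComposition.
Variables (a u v : C) (c : R).
Hypothesis a0 : a != 0.
Hypothesis a1 : normc a < 1.
Hypothesis uc : u = c%:C * (1 - a ^+ 2).
Hypothesis c0 : 0 <= c.
Hypothesis c12 : c < 1 / 2.

Let psi z := cexp (u * z ^+ 2 + v * z).
Let phi z := a * z.
Let W := wcomp psi phi.
Let d := v / (1 - a).
Let f0 := gauss_exp c d.
(** The reciprocal of [f0], written as an exponential so that f / f0 is a product of entire
    functions. *)
Let f0V z := cexp (- (c%:C * z ^+ 2 + d * z)).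
Let en n z := z ^+ n * f0 z.

Hypothesis bW : bounded_on_fock W.

Let a_neq1 : 1 - a != 0.
Proof.
rewrite subr_eq0; apply: contraTneq a1 => <-.
by rewrite Normc.normc1 ltxx.
Qed.

(** The equations that [c] and [d] solve: u + c a^2 = c and v + d a = d. *)
Let psiE z : psi z * f0 (a * z) = f0 z.
Proof.
rewrite /psi /f0 /gauss_exp -cexpD; congr cexp.
have vE : v = d * (1 - a) by rewrite /d divfK.
rewrite uc vE exprMn; move: (c%:C) d (z ^+ 2) => x y t; ring.
Qed.

Let f0VK z : f0V z * f0 z = 1.
Proof. exact: cexpNK. Qed.

Let psiV z : psi z * f0V z = f0V (a * z).
Proof.
transitivity (psi z * f0V z * (f0V (a * z) * f0 (a * z))); first by rewrite f0VK mulr1.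
transitivity (f0V (a * z) * (f0V z * (psi z * f0 (a * z))));
  last by rewrite psiE f0VK mulr1.
by move: (psi z) (f0V z) (f0V _) (f0 _) => x y t s; ring.
Qed.

Let entire_f0V : entire f0V.
Proof.
apply: entire_cexp_comp; apply: entireN; apply: entireD; last exact: entire_linear.
exact: entireM (@entire_cst R c%:C) (@entireX R _ 2 (@entire_id R)).
Qed.

Let f0V_growth z : normc (f0V z) <= expR (c * normc z ^+ 2 + normc d * normc z).
Proof.
rewrite /f0V (le_trans (cexp_normle _)) // ler_expR normc_opp.
rewrite (le_trans (normcD _ _)) // lerD ?Normc.normcM //.
by rewrite normc_real ger0_norm // -expr2.
Qed.

Let entire_en n : entire (en n).
Proof. exact: entireM (@entireX R _ n (@entire_id R)) (@entire_gauss_exp R c d). Qed.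

Let fock_en n : fock (en n).
Proof.
apply/fock_L2; split; first exact: entire_en.
apply: (@L2_growth _ _ (n`!%:R) c (1 + normc d)) => //.
  exact: cmeas_entire (@entire_en n).
have cc : `|c| <= c by rewrite ger0_norm.
move=> z; rewrite /en Normc.normcM.
have := ler_pM (normc_ge0 _) (normc_ge0 _) (normc_pow_le z n) (gauss_exp_growth d z cc).
move=> /le_trans; apply; rewrite mul1r -mulrA -expRD ler_wpM2l ?ler0n // ler_expR.
lra.
Qed.

Let W_en n : W (en n) = fun z => a ^+ n * en n z.
Proof.
apply/funext => z; rewrite /W /wcomp /en /phi exprMn -(psiE z).
by move: (f0 (a * z)) (psi z) (z ^+ n) (a ^+ n) => x y t s; ring.
Qed.

Let en_neq0 n : en n <> fun=> 0.
Proof.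
move=> /(congr1 (fun f => f 1)) /eqP; rewrite /en expr1n mul1r.
by rewrite (negbTE (cexp_neq0 _)).
Qed.

(** Division by [f0] conjugates [W] into the plain dilation by [a], which is diagonal on Taylor
    coefficients. *)
Let Wf0V f z : W f z * f0V z = f (a * z) * f0V (a * z).
Proof. by rewrite /W /wcomp -psiV mulrAC mulrC. Qed.

Lemma wcomp_eigenvalue : point_spectrum W = [set a ^+ n | n in [set: nat]].
Proof.
apply/seteqP; split => [l [f [Ff fN0 Wf]]|_ [n _ <-]]; last first.
  by exists (en n); split; [exact: fock_en|exact: en_neq0|exact: W_en].
apply: contrapT => nl; apply: fN0.
have lN n : a ^+ n != l by apply/eqP => al; apply: nl; exists n.
have /fock_L2[ef lf] := Ff.
pose h z := f z * f0V z.
have eh : entire h := entireM ef entire_f0V.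
have hE : (fun z => h (a * z)) = fun z => l * h z.
  by apply/funext => z; rewrite /h -Wf0V Wf mulrA.
(* Both sides of h(a z) = l h(z) have their [n]-th mean computed: (a^n - l) annihilates it. *)
have h1 n : cmean n h 1 = 0.
  have := cmean_scale n eh a0; rewrite hE cmeanZ // => /eqP.
  by rewrite -subr_eq0 -mulrBl mulf_eq0 subr_eq0 eq_sym (negbTE (lN n)) => /eqP.
(* Dilation by 1/2 divides the growth exponent 1 + c by 4, which brings it below 1/2. *)
pose b : C := (2^-1)%:C.
pose h2 z := h (b * z).
have eh2 : entire h2 := @entire_comp R h (fun z => b * z) eh (@entire_linear R b).
have h2n n z : cmean n h2 z = 0.
  by rewrite cmean_dilation cmean_eq0.
have [K K0 HK] := @point_evaluation R.
have fgrow z : normc (f z) <= Num.sqrt (K * sqnorm f) * expR (normc z ^+ 2).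
  have KN : 0 <= K * sqnorm f by rewrite mulr_ge0 ?sqnorm_ge0 // ltW.
  rewrite -ler_sqr ?nnegrE ?normc_ge0 ?mulr_ge0 ?sqrtr_ge0 ?expR_ge0 //.
  rewrite exprMn sqr_sqrtr // expr2 [expR _ ^+ 2]expr2 -expRD (le_trans _ (le_refl
    _)) //.
  have := HK f z Ff; rewrite mulrAC mulr_natl mulr2n expr2.
  exact.
have lh2 : L2 h2.
  apply: (@L2_growth _ _ (Num.sqrt (K * sqnorm f)) ((1 + c) / 4) (normc d / 2)).
  - exact: cmeas_entire eh2.
  - by have := c12; lra.
  - move=> z; rewrite /h2 /h Normc.normcM.
    have := ler_pM (normc_ge0 _) (normc_ge0 _) (fgrow (b * z)) (f0V_growth (b * z)).
    rewrite -(mulrA (Num.sqrt _)) -expRD => /le_trans; apply.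
    apply: ler_wpM2l; first exact: sqrtr_ge0.
    rewrite ler_expR.
    have -> : normc (b * z) = 2^-1 * normc z.
      by rewrite Normc.normcM normc_real ger0_norm ?invr_ge0.
    by rewrite le_eqVlt; apply/orP; left; apply/eqP; field.
have lX n : L2 (fun z : C => z ^+ n).
  apply: (@L2_growth _ _ (n`!%:R) 0 1).
  - exact: cmeas_entire (@entireX R _ n (@entire_id R)).
  - lra.
  - by move=> z; rewrite mul0r add0r mul1r; exact: normc_pow_le.
(* Vanishing circle means become orthogonality to monomials after integration over the radius. *)
have orthX n : inner (fun z => z ^+ n) h2 = 0.
  rewrite (innerC lh2 (lX n)) -conjc0; congr conjc.
  have E z : h2 z * conjc (z ^+ n) * (gaussw z)%:C = h2 z * conjc z ^+ n * (gaussw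
    z)%:C.
    by congr (_ * _ * _); exact: rmorphXn.
  rewrite /inner (cintegral_eq E); apply: plane_mean_zero => //.
  by apply: (cintegrable_eq (cintegrable_prod lh2 (lX n))) => z; rewrite E.
have h20 : h2 = fun=> 0.
  have half : 0 < 1 / 2 :> R by rewrite divr_gt0.
  have Fh2 : fock h2 by apply/fock_L2.
  apply: (@orth_gauss_exp R h2 0 0 (lexx 0) half Fh2) => n.
  have -> : (fun z => z ^+ n * gauss_exp 0 0 z) = (fun z => z ^+ n).
    by apply/funext => z; rewrite /gauss_exp !mul0r addr0 cexp0 mulr1.
  exact: orthX.
apply/funext => z; have : h2 (b^-1 * z) = 0 by rewrite h20.
have b0 : b != 0 by rewrite eq_complex /= invr_eq0 pnatr_eq0.
rewrite /h2 mulVKf // /h => /eqP; rewrite mulf_eq0 => /orP[/eqP //|].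
by rewrite (negbTE (cexp_neq0 _)).
Qed.

Let WD f g : W (fun z => f z + g z) = (fun z => W f z + W g z).
Proof. by apply/funext => z; rewrite /W /wcomp mulrDr. Qed.

Let WZ l f : W (fun z => l * f z) = (fun z => l * W f z).
Proof. by apply/funext => z; rewrite /W /wcomp mulrCA. Qed.

Let fock_adjoint g : fock g -> fock (adjoint W g).
Proof. by case: (adjointP bW WD WZ) => H _; exact: H. Qed.

Let inner_adjoint f g : fock f -> fock g -> inner (W f) g = inner f (adjoint W g).
Proof. by case: (adjointP bW WD WZ) => _ H; exact: H. Qed.

(** The functional sees [f] only on the unit circle, where [point_evaluation] bounds [f] and [E]
    bounds 1 / f0; hence it is bounded and [riesz] represents it. *)
Lemma coefficient_functional n : exists2 g, fock g &
  forall f, fock f -> cmean n (fun z => f z * f0V z) 1 = inner f g.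
Proof.
have [K K0 HK] := @point_evaluation R.
pose E := expR (c * 1 ^+ 2 + normc d * 1).
have E0 : 0 <= E := expR_ge0 _.
have ent f : fock f -> entire (fun z => f z * f0V z).
  by move=> /fock_L2[ef _]; exact: entireM ef entire_f0V.
apply: (@riesz R (fun f => cmean n (fun z => f z * f0V z) 1)
  (K * expR (2 * 1 ^+ 2) * (E * (2 * pi)) ^+ 2)).
- move=> f g Ff Fg.
  have E1 : (fun z => (f z + g z) * f0V z) = (fun z => f z * f0V z + g z * f0V z).
    by apply/funext => z; rewrite mulrDl.
  rewrite E1.
  exact: (@cmeanD n (fun z => f z * f0V z) (fun z =>
    g z * f0V z) 1 (ent f Ff) (ent g Fg)).
- move=> l f Ff.
  have E1 : (fun z => l * f z * f0V z) = (fun z => l * (f z * f0V z)).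
    by apply/funext => z; rewrite mulrA.
  rewrite E1.
  exact: (@cmeanZ n (fun z => f z * f0V z) l 1 (ent f Ff)).
- move=> f Ff; have KN : 0 <= K * expR (2 * 1 ^+ 2) * sqnorm f.
    by rewrite !mulr_ge0 ?sqnorm_ge0 ?expR_ge0 // ltW.
  have pi2 : 0 <= 2 * pi :> R by rewrite mulr_ge0 ?pi_ge0.
  have H : normc (cmean n (fun z => f z * f0V z) 1) <=
      Num.sqrt (K * expR (2 * 1 ^+ 2) * sqnorm f) * E * (2 * pi - 0).
    apply: curve_int_bound => //; first by apply: ccontinuous_circ; exact: ent.
    move=> t _; rewrite /circ mul1r (Normc.normcM (_ * _)) (Normc.normcM (f _))
      normc_cis mulr1.
    apply: ler_pM; rewrite ?normc_ge0 //.
      rewrite -ler_sqr ?nnegrE ?normc_ge0 ?sqrtr_ge0 // sqr_sqrtr //.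
      by have := HK f (cis t) Ff; rewrite normc_cis.
    by have := f0V_growth (cis t); rewrite normc_cis.
  rewrite subr0 in H.
  have := ler_pM (normc_ge0 _) (normc_ge0 _) H H; rewrite -!expr2 => /le_trans; apply.
  by rewrite -mulrA exprMn sqr_sqrtr // [leRHS]mulrAC.
Qed.

Lemma adjoint_eigenvalue :
  point_spectrum (adjoint W) = [set (conjc a) ^+ n | n in [set: nat]].
Proof.
apply/seteqP; split => [l [g [Fg gN0 Sg]]|_ [n _ <-]].
  apply: contrapT => nl; apply: gN0.
  (* Moving [W] across the inner product gives a^n <e_n, g> = conj(l) <e_n, g>, so [g] is orthogonal
     to every e_n unless [l] is one of the listed values. *)
  apply: (orth_gauss_exp c0 c12 Fg (d := d)) => n.
  have lg := fock_L2_of Fg; have le := fock_L2_of (fock_en n).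
  have := inner_adjoint (fock_en n) Fg; rewrite W_en Sg innerZl // innerZr // => /eqP.
  rewrite -subr_eq0 -mulrBl mulf_eq0 => /orP[|/eqP //].
  rewrite subr_eq0 => /eqP al; exfalso; apply: nl; exists n => //.
  by rewrite -(conjcK l) -al; apply/esym; exact: rmorphXn.
have [g Fg Hg] := coefficient_functional n.
have lg := fock_L2_of Fg.
exists g; split => //.
  (* The functional takes the value 2 pi at z^n f0, so its representing vector is not zero. *)
  move=> g0; have := Hg _ (fock_en n).
  have -> : (fun z => en n z * f0V z) = (fun z => z ^+ n).
    by apply/funext => z; rewrite /en -mulrA [f0 z * _]mulrC f0VK mulr1.
  rewrite cmean_monomial g0.
  have -> : (fun=> 0) = (fun z => 0 * en n z) :> (C -> C).
    by apply/funext => z; rewrite mul0r.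
  rewrite innerZr; [|exact: fock_L2_of|exact: fock_L2_of].
  by rewrite conjc0 mul0r => /eqP; rewrite (negbTE two_pi_neq0).
(* The defect of the eigenvalue equation is tested against itself: <D, D> = <W D, g> - a^n <D, g>,
   and this is 0 because the coefficient functional multiplies by a^n under [W]. *)
pose D z := adjoint W g z - conjc a ^+ n * g z.
have FS := fock_adjoint Fg; have lS := fock_L2_of FS.
have FD : fock D := fockB FS (fockZ (conjc a ^+ n) Fg).
have lD := fock_L2_of FD.
have aE : conjc (conjc a ^+ n) = a ^+ n.
  by rewrite -{2}(conjcK a); exact: rmorphXn.
have ef : entire (fun z => D z * f0V z).
  by have /fock_L2[eD _] := FD; exact: entireM eD entire_f0V.
have FWD : fock (W D) by case: bW => FW _; exact: FW.
have WE : (fun z => W D z * f0V z) = (fun z => (fun w => D w * f0V w) (a * z)).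
  by apply/funext => z; rewrite Wf0V.
have WDg : inner (W D) g = a ^+ n * inner D g.
  rewrite -(Hg _ FWD) -(Hg _ FD) WE.
  exact: (@cmean_scale n (fun z => D z * f0V z) a ef a0).
have DD : inner D D = 0.
  have -> : inner D D = inner D (adjoint W g) - inner D (fun z => conjc a ^+ n * g z).
    exact: (innerBr lS (L2Z (conjc a ^+ n) lg) lD).
  by rewrite -(inner_adjoint FD Fg) WDg (innerZr _ lg lD) aE subrr.
have D0 : D = fun=> 0.
  by apply: fock_posdef => //; rewrite sqnorm_inner DD.
apply/funext => z; apply/eqP; rewrite -subr_eq0; apply/eqP.
exact: (congr1 (fun f => f z) D0).
Qed.

End WeightedComposition.
End Eigenvectors.

Theorem corollary3p4 (R : realType) (a u v : R[i]) (c : R)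
    (phi psi : R[i] -> R[i])
    (ha0 : 0 < `|a|) (ha1 : `|a| < 1) (hu : `|u| < 1 / 2)
    (hphi : phi = fun z => a * z)
    (hpsi : psi = fun z => cexp (u * z ^+ 2 + v * z))
    (hc : u / (1 - a ^+ 2) = c%:C) (hc0 : 0 <= c) (hc1 : c < 1 / 2)
    (hW : bounded_on_fock (wcomp psi phi)) :
  point_spectrum (wcomp psi phi) = [set a ^+ n | n in [set: nat]] /\
  point_spectrum (adjoint (wcomp psi phi)) =
    [set (conjc a) ^+ n | n in [set: nat]].
Proof.
have a0 : a != 0 by rewrite -normr_gt0.
have a1 : normc a < 1 by move: ha1; rewrite normE -(rmorph1 (real_complex R)) ltcR.
(* Since |a| < 1, the quotient in [hc] is a genuine one and can be cleared of its denominator. *)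
have a2 : 1 - a ^+ 2 != 0.
  rewrite subr_eq0; apply: contraTneq a1 => a21; rewrite -leNgt.
  rewrite -(ler_pXn2r (n := 2)) ?nnegrE ?normc_ge0 //.
  by rewrite expr1n -normcX -a21 Normc.normc1.
have uc : u = c%:C * (1 - a ^+ 2) by rewrite -hc divfK.
rewrite hphi hpsi in hW *; split.
- exact: wcomp_eigenvalue uc hc0 hc1.
- exact: adjoint_eigenvalue uc hc0 hc1 hW.
Qed.
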